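(* Let $p$ be a prime, $k\geq 0$ an integer, and let $V$ be a finite-dimensional complex representation of $\mathbb{Z}/p^{k+1}$ with $V^{\mathbb{Z}/p^{k+1}}=0$ and associated integers $m_0,\ldots,m_k$. Let $U$ be a complex $\mathbb{Z}/p^{k+1}$-module of dimension $n$ and let $$\overline{f}:S(U)\to V$$ be a $\mathbb{Z}/p^{k+1}$-map. If $m_k\neq 0$ and $n>\delta(V)$, then the covering dimension of the zero-set $\overline{Z}=\{v\in S(U)\mid\overline{f}(v)=0\}$ is at least $2(n-\delta(V)-1)$.
   Context: For $0\leq l\leq k$, $m_l=\dim_{\mathbb{C}}\big(V^{p^{k-l+1}\mathbb{Z}/p^{k+1}}/V^{p^{k-l}\mathbb{Z}/p^{k+1}}\big)$, where $p^{j}\mathbb{Z}/p^{k+1}$ denotes the subgroup of $\mathbb{Z}/p^{k+1}$ of order $p^{k+1-j}$ and superscripts denote fixed subspaces. If $m_k\neq 0$, then $\delta(V)=\sum_{l=0}^k p^l m_l-(p^k-1)$. $S(U)$ is the unit sphere in $U$ for an invariant inner product. *)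

(* Defs.v *)
From mathcomp Require Import all_boot all_order all_algebra all_fingroup.
From mathcomp Require Import mxrepresentation complex.
From mathcomp Require Import all_classical all_reals all_analysis.

Set Implicit Arguments.
Unset Strict Implicit.
Unset Printing Implicit Defensive.

Import Order.TTheory GRing.Theory Num.Theory.
Import numFieldNormedType.Exports.

Local Open Scope classical_set_scope.
Local Open Scope ring_scope.

(* R[i] carries no topology in its own right; viewed as a numClosedFieldType
   it inherits the one given by its norm. *)
Definition cplx (R : realType) : numClosedFieldType := R[i].

Section CoveringDimension.
Variable T : topologicalType.
Implicit Types A B : set (set T).

Definition open_cover A := (forall U, A U -> open U) /\ \bigcup_(U in A) U = setT.

Definition refines B A := forall V, B V -> exists2 U, A U & V `<=` U.

Definition multiplicity_le B (m : nat) :=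
  forall x : T, ([set V | B V /\ V x] #<= `I_m)%card.

Definition covering_dim_lt (m : nat) :=
  forall A, finite_set A -> open_cover A ->
    exists B, [/\ finite_set B, open_cover B, refines B A & multiplicity_le B m].

(* Equal to -1 exactly when T is empty, and to +oo when no bound exists. *)
Definition covering_dim (R : realType) : \bar R :=
  ereal_inf [set (m%:R - 1)%:E | m in covering_dim_lt].

End CoveringDimension.

(* A subset, as a space in its own right: the library's [subspace Z] will not
   do, since its carrier is all of T, with the points outside Z isolated. *)
Definition subset_space (T : topologicalType) (Z : set T) : topologicalType :=
  initial_topology (\val : Z -> T).

(* The additive group Z/p^(k+1), in the multiplicative notation of the group
   library; its representations act on row vectors, on the right. *)
Definition Zpk (p k : nat) : {group 'Z_(p ^ k.+1)} := [set: 'Z_(p ^ k.+1)]%G.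

Section Representations.
Variables (F : fieldType) (p k d : nat).
Variable rV : mx_representation F (Zpk p k) d.

Definition pow_subgroup (j : nat) : {set 'Z_(p ^ k.+1)} :=
  <[(p ^ j)%:R : 'Z_(p ^ k.+1)]>%g.

(* [in_factmod B A] is the image of the row space of A in the quotient of F^d
   by the row space of B, so that its rank is dim (A / B) when B <= A. *)
Definition rep_mult (l : nat) : nat :=
  \rank (in_factmod (rfix_mx rV (pow_subgroup (k - l)))
                    (rfix_mx rV (pow_subgroup (k - l + 1)))).

Definition rep_delta : int :=
  \sum_(l < k.+1) (p ^ l * rep_mult l)%:Z - ((p ^ k)%:Z - 1).

End Representations.

Section UnitSphere.
Variables (C : numClosedFieldType) (n : nat).

Definition invariant_form (gT : finGroupType) (G : {set gT})
    (rU : mx_representation C G n) (B : 'rV[C]_n -> 'rV[C]_n -> C) :=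
  forall g, g \in G -> forall u v, B (u *m rU g) (v *m rU g) = B u v.

Definition unit_sphere (B : 'rV[C]_n -> 'rV[C]_n -> C) : set 'rV[C]_n :=
  [set u | B u u = 1].

End UnitSphere.

(* Main.v *)
(** Suppose that the zero set Z has covering dimension less than 2r, where r = n - delta(V) - 1.
    After diagonalising U, the map x |-> (x_i^{e_i}) is equivariant from C^n, with the roots of
    unity acting by scalars, to U. Its fibres are finite, so the preimage of Z still has fine
    covers of multiplicity at most 2r, and general position yields an equivariant map h from C^n
    to C^r without zeros on this preimage. Together with f it gives an equivariant map without
    zeros from a sphere around 0 in C^n to V + C^r.

    Its Koszul matrix extends to a family of invertible hermitian matrices over the ball, constant
    on the boundary. Quantizing the n variables one at a time by Toeplitz matrices (Bott
    periodicity) shows that the difference of the graded signatures at the centre and on the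
    boundary, which is the product of the 1 - t^w over the weights w of V + C^r, is divisible by
    (1 - t)^n modulo t^{p^{k+1}} - 1. As some weight has p-valuation k, reduction modulo the
    cyclotomic polynomial bounds n - 1 by the sum of p^{v_p(w)} over the remaining weights, that
    is n <= delta(V) + r = n - 1. *)

Require Import Defs.
From mathcomp Require Import all_boot all_order all_algebra all_fingroup.
From mathcomp Require Import mxrepresentation complex.
From mathcomp Require Import spectral sesquilinear separable cyclic cyclotomic.
From mathcomp Require Import all_classical all_reals all_analysis.
From mathcomp Require Import zify ring lra.

Set Implicit Arguments.
Unset Strict Implicit.
Unset Printing Implicit Defensive.

Import Order.TTheory GRing.Theory Num.Theory.
Import numFieldNormedType.Exports.

Local Open Scope classical_set_scope.
Local Open Scope ring_scope.

(** * Divisibility by powers of 1 - t *)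

Section CyclotomicValuation.

Implicit Types (f g h : {poly int}) (p k l m n : nat).

(** Each quantized variable becomes a lattice of positions, and the position is added to the weight.
    At the bottom of the lattice the form is the one at the centre, at the top the one on the
    boundary, and in between it varies so slowly that a translation by one step does not affect
    signatures. Splitting off the bottom slice or the top slice computes one signature in two ways,
    and comparing the answers produces the factor 1 - t. The obstacle is analytic: a compression of
    an invertible matrix need not be invertible. A lower bound survives because the symbol is nearly
    a trigonometric polynomial in the angle with slowly varying coefficients, so it nearly preserves
    the range of the windowed Fourier transform. The term -(p^k - 1) of delta(V) comes from the
    factor of valuation k: it is divided by t^{p^k} - 1, which also divides t^{p^{k+1}} - 1, and so
    costs one power of 1 - t instead of p^k. The number 2r is the real dimension of C^r: values in
    general position are independent over the reals in groups of 2r, and weights subordinate to a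
    fine cover combine at most that many at a point. *)

Lemma divX1_cancel m f g h :
  f.[1] != 0 -> (1 - 'X) ^+ m * g = f * h ->
  exists2 h', h = (1 - 'X) ^+ m * h' & g = f * h'.
Proof.
move=> f1; elim: m g h => [|m IHm] g h E.
  by exists h; rewrite ?expr0 ?mul1r // -E expr0 mul1r.
have nz : 1 - 'X != 0 :> {poly int}.
  by rewrite -opprB oppr_eq0 -polyC1 polyXsubC_eq0.
(* [1 - 'X] generates the kernel of evaluation at 1, a prime ideal that does not contain [f], so it
   divides [h]. *)
have h1 : root h 1.
  have := congr1 (fun r => r.[1]) E; rewrite !hornerE subrr expr0n /= mul0r.
  by move/esym/eqP; rewrite mulf_eq0 (negPf f1).
have [h0 Eh] := factor_theorem h 1 h1.
have {}Eh : h = (1 - 'X) * (- h0) by rewrite Eh polyC1; ring.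
have [|h' Eh' Eg] := IHm g (- h0).
  by apply: (mulfI nz); rewrite mulrA -exprS E Eh; ring.
by exists h'; rewrite // Eh Eh' exprS; ring.
Qed.

Lemma poly_modp_eq0 p f : prime p ->
  map_poly (intr : int -> 'F_p) f = 0 -> exists g, f = p%:R * g.
Proof.
move=> pr_p f0; exists (\poly_(i < size f) (f`_i %/ p)%Z).
apply/polyP => i; rewrite -[p%:R]polyC_natr coefCM coef_poly.
have [lt_i | le_i] := ltnP; last by rewrite mulr0 nth_default.
have /(congr1 (fun r : {poly 'F_p} => r`_i)) := f0.
rewrite coef_map coef0 /= => fi0.
suff /divzK E: (p %| f`_i)%Z by rewrite mulrC natz E.
have pF: p \in [pchar 'F_p] by rewrite pchar_Fp.
rewrite /dvdz /=; case: (f`_i) fi0 => j /=.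
  by rewrite -pmulrn => /eqP; rewrite -(dvdn_pcharf pF).
rewrite NegzE mulrNz => /eqP; rewrite oppr_eq0 -pmulrn.
by rewrite -(dvdn_pcharf pF).
Qed.

Lemma Frobenius_1subX p l : prime p ->
  ((1 - 'X) ^+ (p ^ l) : {poly 'F_p}) = 1 - 'X^(p ^ l).
Proof.
move=> pr_p; have pP : p \in [pchar {poly 'F_p}] by rewrite pchar_poly pchar_Fp.
elim: l => [|l IHl]; first by rewrite !expn0 !expr1.
rewrite expnSr exprM IHl -(pFrobenius_autE pP) pFrobenius_autB_comm; last exact: mulrC.
by rewrite pFrobenius_aut1 pFrobenius_autE -exprM.
Qed.

(** For prime [p], the cyclotomic polynomial of order [p ^ k.+1]. *)
Definition Phi_pk p k : {poly int} := \sum_(j < p) 'X^(p ^ k) ^+ j.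

Lemma Phi_pk1 p k : (Phi_pk p k).[1] = p%:R.
Proof.
rewrite horner_sum (eq_bigr (fun=> 1)); last by move=> i _; rewrite !hornerE !expr1n.
by rewrite sumr_const card_ord.
Qed.

Lemma Phi_pkE p k : 'X^(p ^ k.+1) - 1 = ('X^(p ^ k) - 1) * Phi_pk p k.
Proof. by rewrite expnSr exprM subrX1. Qed.

(** Total ramification of [p] in the cyclotomic ring, kept at the level of polynomials: Frobenius
    gives the congruence modulo [p], and evaluation at 1, where [Phi_pk] is [p], gives [h.[1] =
    1]. *)
Lemma p_mod_Phi p k : prime p -> exists2 h, h.[1] = 1 &
  Phi_pk p k = (1 - 'X) ^+ (p ^ k * p.-1) * (-1) ^+ (p ^ k * p.-1) + p%:R * h.
Proof.
move=> pr_p; set e := (p ^ k * p.-1)%N.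
have [|h E] := @poly_modp_eq0 p (Phi_pk p k - (1 - 'X) ^+ e * (-1) ^+ e) pr_p.
  pose F := (map_poly (intr : int -> 'F_p)); apply/eqP.
  have nz : 1 - 'X^(p ^ k) != 0 :> {poly 'F_p}.
    rewrite -opprB oppr_eq0 -size_poly_eq0 size_XnsubC ?expn_gt0 ?prime_gt0 //.
  rewrite -(mulrI_eq0 _ (mulfI nz)).
  rewrite rmorphB /= rmorphM /= !rmorphXn /= rmorphB rmorph1 /= map_polyX rmorphN1.
  rewrite mulrBr; apply/eqP.
  have -> : (1 - 'X^(p ^ k)) * F (Phi_pk p k) = (1 - 'X^(p ^ k.+1)).
    rewrite /F rmorph_sum /= (eq_bigr (fun j : 'I_p => 'X^(p ^ k) ^+ j)); last first.
      by move=> j _; rewrite -!exprM rmorphXn /= map_polyX.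
    by rewrite -opprB mulNr -subrX1 -exprM -expnSr opprB.
  rewrite -!Frobenius_1subX // mulrA -exprD /e -mulnS prednK ?prime_gt0 // -expnSr.
  rewrite -[X in X - _]mulr1 -mulrBr; suff -> : 1 - (-1) ^+ (p ^ k * p.-1) = 0 :> {poly 'F_p}.
    by rewrite mulr0.
  (* For odd [p] the exponent is even, since [p - 1] is; in characteristic 2 the sign does not
     matter. *)
  case: (boolP (odd p)) => [odp|/(prime_oddPn pr_p) ->].
    by rewrite -signr_odd oddM -[in odd p.-1]subn1 oddB ?prime_gt0 // odp andbF subrr.
  rewrite -signr_odd; case: odd; rewrite ?subrr // expr1 opprK.
  by rewrite addrr_pchar2 // pchar_poly pchar_Fp.
exists h; last by rewrite -E; ring.
have := congr1 (fun r => r.[1]) E.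
rewrite !hornerE Phi_pk1 subrr expr0n /= muln_eq0 expn_eq0.
have p1 := prime_gt1 pr_p; have p0 := prime_gt0 pr_p.
rewrite !gtn_eqF ?andbF //=; last by lia.
rewrite mul0r subr0 -[p%:R in X in _ = X -> _]polyC_natr hornerC => Ep.
by apply: (@mulfI _ p%:R); rewrite ?pnatr_eq0 ?gtn_eqF // -Ep mulr1.
Qed.

(** In the cyclotomic ring [1 - 'X^a] has valuation [p ^ logn p a] with respect to [1 - 'X]:
    Frobenius shows it modulo [p], and multiplication by [h] turns the remaining multiple of [p]
    into a multiple of a power of [1 - 'X] at least as high. *)
Lemma factor_mod_Phi p k h a : prime p ->
    Phi_pk p k = (1 - 'X) ^+ (p ^ k * p.-1) * (-1) ^+ (p ^ k * p.-1) + p%:R * h ->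
    h.[1] = 1 -> (0 < a)%N -> (logn p a <= k)%N ->
  exists e d, [/\ h * (1 - 'X^a) = (1 - 'X) ^+ (p ^ logn p a) * e + Phi_pk p k * d
                & ~~ (p %| e.[1])%Z].
Proof.
move=> pr_p; set e0 := (p ^ k * p.-1)%N => EP h1 a0 lk.
set l := logn p a in lk *.
have [u pu Ea] : exists2 u, ~~ (p %| u)%N & a = (p ^ l * u)%N.
  by have [u co Ea] := pfactor_coprime pr_p a0; exists u; rewrite 1?mulnC // -prime_coprime.
have [|hl El] := @poly_modp_eq0 p (1 - 'X^(p ^ l) - (1 - 'X) ^+ (p ^ l)) pr_p.
  rewrite !rmorphB /= rmorph1 !rmorphXn /= rmorphB rmorph1 /= map_polyX.
  by rewrite Frobenius_1subX // subrr.
have p1 := prime_gt1 pr_p; have p0 := prime_gt0 pr_p.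
(* For [p = 2] and [l = k] the two powers of [1 - 'X] coincide, and the correction disappears at 1
   only because [hl] vanishes there. *)
have hl1 : hl.[1] = 0.
  have := congr1 (fun r => r.[1]) El.
  rewrite !hornerE expr1n subrr expr0n /= expn_eq0 gtn_eqF //= subrr.
  rewrite -[p%:R in X in _ = X -> _]polyC_natr hornerC => /esym/eqP.
  by rewrite mulf_eq0 pnatr_eq0 gtn_eqF //= => /eqP.
have le_e : (p ^ l <= e0)%N.
  by rewrite (leq_trans (leq_pexp2l _ lk)) // leq_pmulr //; lia.
pose U : {poly int} := \sum_(j < u) 'X^(p ^ l) ^+ j.
pose e := (h - (1 - 'X) ^+ (e0 - p ^ l) * (-1) ^+ e0 * hl) * U.
exists e, (hl * U); split.
  have EU : 1 - 'X^a = (1 - 'X^(p ^ l)) * U.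
    by rewrite Ea exprM -opprB subrX1 -mulNr opprB.
  have E2 : p%:R * h = Phi_pk p k - (1 - 'X) ^+ e0 * (-1) ^+ e0 by rewrite EP; ring.
  have E3 : (1 - 'X) ^+ e0 = (1 - 'X) ^+ (p ^ l) * (1 - 'X) ^+ (e0 - p ^ l) :> {poly int}.
    by rewrite -exprD subnKC.
  have E4 : 1 - 'X^(p ^ l) = (1 - 'X) ^+ (p ^ l) + p%:R * hl :> {poly int}.
    by rewrite -El; ring.
  rewrite EU E4 /e mulrA mulrDr [h * (p%:R * hl)]mulrA [h * p%:R]mulrC E2 E3.
  by ring.
have -> : e.[1] = u%:R.
  rewrite /e hornerM !hornerE hl1 h1 mulr0 subr0 mul1r horner_sum.
  rewrite (eq_bigr (fun=> 1)) ?sumr_const ?card_ord // => i _.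
  by rewrite !hornerE !expr1n.
by rewrite natz.
Qed.

Lemma prod_mod_Phi p k h (s : seq nat) : prime p ->
    Phi_pk p k = (1 - 'X) ^+ (p ^ k * p.-1) * (-1) ^+ (p ^ k * p.-1) + p%:R * h ->
    h.[1] = 1 -> (forall a, a \in s -> (0 < a)%N /\ (logn p a <= k)%N) ->
  exists e d, [/\ h ^+ size s * \prod_(a <- s) (1 - 'X^a)
     = (1 - 'X) ^+ (\sum_(a <- s) p ^ logn p a) * e + Phi_pk p k * d
                & ~~ (p %| e.[1])%Z].
Proof.
move=> pr_p EP h1; elim: s => [|a s IHs] Hs.
  exists 1, 0; rewrite !big_nil !hornerE; split=> //.
  by rewrite dvdz1 /=; apply: contraL pr_p => /eqP ->.
have [|e [d [E He]]] := IHs; first by move=> b bs; apply: Hs; rewrite inE bs orbT.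
have [|a0 la] := Hs a; first exact: mem_head.
have [e' [d' [E' He']]] := factor_mod_Phi pr_p EP h1 a0 la.
exists (e * e'), ((1 - 'X) ^+ (p ^ logn p a) * e' * d +
        d' * (h ^+ size s * \prod_(a <- s) (1 - 'X^a))); split.
  rewrite !big_cons /= exprS mulrACA E' exprD mulrDl.
  rewrite {1}E; ring.
rewrite hornerM dvdzE abszM Euclid_dvdM // negb_or.
by move: He He'; rewrite !dvdzE => -> ->.
Qed.

(** The factor of valuation [k] is a multiple of ['X^(p ^ k) - 1], which also divides
    ['X^(p ^ k.+1) - 1]; cancelling it costs a single [1 - 'X], because the cofactor [N] is nonzero
    at 1. Modulo [Phi_pk] the other factors together have valuation exactly [S], which bounds the
    remaining exponent. *)
Lemma Euler_class_valuation p k n (a0 : nat) (s : seq nat) (b c : {poly int}) :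
    prime p -> (0 < a0)%N -> logn p a0 = k ->
    (forall a, a \in s -> (0 < a)%N /\ (logn p a <= k)%N) ->
    (1 - 'X^a0) * \prod_(a <- s) (1 - 'X^a)
      = (1 - 'X) ^+ n * c + ('X^(p ^ k.+1) - 1) * b ->
  (n <= (\sum_(a <- s) p ^ logn p a).+1)%N.
Proof.
move=> pr_p a00 la0 Hs E; case: n E => [//|n] E; rewrite ltnS leqNgt.
apply/negP; set S := (\sum_(a <- s) _)%N => ltSn.
have [h h1 EP] := p_mod_Phi k pr_p.
have [e [d [Ed He]]] := prod_mod_Phi pr_p EP h1 Hs; rewrite -/S in Ed.
have [u pu Ea] : exists2 u, ~~ (p %| u)%N & a0 = (p ^ k * u)%N.
  have [u co Ea] := pfactor_coprime pr_p a00.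
  by exists u; rewrite 1?mulnC -?prime_coprime // -la0.
pose U : {poly int} := \sum_(j < u) 'X^(p ^ k) ^+ j.
have U1 : U.[1] = u%:R.
  rewrite horner_sum (eq_bigr (fun=> 1)) ?sumr_const ?card_ord // => i _.
  by rewrite !hornerE !expr1n.
have EU : 1 - 'X^a0 = - ('X^(p ^ k) - 1) * U.
  by rewrite Ea exprM -opprB subrX1 -mulNr.
pose N : {poly int} := \sum_(j < p ^ k) 'X^j.
have EN : 'X^(p ^ k) - 1 = ('X - 1) * N :> {poly int} by rewrite subrX1.
have N1 : N.[1] = (p ^ k)%:R.
  rewrite horner_sum (eq_bigr (fun=> 1)) ?sumr_const ?card_ord // => i _.
  by rewrite !hornerE !expr1n.
have p0 := prime_gt0 pr_p.
have nz : 1 - 'X != 0 :> {poly int}.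
  by rewrite -opprB oppr_eq0 -polyC1 polyXsubC_eq0.
set P := \prod_(a <- s) _ in E Ed.
have Ec : (1 - 'X) ^+ n * c = N * (U * P + Phi_pk p k * b).
  apply: (mulfI nz); rewrite mulrA -exprS.
  move: E; rewrite Phi_pkE EU EN => E.
  by rewrite -[LHS](addrK ((('X - 1) * N * Phi_pk p k) * b)) -E; ring.
have [|c' Ec' _] := divX1_cancel _ Ec.
  by rewrite N1 pnatr_eq0 expn_eq0 gtn_eqF.
have E2 : (1 - 'X) ^+ S * (U * e - h ^+ size s * (1 - 'X) ^+ (n - S) * c')
          = Phi_pk p k * (- (h ^+ size s * b + U * d)).
  rewrite mulrBr.
  have -> : (1 - 'X) ^+ S * (h ^+ size s * (1 - 'X) ^+ (n - S) * c')
      = h ^+ size s * ((1 - 'X) ^+ n * c').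
    by rewrite -{2}(subnKC (ltnW ltSn)) exprD; ring.
  rewrite -Ec'.
  have -> : (1 - 'X) ^+ S * (U * e) = U * (h ^+ size s * P - Phi_pk p k * d).
    by rewrite Ed; ring.
  by ring.
have [|d' _ Ed'] := divX1_cancel _ E2; first by rewrite Phi_pk1 pnatr_eq0 gtn_eqF.
have := congr1 (fun r => r.[1]) Ed'.
rewrite !hornerE Phi_pk1 U1 subrr expr0n /= subn_eq0 leqNgt ltSn /= mulr0 mul0r subr0.
(* At 1 all terms with a factor [1 - 'X] are gone, and [p] would divide a product of two integers
   prime to it. *)
move=> Ee; have : (p %| u%:R * e.[1])%Z by rewrite Ee natz dvdz_mulr.
by move: He; rewrite !dvdzE abszM Euclid_dvdM // natz (negPf pu) /= => /negPf ->.
Qed.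

End CyclotomicValuation.

(** * Signatures of hermitian forms *)

Section QuadraticForms.
Variable C : numClosedFieldType.
Implicit Types (I : finType) (g e : C).

Definition nrm2 I (u : I -> C) : C := \sum_i `|u i| ^+ 2.
Definition app I (A : I -> I -> C) (u : I -> C) : I -> C :=
  fun i => \sum_j A i j * u j.
Definition qform I (A : I -> I -> C) (u : I -> C) : C :=
  \sum_i (u i)^* * app A u i.
Definition lincomb I k (c : 'I_k -> C) (X : 'I_k -> I -> C) : I -> C :=
  fun i => \sum_a c a * X a i.

(** The margin [g] lets positivity survive a perturbation; for [0 <= g] the strict inequality also
    makes the vectors independent. *)
Definition posdim I (P : pred I) (A : I -> I -> C) g k : Prop :=
  exists X : 'I_k -> I -> C, (forall a i, ~~ P i -> X a i = 0) /\
    forall c : 'I_k -> C, (exists a, c a != 0) ->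
      g * nrm2 (lincomb c X) < qform A (lincomb c X).

Definition negA I (A : I -> I -> C) : I -> I -> C := fun i j => - A i j.

(* A nondegenerate hermitian form on the coordinates in [P] has [k] positive eigenvalues. *)
Definition signature I (P : pred I) (A : I -> I -> C) k : Prop :=
  exists l, [/\ (k + l = #|P|)%N, posdim P A 0 k & posdim P (negA A) 0 l].

Definition hermf I (A : I -> I -> C) := forall i j, A i j = (A j i)^*.

Lemma nrm2_ge0 I (u : I -> C) : 0 <= nrm2 u.
Proof. by apply: sumr_ge0 => i _; rewrite exprn_ge0. Qed.

Lemma eq_nrm2 I (u v : I -> C) : u =1 v -> nrm2 u = nrm2 v.
Proof. by move=> E; apply: eq_bigr => i _; rewrite E. Qed.

Lemma eq_app I (A : I -> I -> C) (u v : I -> C) : u =1 v -> app A u =1 app A v.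
Proof. by move=> E i; apply: eq_bigr => j _; rewrite E. Qed.

Lemma eq_qform I (A : I -> I -> C) (u v : I -> C) : u =1 v -> qform A u = qform A v.
Proof. by move=> E; apply: eq_bigr => i _; rewrite E (eq_app A E). Qed.

Lemma qform_negA I (A : I -> I -> C) u : qform (negA A) u = - qform A u.
Proof.
rewrite /qform -sumrN; apply: eq_bigr => i _; rewrite -mulrN; congr (_ * _).
by rewrite /app -sumrN; apply: eq_bigr => j _; rewrite mulNr.
Qed.

(** A positive subspace and a negative one meet only in 0; a relation between the stacked vectors
    would give a common nonzero element. *)
Lemma posdim_le_card I (P : pred I) (A : I -> I -> C) k l :
  posdim P A 0 k -> posdim P (negA A) 0 l -> (k + l <= #|P|)%N.
Proof.
move=> [X [XP Xpos]] [Y [YP Ypos]]; rewrite leqNgt; apply/negP => lt_P.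
pose Mx : 'M[C]_(k + l, #|P|) :=
  col_mx (\matrix_(a, j) X a (enum_val j)) (\matrix_(a, j) Y a (enum_val j)).
have : kermx Mx != 0.
  rewrite kermx_eq0 /row_free; apply: contraTneq lt_P => <-.
  by rewrite -leqNgt rank_leq_col.
rewrite -nz_row_eq0; set c := nz_row _ => c0.
have /sub_kermxP cM : (c <= kermx Mx)%MS by exact: nz_row_sub.
pose cX := lincomb (lsubmx c 0) X; pose cY := lincomb (rsubmx c 0) Y.
have E i : cX i = - cY i.
  case: (boolP (P i)) => Pi; last first.
    rewrite /cX /cY /lincomb !big1 ?oppr0 // => a _; rewrite ?(XP, YP) ?mulr0 //.
  apply/eqP; rewrite -addr_eq0; move/matrixP: cM => /(_ 0 (enum_rank_in Pi i)).
  rewrite -[c in c *m _]hsubmxK mul_row_col !mxE /cX /cY /lincomb => Ei.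
  apply/eqP; rewrite -[RHS]Ei; congr (_ + _); apply: eq_bigr => a _;
    by rewrite !mxE enum_rankK_in.
have EQ : qform A cX = qform A cY.
  rewrite (eq_qform A E); apply: eq_bigr => i _; rewrite rmorphN mulNr -mulrN.
  congr (_ * _); rewrite /app -sumrN; apply: eq_bigr => j _.
  by rewrite mulrN opprK.
have posX : lsubmx c != 0 -> 0 < qform A cX.
  move=> nz; have := Xpos (lsubmx c 0); rewrite mul0r; apply.
  by move/rV0Pn: nz.
have posY : rsubmx c != 0 -> 0 < - qform A cY.
  move=> nz; have := Ypos (rsubmx c 0); rewrite mul0r qform_negA; apply.
  by move/rV0Pn: nz.
case: (eqVneq (lsubmx c) 0) => [l0|/posX pX].
  have cX0 i : cX i = 0 by rewrite /cX /lincomb l0 big1 // => a _; rewrite mxE mul0r.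
  have: rsubmx c != 0.
    apply: contraNneq c0 => r0; rewrite -[c]hsubmxK l0 r0; apply/eqP.
    by rewrite row_mx0.
  move/posY; rewrite -EQ /qform big1 ?oppr0 ?ltxx // => i _.
  by rewrite cX0 rmorph0 mul0r.
case: (eqVneq (rsubmx c) 0) => [r0|/posY]; last first.
  by rewrite -EQ => /(addr_gt0 pX); rewrite subrr ltxx.
move: pX; rewrite EQ /qform big1 ?ltxx // => i _.
by rewrite /cY /lincomb r0 big1 ?rmorph0 ?mul0r // => a _; rewrite mxE mul0r.
Qed.

(** Sylvester's law of inertia: each positive space is set against the other negative one. *)
Lemma signature_uniq I (P : pred I) (A : I -> I -> C) k k' :
  signature P A k -> signature P A k' -> k = k'.
Proof.
move=> [l [Ek p n]] [l' [Ek' p' n']].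
have := posdim_le_card p n'; have := posdim_le_card p' n; lia.
Qed.

Lemma qform_real I (A : I -> I -> C) u : hermf A -> qform A u \is Num.real.
Proof.
move=> hA; apply/CrealP; rewrite rmorph_sum /=.
rewrite (eq_bigr (fun i => \sum_j u i * ((u j)^* * A j i))); last first.
  move=> i _; rewrite rmorphM /= conjCK rmorph_sum mulr_sumr /=.
  by apply: eq_bigr => j _; rewrite rmorphM /= -hA [A j i * _]mulrC.
rewrite exchange_big; apply: eq_bigr => j _; rewrite mulr_sumr.
by apply: eq_bigr => i _; ring.
Qed.

Lemma posdim_perturb I (P : pred I) (A A' : I -> I -> C) g k :
    hermf A -> hermf A' ->
    (forall u : I -> C, (forall i, ~~ P i -> u i = 0) ->
       `|qform A u - qform A' u| <= g * nrm2 u) ->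
  posdim P A g k -> posdim P A' 0 k.
Proof.
move=> hA hA' H [X [XP Xpos]]; exists X; split=> // c c0; rewrite mul0r.
have HX : forall i, ~~ P i -> lincomb c X i = 0.
  by move=> i Pi; rewrite /lincomb big1 // => a _; rewrite XP ?mulr0.
have {HX}/H := HX; have {Xpos} := Xpos c c0; set u := lincomb c X => lt1 le1.
have r : qform A u - qform A' u \is Num.real by rewrite rpredB ?qform_real.
have := le_lt_trans (le_trans (real_ler_norm r) le1) lt1.
by rewrite ltrBlDr ltrDl.
Qed.

Lemma posdim_weaken I (P : pred I) (A : I -> I -> C) g k :
  0 <= g -> posdim P A g k -> posdim P A 0 k.
Proof.
move=> g0 [X [XP Xpos]]; exists X; split=> // c /Xpos; rewrite mul0r.
by apply: le_lt_trans; rewrite mulr_ge0 // nrm2_ge0.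
Qed.

Lemma posdim_card I (P Q : pred I) (A : I -> I -> C) k l (kl : k = l) :
  P =1 Q -> posdim P A 0 k -> posdim Q A 0 l.
Proof. by case: l / kl => E [X [XP Xpos]]; exists X; split=> // a i; rewrite -E; exact: XP. Qed.

Lemma posdim_add I (P P1 P2 : pred I) (A : I -> I -> C) k1 k2 :
    (forall i, P i = P1 i || P2 i) ->
    (forall i j, P1 i -> P2 j -> A i j = 0 /\ A j i = 0) ->
    (forall i, ~~ (P1 i && P2 i)) ->
  posdim P1 A 0 k1 -> posdim P2 A 0 k2 -> posdim P A 0 (k1 + k2).
Proof.
move=> PE A0 dj [X [XP Xpos]] [Y [YP Ypos]].
exists (fun a => match fintype.split a with inl b => X b | inr b => Y b end).
split=> [a i|c c0].
  by rewrite PE negb_or => /andP[P1i P2i]; case: splitP => b _; [exact: XP|exact: YP].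
rewrite mul0r; set Z := (fun _ => _).
pose c1 b := c (lshift k2 b); pose c2 b := c (rshift k1 b).
have E i : lincomb c Z i = lincomb c1 X i + lincomb c2 Y i.
  rewrite /lincomb big_split_ord /=; congr (_ + _); apply: eq_bigr => b _; rewrite /Z.
    by rewrite -[lshift _ _]/(unsplit (inl b)) unsplitK.
  by rewrite -[rshift _ _]/(unsplit (inr b)) unsplitK.
set x := lincomb c1 X in E; set y := lincomb c2 Y in E.
have x0 i : ~~ P1 i -> x i = 0.
  by move=> Pi; rewrite /x /lincomb big1 // => a _; rewrite XP ?mulr0.
have y0 i : ~~ P2 i -> y i = 0.
  by move=> Pi; rewrite /y /lincomb big1 // => a _; rewrite YP ?mulr0.
have EA i : app A (lincomb c Z) i = app A x i + app A y i.
  by rewrite /app -big_split; apply: eq_bigr => j _; rewrite E mulrDr.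
have cross u v (Pu Pv : pred I) : (forall i, ~~ Pu i -> u i = 0) ->
   (forall i, ~~ Pv i -> v i = 0) -> (forall i j, Pu i -> Pv j -> A i j = 0) ->
   forall i, (u i)^* * app A v i = 0.
  move=> u0 v0 H i; case: (boolP (Pu i)) => [Pi|/u0->]; last by rewrite rmorph0 mul0r.
  rewrite /app big1 ?mulr0 // => j _.
  by case: (boolP (Pv j)) => [Pj|/v0->]; [rewrite H ?mul0r|rewrite mulr0].
have -> : qform A (lincomb c Z) = qform A x + qform A y.
  rewrite /qform -big_split; apply: eq_bigr => i _; rewrite E EA rmorphD /=.
  rewrite mulrDl !mulrDr (cross x y P1 P2) //; last by move=> a b /A0 H /H [].
  rewrite (cross y x P2 P1) //; last by move=> a b pa pb; have [] := A0 _ _ pb pa.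
  by rewrite add0r addr0.
have Qge0 k' (c' : 'I_k' -> C) X' : (forall c : 'I_k' -> C, (exists a, c a != 0) ->
      0 * nrm2 (lincomb c X') < qform A (lincomb c X')) -> 0 <= qform A (lincomb c' X').
  move=> H; case: (boolP [exists a, c' a != 0]) => [/existsP/H|].
    by rewrite mul0r => /ltW.
  rewrite negb_exists => /forallP c'0; rewrite /qform big1 // => i _.
  rewrite {1}/lincomb big1 ?rmorph0 ?mul0r // => a _.
  by move: (c'0 a); rewrite negbK => /eqP ->; rewrite mul0r.
case: c0 => a; rewrite -(splitK a); case: (fintype.split a) => b cb.
  rewrite ltr_pwDl ?Qge0 //; have := Xpos c1; rewrite mul0r; apply.
  by exists b.
rewrite addrC ltr_pwDl ?Qge0 //; have := Ypos c2; rewrite mul0r; apply.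
by exists b.
Qed.

Lemma card_predU_disj I (P P1 P2 : pred I) :
    (forall i, P i = P1 i || P2 i) -> (forall i, ~~ (P1 i && P2 i)) ->
  #|P| = (#|P1| + #|P2|)%N.
Proof.
move=> PE dj; rewrite -cardUI [X in (_ + X)%N]eq_card0 ?addn0; last first.
  by move=> i; rewrite !inE; apply/negbTE/dj.
by apply: eq_card => i; rewrite !inE -!topredE /= PE.
Qed.

Lemma signature_add I (P P1 P2 : pred I) (A : I -> I -> C) k1 k2 :
    (forall i, P i = P1 i || P2 i) ->
    (forall i j, P1 i -> P2 j -> A i j = 0 /\ A j i = 0) ->
    (forall i, ~~ (P1 i && P2 i)) ->
  signature P1 A k1 -> signature P2 A k2 -> signature P A (k1 + k2).
Proof.
move=> PE A0 dj [l1 [E1 p1 n1]] [l2 [E2 p2 n2]]; exists (l1 + l2)%N; split.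
- by rewrite (card_predU_disj PE dj) -E1 -E2; lia.
- exact: (posdim_add PE A0 dj p1 p2).
apply: (posdim_add PE _ dj n1 n2) => i j Pi Pj.
by rewrite /negA; have [-> ->] := A0 _ _ Pi Pj; rewrite oppr0.
Qed.

Lemma eq_signature I (P Q : pred I) (A : I -> I -> C) k :
  P =1 Q -> signature P A k -> signature Q A k.
Proof.
move=> E [l [El p n]]; exists l; split.
- by rewrite El; apply: eq_card => i; rewrite -!topredE /= E.
- exact: posdim_card p.
- exact: posdim_card n.
Qed.

Local Notation adj x := (map_mx (Num.conj : C -> C) x^T).

(** By the spectral theorem the lower bound keeps every squared eigenvalue at least [g], hence every
    eigenvalue beyond [e] in modulus; the eigenvectors of either sign, extended by 0 outside [P],
    then carry the margin [e]. *)
Lemma signature_exists I (P : pred I) (A : I -> I -> C) g e :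
    hermf A -> 0 <= e -> e ^+ 2 < g ->
    (forall u : I -> C, (forall i, ~~ P i -> u i = 0) ->
        g * nrm2 u <= \sum_(i | P i) `|app A u i| ^+ 2) ->
  exists k l, [/\ (k + l = #|P|)%N, posdim P A e k & posdim P (negA A) e l].
Proof.
move=> hA e0 eg gap; set n := #|P|.
pose Am : 'M[C]_n := \matrix_(i, j) A (enum_val i) (enum_val j).
have hAm : Am \is hermsymmx.
  by apply/is_hermitianmxP; rewrite scale1r; apply/matrixP => i j; rewrite !mxE -hA.
pose S := spectralmx Am; pose D := spectral_diag Am.
have uS : S \is unitarymx by exact: spectral_unitarymx.
have EAm : Am = (adj S) *m diag_mx D *m S.
  rewrite -[(adj S)](invmx_unitary uS); apply/orthomx_spectralP.
  exact: hermitian_normalmx.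
have SS : S *m (adj S) = 1%:M by apply/unitarymxP.
have SS' : (adj S) *m S = 1%:M by exact: mulmx1C.
have Dr a : D 0 a \is Num.real.
  by have /mxOverP := hermitian_spectral_diag_real hAm; apply.
pose dot (x y : 'cV[C]_n) := \sum_i (x i 0)^* * y i 0.
have dotE x y : dot x y = ((adj x) *m y) 0 0.
  by rewrite mxE; apply: eq_bigr => i _; rewrite !mxE.
have dotW x y : dot ((adj S) *m x) ((adj S) *m y) = dot x y.
  rewrite !dotE trmx_mul map_mxM !mulmxA -[_ *m _ *m (adj S)]mulmxA.
  have -> : (adj (adj S)) = S by apply/matrixP => i j; rewrite !mxE conjCK.
  by rewrite SS mulmx1.
pose vec (u : I -> C) : 'cV[C]_n := \col_j u (enum_val j).
have sumP0 (F : I -> C) : \sum_(i | P i) F i = \sum_(j < n) F (enum_val j).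
  by rewrite -(big_enum_val F); apply: eq_bigl => i; rewrite unfold_in.
have sumP (F : I -> C) : (forall i, ~~ P i -> F i = 0) ->
    \sum_i F i = \sum_(j < n) F (enum_val j).
  move=> F0; rewrite (bigID P) /= [X in _ + X]big1 ?addr0; last by move=> i /F0.
  exact: sumP0.
have appE u j : (forall i, ~~ P i -> u i = 0) ->
    app A u (enum_val j) = (Am *m vec u) j 0.
  move=> u0; rewrite /app sumP => [|i /u0 ->]; last by rewrite mulr0.
  by rewrite mxE; apply: eq_bigr => i _; rewrite !mxE.
have nrmE u : (forall i, ~~ P i -> u i = 0) -> nrm2 u = dot (vec u) (vec u).
  move=> u0; rewrite /nrm2 sumP => [|i /u0 ->]; last by rewrite normr0 expr0n.
  by apply: eq_bigr => i _; rewrite !mxE normCK mulrC.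
have qE u : (forall i, ~~ P i -> u i = 0) -> qform A u = dot (vec u) (Am *m vec u).
  move=> u0; rewrite /qform sumP => [|i /u0 ->]; last by rewrite rmorph0 mul0r.
  by apply: eq_bigr => i _; rewrite appE // [vec u _ _]mxE.
have gapE u : (forall i, ~~ P i -> u i = 0) ->
   \sum_(i | P i) `|app A u i| ^+ 2 = dot (Am *m vec u) (Am *m vec u).
  move=> u0; rewrite sumP0; apply: eq_bigr => i _.
  by rewrite appE // normCK mulrC.
pose ext (c : 'cV[C]_n) (i : I) := \sum_(j < n | enum_val j == i) ((adj S) *m c) j 0.
have ext0 c i : ~~ P i -> ext c i = 0.
  move=> Pi; rewrite /ext big1 // => j /eqP Ej; have := enum_valP j.
  by rewrite Ej -topredE /= (negPf Pi).
have vec_ext c : vec (ext c) = (adj S) *m c.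
  apply/colP => j; rewrite mxE /ext (big_pred1 j) // => j'.
  by rewrite /= (inj_eq enum_val_inj).
have Amv c : Am *m ((adj S) *m c) = (adj S) *m (diag_mx D *m c).
  by rewrite EAm !mulmxA -[_ *m S *m _]mulmxA SS mulmx1.
have Dgap a : g <= `|D 0 a| ^+ 2.
  have := gap (ext (delta_mx a 0)) (ext0 _).
  rewrite nrmE; last exact: ext0; rewrite gapE; last exact: ext0.
  rewrite vec_ext Amv !dotW /dot (bigD1 a) //= big1; last first.
    by move=> i /negPf ia; rewrite !mxE ia /= rmorph0 mul0r.
  rewrite (bigD1 a) //= big1; last first.
    move=> i /negPf ia; rewrite mxE (bigD1 a) //= !mxE ia mulr0n mul0r add0r big1 ?rmorph0 ?mul0r //.
    by move=> j /negPf ja; rewrite !mxE ja mulr0.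
  have -> : (diag_mx D *m delta_mx a 0) a (0 : 'I_1) = D 0 a.
    rewrite mxE (bigD1 a) //= !mxE !eqxx mulr1 big1 ?addr0 // => j /negPf ja.
    by rewrite !mxE ja mulr0.
  by rewrite !mxE !eqxx /= rmorph1 !mulr1 !addr0 mulr1 normCK mulrC.
(* The boolean selects the sign, so that one argument serves both [A] and [negA A]. *)
have half (B : I -> I -> C) (b : bool) :
    (forall u, qform B u = (-1) ^+ b * qform A u) ->
    posdim P B e #|[pred a : 'I_n | 0 < (-1) ^+ b * D 0 a]|.
  move=> EB; set Q := [pred a | _]; pose W (j : 'I_#|Q|) := ext (delta_mx (enum_val j : 'I_n) 0).
  exists W; split=> [a i|c [a ca]]; first exact: ext0.
  pose cc : 'cV[C]_n := \col_i \sum_(j : 'I_#|Q| | enum_val j == i) c j.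
  have EW : lincomb c W =1 ext cc.
    move=> i; rewrite /lincomb /ext.
    under eq_bigr do rewrite mulr_sumr.
    rewrite exchange_big; apply: eq_bigr => j _ /=.
    rewrite mxE.
    under [RHS]eq_bigr do rewrite [cc _ _]mxE mulr_sumr.
    rewrite (exchange_big_dep xpredT) //=; apply: eq_bigr => b' _.
    rewrite mxE mulr_sumr (bigD1 (enum_val b')) //= [X in _ + X]big1 ?addr0; last first.
      by move=> j' /negPf jb; rewrite !mxE jb mulr0 mulr0.
    rewrite (big_pred1 (enum_val b')); last by move=> i'; rewrite /= eq_sym.
    by rewrite !mxE !eqxx mulr1 mulrC.
  rewrite (eq_nrm2 EW) (eq_qform B EW) EB nrmE; last exact: ext0.
  rewrite qE; last exact: ext0.
  rewrite vec_ext Amv !dotW /dot !mulr_sumr.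
  have cc0 i : ~~ Q i -> cc i 0 = 0.
    move=> Qi; rewrite mxE big1 // => j /eqP Ej; case/negP: Qi.
    by have := enum_valP j; rewrite Ej.
  have DQ i : Q i -> e < (-1) ^+ b * D 0 i.
    rewrite inE => Di; rewrite -(@ltr_pXn2r _ 2) ?nnegrE ?(ltW Di) //.
    apply: (lt_le_trans eg); apply: (le_trans (Dgap i)).
    by rewrite exprMn sqrr_sign mul1r real_normK.
  have Edc i : (diag_mx D *m cc) i 0 = D 0 i * cc i 0.
    by rewrite mul_diag_mx mxE.
  have le_ccD i : e * ((cc i 0)^* * cc i 0)
     <= (-1) ^+ b * ((cc i 0)^* * (diag_mx D *m cc) i 0) ?= iff (cc i 0 == 0).
    have -> : (-1) ^+ b * ((cc i 0)^* * (diag_mx D *m cc) i 0)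
        = (-1) ^+ b * D 0 i * `|cc i 0| ^+ 2 by rewrite Edc normCK; ring.
    have -> : (cc i 0)^* * cc i 0 = `|cc i 0| ^+ 2 by rewrite normCK mulrC.
    case: (boolP (Q i)) => [/DQ lt_e|/cc0 ->]; last first.
      by apply/leifP; rewrite normr0 expr0n !mulr0 !eqxx.
    have [->|nz] := eqVneq (cc i 0) 0.
      by apply/leifP; rewrite normr0 expr0n !mulr0 ?eqxx.
    by apply/leifP; rewrite ltr_pM2r // exprn_gt0 // normr_gt0.
  rewrite (bigD1 (enum_val a)) //= [ltRHS](bigD1 (enum_val a)) //= ltr_leD //.
    rewrite (lt_leif (le_ccD _)) mxE (big_pred1 a) // => j.
    by rewrite /= (inj_eq enum_val_inj).
  by apply: ler_sum => i _; rewrite (le_ccD i).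
exists #|[pred a : 'I_n | 0 < (-1) ^+ false * D 0 a]|.
exists #|[pred a : 'I_n | 0 < (-1) ^+ true * D 0 a]|; split.
- rewrite -[RHS]card_ord -(cardC [pred a : 'I_n | 0 < (-1) ^+ false * D 0 a]).
  congr (_ + _)%N; apply: eq_card => a.
  have D0 : D 0 a != 0.
    apply: contraTneq (Dgap a) => ->; rewrite normr0 expr0n /=.
    apply/negP => g0.
    by have := le_lt_trans (exprn_ge0 2 e0) (lt_le_trans eg g0); rewrite ltxx.
  rewrite !inE expr0 mul1r expr1 mulN1r oppr_gt0.
  by rewrite -[RHS]real_leNgt ?real0 // lt_neqAle D0.
- by apply: half => u; rewrite expr0 mul1r.
by apply: half => u; rewrite qform_negA expr1 mulN1r.
Qed.

End QuadraticForms.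

(** * Toeplitz quantization *)

Section Inequalities.
Variable C : numClosedFieldType.

Lemma sqr_normD_le (x y : C) : `|x + y| ^+ 2 <= `|x| ^+ 2 *+ 2 + `|y| ^+ 2 *+ 2.
Proof.
apply: (@le_trans _ _ ((`|x| + `|y|) ^+ 2)).
  by rewrite ler_pXn2r ?nnegrE ?addr_ge0 // ler_normD.
have r: `|x| - `|y| \is Num.real by rewrite rpredB ?normr_real.
rewrite -subr_ge0; have := real_exprn_even_ge0 r (isT : ~~ odd 2).
by congr (_ <= _); ring.
Qed.

Lemma Young_le (e : C) (x y : C) : 0 < e ->
  `|x| * `|y| <= e * `|x| ^+ 2 + (4%:R * e)^-1 * `|y| ^+ 2.
Proof.
move=> e0; have r: e *+ 2 * `|x| - `|y| \is Num.real.
  by rewrite rpredB ?normr_real ?rpredM ?normr_real ?rpredMn ?gtr0_real.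
have e4 : 0 < (4%:R * e)^-1 by rewrite invr_gt0 mulr_gt0.
rewrite -subr_ge0; have := real_exprn_even_ge0 r (isT : ~~ odd 2).
rewrite -(pmulr_rge0 _ e4); congr (_ <= _).
by field; rewrite gt_eqF.
Qed.

Lemma sqr_norm_sum_le (I : finType) (F : I -> C) :
  `|\sum_i F i| ^+ 2 <= #|I|%:R * \sum_i `|F i| ^+ 2.
Proof.
apply: (@le_trans _ _ ((\sum_i `|F i|) ^+ 2)).
  by rewrite ler_pXn2r ?nnegrE ?sumr_ge0 // ler_norm_sum.
have H (x y : C) : `|x| * `|y| <= 2^-1 * `|x| ^+ 2 + 2^-1 * `|y| ^+ 2.
  have := Young_le x y (_ : 0 < 2^-1); rewrite invr_gt0 ltr0n => /(_ isT).
  by congr (_ <= _ + _ * _); field.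
rewrite expr2 mulr_suml.
apply: (@le_trans _ _ (\sum_i \sum_j (2^-1 * `|F i| ^+ 2 + 2^-1 * `|F j| ^+ 2))).
  by apply: ler_sum => i _; rewrite mulr_sumr; apply: ler_sum => j _.
rewrite (eq_bigr (fun i => #|I|%:R * (2^-1 * `|F i| ^+ 2) + \sum_j 2^-1 * `|F j| ^+ 2)).
  rewrite big_split /= sumr_const -!mulr_sumr -mulr_natl.
  by set S := \sum_i _; rewrite le_eqVlt; apply/orP; left; apply/eqP; field.
by move=> i _; rewrite big_split /= sumr_const mulr_natl.
Qed.

Lemma nrm2_sum_le (I J : finType) (F : J -> I -> C) :
  nrm2 (fun i => \sum_j F j i) <= #|J|%:R * \sum_j nrm2 (F j).
Proof.
rewrite /nrm2 exchange_big /= mulr_sumr; apply: ler_sum => i _.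
exact: sqr_norm_sum_le.
Qed.

Lemma nrm2D_le (I : finType) (u v : I -> C) :
  nrm2 (fun i => u i + v i) <= nrm2 u *+ 2 + nrm2 v *+ 2.
Proof.
by rewrite /nrm2 -!sumrMnl -big_split; apply: ler_sum => i _; exact: sqr_normD_le.
Qed.

(* Entrywise bounds suffice, since only one matrix size is in play at a time. *)
Lemma nrm2_app_le (I : finType) (A : I -> I -> C) (u : I -> C) (e : C) :
  (forall i j, `|A i j| ^+ 2 <= e) -> nrm2 (app A u) <= #|I|%:R ^+ 2 * e * nrm2 u.
Proof.
move=> Ae; have : \sum_(i : I) #|I|%:R * \sum_j e * `|u j| ^+ 2 = #|I|%:R ^+ 2 * e * nrm2 u.
  by rewrite sumr_const -mulr_sumr -mulr_natl /nrm2; ring.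
move=> <-; apply: ler_sum => i _; apply: le_trans (sqr_norm_sum_le _) _.
rewrite ler_wpM2l // ?ler0n //; apply: ler_sum => j _.
by rewrite normrM exprMn ler_wpM2r // exprn_ge0.
Qed.

End Inequalities.

Section Fourier.
Variables (C : numClosedFieldType) (L : nat) (w : C).
Hypothesis Lw : L.-primitive_root w.

Lemma L_gt0 : (0 < L)%N. Proof. exact: prim_order_gt0 Lw. Qed.

Lemma norm_w n : `|w ^+ n| = 1.
Proof.
rewrite normrX; suff -> : `|w| = 1 by rewrite expr1n.
have := congr1 (fun x : C => `|x|) (prim_expr_order Lw); rewrite normrX normr1.
by move/eqP; rewrite pexpr_eq1 ?L_gt0 // => /eqP.
Qed.

Lemma wconjK n : w ^+ n * (w ^+ n)^* = 1.
Proof. by rewrite -normCK norm_w expr1n. Qed.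

Lemma sum_characters (a b : nat) :
  \sum_(t < L) w ^+ (a * t) * (w ^+ (b * t))^* = if a == b %[mod L] then L%:R else 0.
Proof.
pose z := w ^+ a * (w ^+ b)^*.
rewrite (eq_bigr (fun t : 'I_L => z ^+ t)); last first.
  by move=> t _; rewrite exprMn -rmorphXn -!exprM.
have zE : (z == 1) = (a == b %[mod L]).
  have nz : (w ^+ b)^* != 0 by rewrite -normr_eq0 norm_conjC norm_w oner_eq0.
  by rewrite -(eq_prim_root_expr Lw) -[RHS](inj_eq (mulIf nz)) wconjK.
rewrite -zE; case: eqVneq => [->|z1].
  by rewrite (eq_bigr (fun=> 1)) ?sumr_const ?card_ord // => t _; rewrite expr1n.
apply: (mulfI (_ : z - 1 != 0)); first by rewrite subr_eq0.
rewrite -subrX1 mulr0 exprMn -rmorphXn -!exprM ![(_ * L)%N]mulnC !exprM.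
by rewrite (prim_expr_order Lw) !expr1n rmorph1 mulr1 subrr.
Qed.

(** Characters are orthogonal as long as the support of [c] has distinct residues modulo [L]; the
    index set itself may be longer than [L]. *)
Lemma Parseval n (c : 'I_n -> C) :
  (forall a b : 'I_n, c a != 0 -> c b != 0 -> a = b %[mod L] -> a = b) ->
  \sum_(t < L) `|\sum_(a < n) (w ^+ (a * t))^* * c a| ^+ 2 = L%:R * \sum_a `|c a| ^+ 2.
Proof.
move=> inj; rewrite mulr_sumr.
transitivity (\sum_(t < L) \sum_(a < n) \sum_(b < n)
    (c a * (c b)^*) * (w ^+ (b * t) * (w ^+ (a * t))^*)).
  apply: eq_bigr => t _; rewrite normCK mulr_suml; apply: eq_bigr => a _.
  rewrite rmorph_sum mulr_sumr; apply: eq_bigr => b _.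
  by rewrite rmorphM /= conjCK; ring.
rewrite exchange_big; apply: eq_bigr => a _ /=.
rewrite exchange_big (bigD1 a) //= [X in _ + X]big1 ?addr0; last first.
  move=> b ba; rewrite -mulr_sumr sum_characters.
  case: (eqVneq (c a) 0) => [->|ca]; first by rewrite mul0r mul0r.
  case: (eqVneq (c b) 0) => [->|cb]; first by rewrite rmorph0 mulr0 mul0r.
  case: eqP => [/inj E|_]; last by rewrite mulr0.
  by rewrite E ?eqxx in ba.
by rewrite -mulr_sumr sum_characters eqxx normCK mulrC.
Qed.

End Fourier.

Lemma big_triple (C : zmodType) (A B I : finType) (F : A * B * I -> C) :
  \sum_k F k = \sum_a \sum_b \sum_i F (a, b, i).
Proof.
by rewrite pair_bigA pair_bigA; apply: eq_bigr => [[[a b] i]].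
Qed.

Lemma big_pair (C : zmodType) (A B : finType) (F : A * B -> C) :
  \sum_k F k = \sum_a \sum_b F (a, b).
Proof. by rewrite pair_bigA; apply: eq_bigr => [[a b]]. Qed.

Lemma count_interval (N lo hi : nat) :
  (\sum_(b < N) (lo < b <= hi : nat) = minn hi N.-1 - lo)%N.
Proof.
elim: N => [|N IHN]; first by rewrite big_ord0 /=; lia.
rewrite big_ord_recr /= IHN.
by case: (ltnP lo N); case: (leqP N hi); lia.
Qed.

Section Toeplitz.
Variables (C : numClosedFieldType) (L m Q : nat) (w : C).
Hypotheses (Lw : L.-primitive_root w) (m_gt0 : (0 < m)%N) (Q_gt0 : (0 < Q)%N).
Local Notation T := (m + Q)%N.
Local Notation NB := (m + Q + m).+1.

(* The windows [b - m, b) cover the lattice [0, m + Q); the radius vanishes on every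
   window that meets the point 0 and equals 1 on every window that meets the last point. *)
Definition rho (b : nat) : C := (minn (b - m) Q)%:R / Q%:R.
Definition pt (b t : nat) : C := rho b * w ^+ t.
Definition win (a b : nat) : bool := (a < b <= a + m)%N.

Variable I : finType.
Local Notation X := (I * 'I_T)%type.
Local Notation K := ('I_NB * 'I_L * I)%type.
Implicit Types (M : C -> I -> I -> C) (u : X -> C).

(** Quantization by windowed Fourier analysis: [b] is the place of a window, hence a radius, and [t]
    an angle; the entry averages the symbol over the windows that contain both positions. *)
Definition toep M (x y : X) : C :=
  (m * L)%:R^-1 * \sum_(b < NB) \sum_(t < L)
     (win x.2 b && win y.2 b)%:R *
       (M (pt b t) x.1 y.1 * (w ^+ (x.2 * t) * (w ^+ (y.2 * t))^*)).

Definition Jt u (k : K) : C :=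
  \sum_(a < T) (w ^+ (a * k.1.2))^* * ((win a k.1.1)%:R * u (k.2, a)).

Definition MJt M u (k : K) : C :=
  \sum_i M (pt k.1.1 k.1.2) k.2 i * Jt u (k.1, i).

Lemma win_mod (a a' b : nat) : (m <= L)%N -> win a b -> win a' b ->
  a = a' %[mod L] -> a = a'.
Proof.
move=> mL; rewrite /win => /andP[lt1 le1] /andP[lt2 le2] /eqP.
wlog le : a a' lt1 le1 lt2 le2 / (a <= a')%N.
  move=> H; case: (leqP a a') => [/H|/ltnW le E]; first exact.
  by apply/esym/H => //; rewrite eq_sym.
rewrite eq_sym eqn_mod_dvd // => /dvdn_leq.
case: (posnP (a' - a)) => [|gt0 /(_ isT)]; first by lia.
by lia.
Qed.

Lemma card_win (a : 'I_T) : \sum_(b < NB) (win a b)%:R = m%:R :> C.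
Proof.
rewrite -natr_sum count_interval; congr _%:R.
by have := ltn_ord a; rewrite /=; lia.
Qed.

(** Inside one window the positions are distinct modulo [L], so Parseval applies window by window,
    and each position lies in exactly [m] windows. *)
Lemma Jt_norm u : (m <= L)%N -> nrm2 (Jt u) = (m * L)%:R * nrm2 u.
Proof.
move=> mL; rewrite /nrm2 big_triple.
transitivity (\sum_(b < NB) \sum_i L%:R * \sum_(a < T) `|(win a b)%:R * u (i, a)| ^+ 2).
  apply: eq_bigr => b _; rewrite exchange_big; apply: eq_bigr => i _ /=.
  rewrite /Jt /= (Parseval Lw) // => a a'; rewrite !mulf_eq0 !negb_or !pnatr_eq0 !eqb0 !negbK.
  by move=> /andP[wa _] /andP[wb _] /(win_mod mL wa wb)/val_inj.
rewrite exchange_big big_pair mulr_sumr /=.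
apply: eq_bigr => i _; rewrite -mulr_sumr exchange_big natrM [m%:R * _]mulrC -mulrA.
congr (_ * _); rewrite mulr_sumr; apply: eq_bigr => a _ /=.
rewrite -(card_win a) mulr_suml; apply: eq_bigr => b _.
by rewrite normrM exprMn normr_nat -natrX; case: win; rewrite ?mulr1 ?mul1r ?mulr0 ?mul0r.
Qed.

Lemma toep_herm M : (forall x, hermf (M x)) -> hermf (toep M).
Proof.
move=> hM x y; rewrite /toep [RHS]rmorphM /=; congr (_ * _).
  by rewrite conj_Creal // rpredV realn.
rewrite rmorph_sum; apply: eq_bigr => b _; rewrite rmorph_sum; apply: eq_bigr => t _.
rewrite !rmorphM /= rmorph_nat conjCK -hM andbC; congr (_ * (_ * _)).
by rewrite mulrC.
Qed.

(* The matrix is [Jt^* M Jt], up to scaling. *)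
Lemma toep_adjoint M (z u : X -> C) :
  (m * L)%:R * \sum_x (z x)^* * app (toep M) u x = \sum_k (Jt z k)^* * MJt M u k.
Proof.
have mL0 : (m * L)%:R != 0 :> C.
  by rewrite pnatr_eq0 muln_eq0 !gtn_eqF // (prim_order_gt0 Lw).
rewrite mulr_sumr.
rewrite (eq_bigr (fun x => \sum_(b < NB) \sum_(t < L) (z x)^* * (win x.2 b)%:R * w ^+ (x.2 * t)
   * (\sum_i M (pt b t) x.1 i * Jt u (b, t, i)))); last first.
  move=> x _; rewrite mulrCA /app.
  transitivity ((z x)^* * \sum_(y : X) \sum_(b < NB) \sum_(t < L)
       (win x.2 b && win y.2 b)%:R *
       (M (pt b t) x.1 y.1 * (w ^+ (x.2 * t) * (w ^+ (y.2 * t))^*)) * u y).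
    congr (_ * _); rewrite mulr_sumr; apply: eq_bigr => y _.
    rewrite /toep mulrA mulVKf // mulr_suml; apply: eq_bigr => b _.
    by rewrite mulr_suml.
  rewrite exchange_big /= mulr_sumr; apply: eq_bigr => b _.
  rewrite exchange_big /= mulr_sumr; apply: eq_bigr => t _.
  rewrite -!mulrA; congr (_ * _); rewrite big_pair !mulr_sumr; apply: eq_bigr => i _.
  rewrite /Jt !mulr_sumr; apply: eq_bigr => a _ /=.
  by case: (win x.2 b); case: (win a b); rewrite /= ?mul0r ?mul1r ?mulr0; ring.
rewrite exchange_big big_triple; apply: eq_bigr => b _ /=.
rewrite exchange_big; apply: eq_bigr => t _ /=.
rewrite big_pair; apply: eq_bigr => i _ /=; rewrite -mulr_suml; congr (_ * _).
rewrite /Jt rmorph_sum; apply: eq_bigr => a _ /=.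
by rewrite !rmorphM /= conjCK rmorph_nat; ring.
Qed.

(** The Fourier coefficient of frequency [s - s'] of the symbol on the circle of radius [rho b]; a
    pair of indices keeps all exponents natural numbers. *)
Definition Mhat M (s s' b : nat) (i j : I) : C :=
  L%:R^-1 * \sum_(f < L) M (pt b f) i j * ((w ^+ (s * f))^* * w ^+ (s' * f)).

(** Grouping the pairs by their difference yields the triangular weights of the Fejer mean. *)
Definition Fejer M (B b t : nat) (i j : I) : C :=
  B%:R^-1 * \sum_(s < B) \sum_(s' < B) w ^+ (s * t) * (w ^+ (s' * t))^* * Mhat M s s' b i j.

Lemma L_neq0 : L%:R != 0 :> C.
Proof. by rewrite pnatr_eq0 gtn_eqF // (prim_order_gt0 Lw). Qed.

Definition Fker (B t f : nat) : C :=
  B%:R^-1 * `|\sum_(s < B) (w ^+ t * (w ^+ f)^*) ^+ s| ^+ 2.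

Lemma Fejer_kernel M B b t i j :
  Fejer M B b t i j = L%:R^-1 * \sum_(f < L) Fker B t f * M (pt b f) i j.
Proof.
rewrite /Fejer /Mhat.
transitivity (B%:R^-1 * (L%:R^-1 * \sum_(f < L) (\sum_(s < B) \sum_(s' < B)
   (w ^+ (s * t) * (w ^+ (s' * t))^* * ((w ^+ (s * f))^* * w ^+ (s' * f)))) * M (pt b f) i j)).
  congr (_ * _); rewrite mulr_sumr.
  under [RHS]eq_bigr do rewrite mulr_suml mulr_sumr.
  rewrite [RHS]exchange_big /=; apply: eq_bigr => s _.
  under [RHS]eq_bigr do rewrite mulr_suml mulr_sumr.
  rewrite [RHS]exchange_big /=; apply: eq_bigr => s' _.
  by rewrite !mulr_sumr; apply: eq_bigr => f _; ring.
rewrite mulrCA; congr (_ * _); rewrite mulr_sumr; apply: eq_bigr => f _.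
rewrite mulrA; congr (_ * _ * _); rewrite normCK mulr_suml; apply: eq_bigr => s _.
rewrite rmorph_sum mulr_sumr; apply: eq_bigr => s' _.
by rewrite !exprMn rmorphM /= -!rmorphXn /= conjCK -!exprM ![(_ * s)%N]mulnC ![(_ * s')%N]mulnC; ring.
Qed.

Lemma Fker_sum B t : (0 < B <= L)%N -> \sum_(f < L) Fker B t f = L%:R.
Proof.
move=> /andP[B0 BL]; rewrite -mulr_sumr.
have B0' : B%:R != 0 :> C by rewrite pnatr_eq0 gtn_eqF.
apply: (mulfI B0'); rewrite mulVKf //.
transitivity (\sum_(f < L) `|\sum_(s < B) (w ^+ (s * f))^* * w ^+ (s * t)| ^+ 2).
  apply: eq_bigr => f _; congr (`|_| ^+ 2); apply: eq_bigr => s _.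
  by rewrite exprMn -rmorphXn -!exprM ![(_ * s)%N]mulnC mulrC.
rewrite (Parseval Lw) => [|a b _ _]; last first.
  by rewrite !modn_small ?(leq_trans (ltn_ord _) BL) // => /val_inj.
rewrite (eq_bigr (fun=> 1)) ?sumr_const ?card_ord 1?mulrC // => s _.
by rewrite (norm_w Lw) expr1n.
Qed.

(** The factor [g - 1] telescopes the geometric sum to [g ^+ B - 1], of norm at most 2. *)
Lemma Fker_moment B t f : (0 < B)%N ->
  Fker B t f * `|w ^+ t - w ^+ f| ^+ 2 <= 4%:R / B%:R.
Proof.
move=> B0; set g := w ^+ t * (w ^+ f)^*.
have gE : g * w ^+ f = w ^+ t by rewrite /g mulrAC -mulrA (wconjK Lw) mulr1.
have -> : `|w ^+ t - w ^+ f| = `|g - 1|.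
  by rewrite -gE -{2}[w ^+ f]mul1r -mulrBl normrM (norm_w Lw) mulr1.
rewrite /Fker -mulrA -exprMn -normrM [_ * (g - 1)]mulrC -subrX1 mulrC.
rewrite ler_wpM2r ?invr_ge0 ?ler0n //.
have : `|g ^+ B - 1| <= 2.
  rewrite (le_trans (ler_normB _ _)) // normr1 normrX /g normrM norm_conjC !(norm_w Lw).
  by rewrite mul1r expr1n.
move=> le2; have -> : 4%:R = 2 ^+ 2 :> C by rewrite -natrX.
by rewrite ler_pXn2r ?nnegrE ?ler0n.
Qed.

Lemma Fker_ge0 B t f : 0 <= Fker B t f.
Proof. by rewrite mulr_ge0 ?invr_ge0 ?ler0n ?exprn_ge0. Qed.

Lemma rho_ge0 b : 0 <= rho b.
Proof. by rewrite mulr_ge0 ?invr_ge0 ?ler0n. Qed.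

Lemma rho_le1 b : rho b <= 1.
Proof. by rewrite ler_pdivrMr ?ltr0n // mul1r ler_nat geq_minr. Qed.

Lemma norm_pt b t : `|pt b t| = rho b.
Proof. by rewrite normrM (norm_w Lw) mulr1 ger0_norm ?rho_ge0. Qed.

(** Continuity is assumed with a quadratic modulus because this integrates directly against the
    Fejer kernel, whose mass and second moment are under control. *)
Lemma Fejer_approx M B b t i j (e k : C) : (0 < B <= L)%N -> 0 <= k ->
    (forall x y, `|x| <= 1 -> `|y| <= 1 -> `|M x i j - M y i j| <= e + k * `|x - y| ^+ 2) ->
  `|M (pt b t) i j - Fejer M B b t i j| <= e + k * (4%:R / B%:R).
Proof.
move=> BL k0 H; rewrite Fejer_kernel.
have -> : M (pt b t) i j - L%:R^-1 * \sum_(f < L) Fker B t f * M (pt b f) i j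
   = L%:R^-1 * \sum_(f < L) Fker B t f * (M (pt b t) i j - M (pt b f) i j).
  apply: (mulfI L_neq0); rewrite mulrBr !mulVKf ?L_neq0 // -{1}(Fker_sum t BL).
  by rewrite mulr_suml -sumrB; apply: eq_bigr => f _; rewrite mulrBr.
rewrite normrM ger0_norm ?invr_ge0 ?ler0n // ler_pdivrMl; last first.
  by rewrite ltr0n (prim_order_gt0 Lw).
rewrite (le_trans (ler_norm_sum _ _ _)) //.
apply: (@le_trans _ _ (\sum_(f < L) (Fker B t f * e + k * (4%:R / B%:R)))); last first.
  rewrite big_split /= -mulr_suml (Fker_sum t BL) sumr_const card_ord mulrDr.
  by rewrite -[X in _ + X <= _]mulr_natl.
apply: ler_sum => f _; rewrite normrM (ger0_norm (Fker_ge0 _ _ _)).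
have /andP[B0 _] := BL.
apply: (@le_trans _ _ (Fker B t f * (e + k * `|w ^+ t - w ^+ f| ^+ 2))).
  rewrite ler_wpM2l ?Fker_ge0 // (le_trans (H _ _ _ _)) ?norm_pt ?rho_le1 //.
  rewrite lerD2l ler_wpM2l // /pt -mulrBr normrM exprMn.
  by rewrite ler_piMl ?exprn_ge0 // ger0_norm ?rho_ge0 // exprn_ile1 ?rho_ge0 ?rho_le1.
by rewrite mulrDr lerD2l mulrCA ler_wpM2l // Fker_moment.
Qed.

End Toeplitz.

Lemma sum_shift (C : nzRingType) (T s N : nat) (F : nat -> C) :
  \sum_(a < T) (N == a + s)%N%:R * F a = if (s <= N)%N && (N - s < T)%N then F (N - s)%N else 0.
Proof.
case: ifP => [/andP[le lt]|H].
  rewrite (bigD1 (Ordinal lt)) //= subnK // eqxx mul1r big1 ?addr0 // => a.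
  rewrite -val_eqE /= => ne; case: eqP => [E|]; last by rewrite mul0r.
  by case/eqP: ne; rewrite E addnK.
rewrite big1 // => a _; case: eqP => [E|]; last by rewrite mul0r.
by move: H; rewrite E leq_addl addnK ltn_ord.
Qed.

Lemma count_shift_interval (N c lo hi : nat) :
  (\sum_(b < N) (lo < b + c <= hi : nat) <= hi - lo)%N.
Proof.
suff: (\sum_(b < N) (lo < b + c <= hi : nat) <= minn hi (N + c).-1 - lo)%N by lia.
elim: N => [|N IHN]; first by rewrite big_ord0.
rewrite big_ord_recr /=; move: IHN; set S := bigop _ _ _.
by case: (ltnP lo (N + c)); case: (leqP (N + c) hi) => /=; lia.
Qed.

(** * Trigonometric monomials as shifts of the lattice *)

Section ToeplitzShift.
Variables (C : numClosedFieldType) (L m Q : nat) (w : C).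
Hypotheses (Lw : L.-primitive_root w) (m_gt0 : (0 < m)%N) (Q_gt0 : (0 < Q)%N).
Local Notation T := (m + Q)%N.
Local Notation NB := (m + Q + m).+1.
Variable I : finType.
Local Notation X := (I * 'I_T)%type.
Local Notation K := ('I_NB * 'I_L * I)%type.
Local Notation Jt := (@Jt C L m Q w I).
Local Notation win := (win m).
Variables (M : C -> I -> I -> C) (u : X -> C) (s s' B : nat) (h k : C).
Hypotheses (sB : (s < B)%N) (sB' : (s' < B)%N) (LB : (m + 2 * B <= L)%N).
Hypotheses (k_ge0 : 0 <= k) (h_ge0 : 0 <= h).
Local Notation Mh := (Mhat L m Q w M s s').
Hypothesis Mh_bound : forall b i j, `|Mh b i j| <= k.
Hypothesis Mh_slow : forall b b' i j, (b <= b' + (m + B))%N -> (b' <= b + (m + B))%N ->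
  `|Mh b i j - Mh b' i j| <= h.
Hypothesis Mh_end : s != s' -> forall b i j, (b <= m)%N || (T <= b)%N -> Mh b i j = 0.

(** What multiplication by the monomial of frequency [s - s'] becomes on the lattice: a shift, with
    the coefficient read at the position itself instead of at the window. *)
Definition shift_term (x : X) : C :=
  \sum_(a < T) (a + s' == x.2 + s)%N%:R * \sum_j Mh x.2 x.1 j * u (j, a).

Definition shift_win (a b : nat) := (a + s' < b + s <= a + s' + m)%N.

(** The discrepancy between applying the monomial after the transform and before it, as a
    coefficient of [u (j, a)] once the common phases are removed. *)
Definition shift_coef (b a : nat) (i j : I) : C :=
  (win a b)%:R * Mh b i j - \sum_(a' < T) (a + s' == a' + s)%N%:R * ((win a' b)%:R * Mh a' i j).

(** In both windows only the slow variation of the coefficient counts; where the windows disagree,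
    only its size. *)
Definition shift_kap (a b : nat) : C :=
  if win a b && shift_win a b then h ^+ 2
  else if win a b || shift_win a b then k ^+ 2 else 0.

Lemma shift_coef_le b (a : 'I_T) i j : `|shift_coef b a i j| ^+ 2 <= shift_kap a b.
Proof.
rewrite /shift_coef (@sum_shift _ _ _ _ (fun a' => (win a' b)%:R * Mh a' i j)).
have lta := ltn_ord a.
set c := (s <= a + s')%N && _.
have winE : c -> win (a + s' - s) b = shift_win a b.
  by rewrite /c /win /shift_win; lia.
have sq (x y : C) : `|x| <= y -> `|x| ^+ 2 <= y ^+ 2.
  by move=> H; rewrite ler_pXn2r ?nnegrE // (le_trans _ H).
rewrite /shift_kap; case: (boolP (win a b)) => wa /=.
  rewrite mul1r; case: (boolP (shift_win a b)) => wb.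
    apply: sq; case: (boolP c) => cc.
      rewrite winE // wb mul1r; apply: Mh_slow.
        by move: cc wb wa; rewrite /c /win /shift_win; lia.
      by move: cc wb wa; rewrite /c /win /shift_win; lia.
    (* The shifted position has left the lattice: the window is within [m + B] of an end, where the
       coefficient vanishes, so slow variation still gives the bound [h]. *)
    have ss : s != s' by apply: contra cc; rewrite /c => /eqP ->; lia.
    rewrite subr0; have [lt|ge] := ltnP (a + s') s.
      rewrite -[Mh b i j]subr0 -(@Mh_end ss m i j) ?leqnn //.
      by apply: Mh_slow; move: wa; rewrite /win; lia.
    rewrite -[Mh b i j]subr0 -(@Mh_end ss T i j) ?leqnn ?orbT //.
    by apply: Mh_slow; move: wa cc; rewrite /win /c; lia.
  apply: sq; case: ifP => [/winE ->|_]; last by rewrite subr0.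
  by rewrite (negPf wb) mul0r subr0.
rewrite mul0r sub0r normrN; case: (boolP (shift_win a b)) => wb.
  apply: sq; case: ifP => [/winE ->|_]; last by rewrite normr0.
  by rewrite wb mul1r.
case: ifP => [/winE ->|_]; last by rewrite normr0 expr0n.
by rewrite (negPf wb) mul0r normr0 expr0n.
Qed.

(** The window and its shift differ only within [B] of the two end points, which leaves at most
    [4 * B] values of [b] for the coarse bound [k]. *)
Lemma shift_kap_sum (a : 'I_T) :
  \sum_(b < NB) shift_kap a b <= m%:R * h ^+ 2 + (4 * B)%:R * k ^+ 2.
Proof.
have H (b : nat) : shift_kap a b <= (win a b)%:R * h ^+ 2
   + ((a < b + B <= a + 2 * B : nat) + (a + m < b + B <= a + m + 2 * B : nat))%:R * k ^+ 2.
  have k2 : 0 <= k ^+ 2 by rewrite exprn_ge0.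
  rewrite /shift_kap; case: ifP => [/andP[-> _]|nb].
    by rewrite mul1r lerDl mulr_ge0.
  case: ifP => [ob|_]; last by rewrite addr_ge0 ?mulr_ge0.
  have le1 : (1 <= (a < b + B <= a + 2 * B : nat) + (a + m < b + B <= a + m + 2 * B : nat))%N.
    have : (a < b + B <= a + 2 * B)%N || (a + m < b + B <= a + m + 2 * B)%N.
      by move: nb ob; rewrite /win /shift_win; lia.
    by case/orP => ->; lia.
  rewrite -[leLHS]add0r lerD ?mulr_ge0 // ler_peMl //.
  by rewrite (ler_nat _ 1).
apply: le_trans; first by apply: ler_sum => b _; exact: H.
rewrite big_split /= -!mulr_suml lerD // ler_wpM2r ?exprn_ge0 //.
  by rewrite -natr_sum ler_nat count_interval; lia.
rewrite -natr_sum ler_nat big_split /=.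
apply: leq_trans (leq_add (count_shift_interval _ _ _ _) (count_shift_interval _ _ _ _)) _.
by lia.
Qed.

Definition shift_err (kk : K) : C :=
  w ^+ (s * kk.1.2) * (w ^+ (s' * kk.1.2))^* *
     (\sum_j Mh kk.1.1 kk.2 j * Jt u (kk.1, j)) - Jt shift_term kk.

Lemma shift_errE b t i : shift_err (b, t, i) =
  w ^+ (s * t) * (w ^+ (s' * t))^* *
  \sum_(a < T) (w ^+ (a * t))^* * \sum_j shift_coef b a i j * u (j, a).
Proof.
rewrite /shift_err /= /shift_coef.
transitivity (w ^+ (s * t) * (w ^+ (s' * t))^* *
    (\sum_(a < T) (w ^+ (a * t))^* * \sum_j (win a b)%:R * Mh b i j * u (j, a)
     - \sum_(a < T) (w ^+ (a * t))^* * \sum_j (\sum_(a' < T) (a + s' == a' + s)%N%:R *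
         ((win a' b)%:R * Mh a' i j)) * u (j, a))); last first.
  congr (_ * _); rewrite -sumrB; apply: eq_bigr => a _; rewrite -mulrBr -sumrB.
  by congr (_ * _); apply: eq_bigr => j _; rewrite mulrBl.
rewrite mulrBr; congr (_ * _ - _).
  under [RHS]eq_bigr do rewrite mulr_sumr.
  rewrite [RHS]exchange_big; apply: eq_bigr => j _ /=.
  by rewrite /Jt mulr_sumr; apply: eq_bigr => a _ /=; ring.
rewrite /Jt /shift_term /=.
transitivity (\sum_(a' < T) \sum_(a < T) (a + s' == a' + s)%N%:R * (win a' b)%:R *
   (w ^+ (a' * t))^* * \sum_j Mh a' i j * u (j, a)).
  apply: eq_bigr => a' _; rewrite 2!mulr_sumr; apply: eq_bigr => a _; ring.
rewrite exchange_big mulr_sumr; apply: eq_bigr => a _ /=.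
under [X in _ = _ * (_ * X)]eq_bigr do rewrite mulr_suml.
rewrite exchange_big !mulr_sumr; apply: eq_bigr => a' _ /=.
case: eqP => [E|]; last first.
  rewrite !mul0r => _; rewrite big1 ?mulr0 // => j _; rewrite mul0r mul0r //.
rewrite mul1r.
have E2 : (w ^+ (a' * t))^* = w ^+ (s * t) * (w ^+ (s' * t))^* * (w ^+ (a * t))^*.
  have := wconjK Lw (s * t); set x := w ^+ (s * t); move=> E1.
  rewrite -[LHS]mul1r -E1 -!mulrA; congr (_ * _).
  by rewrite -!rmorphM -!exprD -!mulnDl addnC -E addnC.
rewrite E2 !mulr_sumr; apply: eq_bigr => j _ /=; ring.
Qed.

(** Parseval in the angle: the positions met by a window or by its shift are less than
    [m + 2 * B <= L] apart, hence distinct modulo [L]. *)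
Lemma shift_err_le :
  nrm2 shift_err <= L%:R * #|I|%:R ^+ 2 * (m%:R * h ^+ 2 + (4 * B)%:R * k ^+ 2) * nrm2 u.
Proof.
pose c b i (a : 'I_T) := \sum_j shift_coef b a i j * u (j, a).
have E b i : \sum_(t < L) `|shift_err (b, t, i)| ^+ 2 = L%:R * \sum_a `|c b i a| ^+ 2.
  rewrite -(Parseval Lw) => [|a a' ca ca' E].
    apply: eq_bigr => t _; rewrite shift_errE normrM normrM norm_conjC !(norm_w Lw).
    by rewrite !mul1r.
  have near (x : 'I_T) : c b i x != 0 -> win x b || shift_win x b.
    apply: contraR => nb; rewrite /c big1 // => j _; apply/eqP; rewrite mulf_eq0 -normr_eq0.
    have := shift_coef_le b x i j; rewrite /shift_kap (negPf nb).
    have -> : win x b && shift_win x b = false.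
      by move: nb; rewrite negb_or => /andP[/negPf -> _].
    move=> le0; have : `|shift_coef b x i j| ^+ 2 == 0 by rewrite eq_le le0 exprn_ge0.
    by rewrite expf_eq0 /= => ->.
  apply: val_inj; move: (near _ ca) (near _ ca') E.
  rewrite /win /shift_win /=; move: (val a) (val a') => {ca ca' a near} x y nx ny /eqP.
  wlog le : x y nx ny / (x <= y)%N.
    move=> H; case: (leqP x y) => [/H|/ltnW le E]; first exact.
    by apply/esym/H => //; rewrite eq_sym.
  rewrite eq_sym eqn_mod_dvd // => /dvdn_leq.
  case: (posnP (y - x)) => [|gt0 /(_ isT)]; first by lia.
  by lia.
rewrite /nrm2 big_triple.
under eq_bigr do rewrite exchange_big.
under eq_bigr do under eq_bigr do rewrite E.
apply: (@le_trans _ _ (\sum_(b < NB) \sum_(i : I) L%:R * \sum_(a < T)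
    #|I|%:R * \sum_j shift_kap a b * `|u (j, a)| ^+ 2)).
  apply: ler_sum => b _; apply: ler_sum => i _; rewrite ler_wpM2l ?ler0n //.
  apply: ler_sum => a _; apply: (le_trans (sqr_norm_sum_le _)).
  rewrite ler_wpM2l ?ler0n //; apply: ler_sum => j _.
  by rewrite normrM exprMn ler_wpM2r ?exprn_ge0 // shift_coef_le.
have -> : L%:R * #|I|%:R ^+ 2 * (m%:R * h ^+ 2 + (4 * B)%:R * k ^+ 2) * (\sum_x `|u x| ^+ 2)
  = #|I|%:R * (L%:R * #|I|%:R) * ((m%:R * h ^+ 2 + (4 * B)%:R * k ^+ 2) * (\sum_x `|u x| ^+ 2)) by ring.
rewrite (eq_bigr (fun b : 'I_NB => #|I|%:R * (L%:R * #|I|%:R) *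
    \sum_(a < T) \sum_j shift_kap a b * `|u (j, a)| ^+ 2)); last first.
  by move=> b _; rewrite sumr_const -[LHS]mulr_natl -mulr_sumr !mulrA.
rewrite -mulr_sumr ler_wpM2l ?mulr_ge0 ?ler0n // exchange_big /=.
rewrite big_pair [X in _ * X]exchange_big mulr_sumr; apply: ler_sum => a _ /=.
rewrite exchange_big mulr_sumr; apply: ler_sum => j _ /=.
by rewrite -mulr_suml ler_wpM2r ?exprn_ge0 // shift_kap_sum.
Qed.

End ToeplitzShift.

(** * The lower bound for the quantized form *)

Section ToeplitzGap.
Variables (C : numClosedFieldType) (L m Q B : nat) (w : C).
Hypotheses (Lw : L.-primitive_root w) (m_gt0 : (0 < m)%N) (Q_gt0 : (0 < Q)%N).
Hypotheses (B_gt0 : (0 < B)%N) (LB : (m + 2 * B <= L)%N).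
Local Notation T := (m + Q)%N.
Local Notation NB := (m + Q + m).+1.
Variable I : finType.
Local Notation X := (I * 'I_T)%type.
Local Notation K := ('I_NB * 'I_L * I)%type.
Local Notation Jt := (@Jt C L m Q w I).
Local Notation MJt := (@MJt C L m Q w I).
Local Notation pt := (pt m Q w).
Local Notation toep := (@toep C L m Q w I).

Variables (M : C -> I -> I -> C) (k h e k2 c t : C).
Hypotheses (k_ge0 : 0 <= k) (h_ge0 : 0 <= h) (k2_ge0 : 0 <= k2) (e_ge0 : 0 <= e) (t_ge0 : 0 <= t).
Hypothesis M_bound : forall x i j, `|M x i j| <= k.
Hypothesis M_ucont : forall x y i j, `|x| <= 1 -> `|y| <= 1 ->
  `|M x i j - M y i j| <= e + k2 * `|x - y| ^+ 2.
Hypothesis M_slow : forall x y i j, `|x - y| <= (m + B)%:R / Q%:R -> `|M x i j - M y i j| <= h.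
Hypothesis M_end : forall x y i j, 1 <= `|x| -> 1 <= `|y| -> M x i j = M y i j.
Hypothesis M_gap : forall x v, c * nrm2 v <= nrm2 (app (M x) v).
Hypothesis e_small : e + k2 * (4%:R / B%:R) <= t.
Hypothesis h_small : B%:R ^+ 2 * (h ^+ 2 + (4 * B)%:R * k ^+ 2 / m%:R) <= t.
Hypothesis t_small : 2 * #|I|%:R ^+ 2 * (t ^+ 2 + t) <= c / 12%:R.

Local Notation Mh := (Mhat L m Q w M).

Lemma Mhat_bound s s' b i j : `|Mh s s' b i j| <= k.
Proof.
rewrite /Mhat normrM ger0_norm ?invr_ge0 ?ler0n // ler_pdivrMl; last first.
  by rewrite ltr0n (prim_order_gt0 Lw).
rewrite (le_trans (ler_norm_sum _ _ _)) //.
rewrite (le_trans (ler_sum (G := fun=> k) _ _)) //; last first.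
  by rewrite sumr_const card_ord mulr_natl.
by move=> f _; rewrite !normrM norm_conjC !(norm_w Lw) !mulr1.
Qed.

Lemma rho_slow b b' d : (b <= b' + d)%N -> (b' <= b + d)%N ->
  `|rho C m Q b - rho C m Q b'| <= d%:R / Q%:R.
Proof.
move=> le1 le2; rewrite /rho -mulrBl normrM [X in _ * X]ger0_norm ?invr_ge0 ?ler0n //.
rewrite ler_wpM2r ?invr_ge0 ?ler0n //.
wlog le : b b' le1 le2 / (b <= b')%N.
  by move=> H; case: (leqP b b') => [/H|/ltnW/H]; [exact|rewrite distrC; exact].
rewrite distrC ger0_norm ?subr_ge0 ?ler_nat; last by clear -le; lia.
by rewrite -natrB ?ler_nat; clear -le1 le2 le; lia.
Qed.

Lemma Mhat_slow s s' b b' i j : (b <= b' + (m + B))%N -> (b' <= b + (m + B))%N ->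
  `|Mh s s' b i j - Mh s s' b' i j| <= h.
Proof.
move=> le1 le2; rewrite /Mhat -mulrBr normrM ger0_norm ?invr_ge0 ?ler0n // ler_pdivrMl; last first.
  by rewrite ltr0n (prim_order_gt0 Lw).
rewrite -sumrB (le_trans (ler_norm_sum _ _ _)) //.
rewrite (le_trans (ler_sum (G := fun=> h) _ _)) //; last first.
  by rewrite sumr_const card_ord mulr_natl.
move=> f _; rewrite -mulrBl !normrM norm_conjC !(norm_w Lw) !mulr1.
by apply: M_slow; rewrite /pt -mulrBl normrM (norm_w Lw) mulr1 rho_slow.
Qed.

(** At both ends the symbol does not depend on the angle: the radius is 0 at the bottom, and at the
    top it is 1, where the symbol is constant. Only frequency 0 remains. *)
Lemma Mhat_end s s' : (s < B)%N -> (s' < B)%N -> s != s' ->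
  forall b i j, (b <= m)%N || (T <= b)%N -> Mh s s' b i j = 0.
Proof.
move=> sB sB' ss b i j bend; rewrite /Mhat.
have [A EA] : exists A, forall f, M (pt b f) i j = A.
  case/orP: bend => le.
    exists (M 0 i j) => f; rewrite /pt /rho (eqP (_ : b - m == 0)%N) ?subn_eq0 //.
    by rewrite min0n mul0r mul0r.
  exists (M 1 i j) => f; apply: M_end; rewrite ?normr1 // (norm_pt _ _ Lw).
  by rewrite /rho (minn_idPr _) ?divff ?pnatr_eq0 ?gtn_eqF //; clear -le; lia.
under eq_bigr do rewrite EA.
rewrite -mulr_sumr; have := sum_characters Lw s' s.
under eq_bigr do rewrite mulrC.
move=> ->; rewrite !modn_small; try (clear -LB sB sB'; lia).
by rewrite eq_sym (negPf ss) !mulr0.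
Qed.

(** The Fejer mean of the symbol as an operator on the lattice, so that [Jt (zapp u)] is close to
    [MJt M u]. *)
Definition zapp (u : X -> C) (x : X) : C :=
  B%:R^-1 * \sum_(s < B) \sum_(s' < B) shift_term L w M u s s' x.

Lemma Jt_zapp u kk : Jt (zapp u) kk =
  B%:R^-1 * \sum_(s < B) \sum_(s' < B) Jt (shift_term L w M u s s') kk.
Proof.
rewrite /Jt /zapp.
under eq_bigr do rewrite !mulr_sumr.
rewrite exchange_big mulr_sumr; apply: eq_bigr => s _ /=.
under eq_bigr do rewrite !mulr_sumr.
rewrite exchange_big mulr_sumr; apply: eq_bigr => s' _ /=.
by rewrite mulr_sumr; apply: eq_bigr => a _; ring.
Qed.

Lemma toep_error u :
  nrm2 (fun kk => MJt M u kk - Jt (zapp u) kk) <= c / 12%:R * ((m * L)%:R * nrm2 u).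
Proof.
(* [E1] measures the symbol against its Fejer mean, [E2] collects the errors of the [B ^ 2]
   shifts. *)
pose E1 (kk : K) := \sum_j (M (pt kk.1.1 kk.1.2) kk.2 j - Fejer L m Q w M B kk.1.1 kk.1.2 kk.2 j)
   * Jt u (kk.1, j).
pose E2 (kk : K) := \sum_(p : 'I_B * 'I_B) B%:R^-1 * shift_err w M u p.1 p.2 kk.
have EE kk : MJt M u kk - Jt (zapp u) kk = E1 kk + E2 kk.
  rewrite /E2 -mulr_sumr big_pair /= /shift_err.
  under [X in _ = _ + _ * X]eq_bigr do rewrite sumrB.
  rewrite sumrB mulrBr -Jt_zapp addrA; congr (_ - _).
  rewrite /E1 (eq_bigr (fun j => M (pt kk.1.1 kk.1.2) kk.2 j * Jt u (kk.1, j) -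
     Fejer L m Q w M B kk.1.1 kk.1.2 kk.2 j * Jt u (kk.1, j))); last first.
    by move=> j _; rewrite mulrBl.
  rewrite sumrB -addrA [X in _ = _ + X](_ : _ = 0) ?addr0 //.
  apply/eqP; rewrite addrC subr_eq0; apply/eqP.
  rewrite /Fejer; under [RHS]eq_bigr do rewrite -mulrA mulr_suml.
  rewrite -[RHS]mulr_sumr; congr (_ * _); rewrite [RHS]exchange_big; apply: eq_bigr => s _ /=.
  under [RHS]eq_bigr do rewrite mulr_suml.
  rewrite [RHS]exchange_big; apply: eq_bigr => s' _ /=.
  by rewrite mulr_sumr; apply: eq_bigr => j _; ring.
have lerwMn2 (x y : C) : x <= y -> x *+ 2 <= y *+ 2 by move=> xy; rewrite lerMn2r xy orbT.
have mL : (m <= L)%N by clear -LB; lia.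
have N1 : nrm2 E1 <= #|I|%:R ^+ 2 * t ^+ 2 * ((m * L)%:R * nrm2 u).
  rewrite -(Jt_norm Lw m_gt0 Q_gt0) // /nrm2 !big_triple !mulr_sumr; apply: ler_sum => b _.
  rewrite !mulr_sumr; apply: ler_sum => f _.
  apply: (nrm2_app_le (fun j => Jt u (b, f, j))) => i j.
  rewrite ler_pXn2r ?nnegrE //.
  apply: le_trans e_small; apply: (Fejer_approx _ Lw) => //; first by rewrite B_gt0; clear -LB; lia.
  by move=> x y x1 y1; exact: M_ucont.
have N2 : nrm2 E2 <= #|I|%:R ^+ 2 * t * ((m * L)%:R * nrm2 u).
  apply: le_trans (nrm2_sum_le _) _.
  have S (p : 'I_B * 'I_B) : nrm2 (fun kk : K => B%:R^-1 * shift_err w M u p.1 p.2 kk) <=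
     B%:R^-1 ^+ 2 * (L%:R * #|I|%:R ^+ 2 * (m%:R * h ^+ 2 + (4 * B)%:R * k ^+ 2) * nrm2 u).
    rewrite {1}/nrm2; under eq_bigr do rewrite normrM exprMn.
    rewrite -mulr_sumr ger0_norm ?invr_ge0 // ler_wpM2l ?exprn_ge0 ?invr_ge0 //.
    rewrite -/(nrm2 (shift_err w M u p.1 p.2)).
    apply: (shift_err_le Lw m_gt0 Q_gt0 u (ltn_ord p.1) (ltn_ord p.2) LB k_ge0 h_ge0).
    - exact: Mhat_bound.
    - exact: Mhat_slow.
    - exact: Mhat_end.
  apply: (@le_trans _ _ (#|{: 'I_B * 'I_B}|%:R * \sum_(p : 'I_B * 'I_B) B%:R^-1 ^+ 2 *
      (L%:R * #|I|%:R ^+ 2 * (m%:R * h ^+ 2 + (4 * B)%:R * k ^+ 2) * nrm2 u))).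
    by apply: ler_wpM2l => //; apply: ler_sum => p _; exact: S.
  rewrite sumr_const card_prod card_ord.
  have B0 : B%:R != 0 :> C by rewrite pnatr_eq0 gtn_eqF.
  have m0 : m%:R != 0 :> C by rewrite pnatr_eq0 gtn_eqF.
  apply: (@le_trans _ _ (#|I|%:R ^+ 2 * (B%:R ^+ 2 * (h ^+ 2 + (4 * B)%:R * k ^+ 2 / m%:R))
            * ((m * L)%:R * nrm2 u))).
    rewrite le_eqVlt; apply/orP; left; apply/eqP.
    rewrite -mulr_natl !natrM; field.
    by rewrite m0 B0.
  by rewrite ler_wpM2r ?mulr_ge0 ?nrm2_ge0 // ler_wpM2l ?exprn_ge0.
rewrite (eq_nrm2 EE); apply: le_trans (nrm2D_le _ _) _.
have N12 := lerD (lerwMn2 _ _ N1) (lerwMn2 _ _ N2); apply: le_trans N12 _.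
apply: (@le_trans _ _ (2 * #|I|%:R ^+ 2 * (t ^+ 2 + t) * ((m * L)%:R * nrm2 u))).
  by rewrite le_eqVlt; apply/orP; left; apply/eqP; ring.
by rewrite ler_wpM2r // mulr_ge0 ?nrm2_ge0.
Qed.

(** [MJt M u] is bounded below and close to [Jt z], so [z] is not small. Pairing [toep M u] with [z]
    gives, up to [m * L], the pairing of [MJt M u] with [Jt z], which is close to the squared norm
    of [Jt z]; hence [toep M u] is not small either. With the error c / 12 the error terms add up to
    c / 2, and c / 16 remains. *)
Lemma toep_gap u : c / 16%:R * nrm2 u <= nrm2 (app (toep M) u).
Proof.
set z := zapp u; set E := fun kk => MJt M u kk - Jt z kk.
have mL0 : 0 < (m * L)%:R :> C by rewrite ltr0n muln_gt0 m_gt0 (prim_order_gt0 Lw).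
have mL : (m <= L)%N by clear -LB; lia.
have NE : nrm2 E <= c / 12%:R * ((m * L)%:R * nrm2 u) by exact: toep_error.
have NJ v : nrm2 (Jt v) = (m * L)%:R * nrm2 v by exact: Jt_norm.
have lowM : c * ((m * L)%:R * nrm2 u) <= nrm2 (MJt M u).
  rewrite -NJ /nrm2 !big_triple mulr_sumr; apply: ler_sum => b _.
  rewrite mulr_sumr; apply: ler_sum => f _.
  exact: (M_gap (pt b f) (fun j => Jt u (b, f, j))).
have lowz : c * ((m * L)%:R * nrm2 u) <= ((m * L)%:R * nrm2 z) *+ 2
     + (c / 12%:R * ((m * L)%:R * nrm2 u)) *+ 2.
  apply: le_trans lowM _.
  have EE kk : MJt M u kk = Jt z kk + E kk by rewrite /E addrC subrK.
  rewrite (eq_nrm2 EE); apply: le_trans (nrm2D_le _ _) _.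
  by rewrite NJ lerD2l lerMn2r NE orbT.
have pair (F : finType) (x y : F -> C) e1 : 0 < e1 ->
    `|\sum_i (x i)^* * y i| <= e1 * nrm2 x + (4%:R * e1)^-1 * nrm2 y.
  move=> e1p; rewrite (le_trans (ler_norm_sum _ _ _)) // !mulr_sumr -big_split.
  by apply: ler_sum => i _; rewrite normrM norm_conjC Young_le.
have adj := toep_adjoint Lw m_gt0 M z u.
have upz : (m * L)%:R * nrm2 z <= (m * L)%:R * (4%:R^-1 * nrm2 z + nrm2 (app (toep M) u))
    + (2%:R^-1 * ((m * L)%:R * nrm2 z) + 2%:R^-1 * (c / 12%:R * ((m * L)%:R * nrm2 u))).
  have Ez : (m * L)%:R * nrm2 z = (m * L)%:R * (\sum_x (z x)^* * app (toep M) u x)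
     - \sum_kk (Jt z kk)^* * E kk.
    rewrite adj -sumrB -NJ; apply: eq_bigr => kk _.
    by rewrite /E mulrBr opprB addrC subrK normCK mulrC.
  rewrite -[X in X <= _]ger0_norm; last by rewrite mulr_ge0 ?nrm2_ge0 // ltW.
  rewrite {1}Ez; apply: le_trans (ler_normB _ _) _; apply: lerD.
    rewrite normrM ger0_norm ?(ltW mL0) // ler_pM2l //.
    have := pair _ z (app (toep M) u) 4%:R^-1.
    by rewrite invr_gt0 ltr0n mulfV ?pnatr_eq0 // invr1 mul1r; apply.
  have := pair _ (Jt z) E 2%:R^-1; rewrite invr_gt0 ltr0n => /(_ isT) H.
  apply: le_trans H _; rewrite NJ lerD2l.
  have -> : (4%:R * 2%:R^-1)^-1 = 2%:R^-1 :> C by field.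
  by rewrite ler_pM2l ?invr_gt0 ?ltr0n.
move: lowz upz; set a := (m * L)%:R in mL0 *.
set N2 := nrm2 z; set N3 := nrm2 (app _ u); set N1 := nrm2 u => lowz upz.
rewrite -(ler_pM2l mL0).
have {}upz : a * N2 <= 4%:R * (a * N3) + 2 * (c / 12%:R * (a * N1)).
  rewrite -subr_ge0; move: upz; rewrite -subr_ge0 -(pmulr_rge0 _ (ltr0Sn C 3)).
  by congr (_ <= _); field.
have : c * (a * N1) <= 8%:R * (a * N3) + 4%:R * (c / 12%:R * (a * N1)) + 2 * (c / 12%:R * (a * N1)).
  apply: le_trans lowz _; rewrite -[X in _ + X <= _]mulr_natl lerD2r -[X in X <= _]mulr_natl.
  have -> : 8%:R * (a * N3) + 4%:R * (c / 12%:R * (a * N1))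
    = 2 * (4%:R * (a * N3) + 2 * (c / 12%:R * (a * N1))) by ring.
  by rewrite ler_pM2l ?ltr0n.
move=> H; rewrite -subr_ge0; move: H.
rewrite -subr_ge0 -(pmulr_rge0 _ (_ : 0 < 8%:R^-1)) ?invr_gt0 ?ltr0n //.
by congr (_ <= _); field.
Qed.

End ToeplitzGap.

Lemma prim_root_exists (C : numClosedFieldType) n :
  (0 < n)%N -> exists w : C, n.-primitive_root w.
Proof.
move=> n0; have [rs Ers] := closed_field_poly_normal ('X^n - 1 : {poly C}).
have mon : ('X^n - 1 : {poly C}) \is monic by rewrite monicXnsubC.
rewrite (eqP mon) scale1r in Ers.
have urs : uniq rs.
  rewrite -separable_prod_XsubC -Ers separable_Xn_sub_1 //.
  by rewrite pnatr_eq0 -lt0n.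
have : has n.-primitive_root rs.
  apply: has_prim_root => //.
    apply/allP => z zrs; rewrite unity_rootE -subr_eq0.
    have : root ('X^n - 1) z by rewrite Ers root_prod_XsubC.
    by rewrite rootE !hornerE.
  by have := size_XnsubC (1 : C) n0; rewrite polyC1 Ers size_prod_XsubC => -[->].
by case/hasP => w _ pw; exists w.
Qed.

Definition archimedean_field (C : numClosedFieldType) :=
  forall x : C, 0 <= x -> exists n : nat, x <= n%:R.

Lemma archi_div (C : numClosedFieldType) (x y : C) :
  archimedean_field C -> 0 <= x -> 0 < y ->
  exists2 N : nat, (0 < N)%N & forall N', (N <= N')%N -> x / N'%:R <= y.
Proof.
move=> archi x0 y0; have [n le_n] := archi (x / y) (divr_ge0 x0 (ltW y0)).
exists n.+1 => // N' leN; rewrite ler_pdivrMr; last by rewrite ltr0n; lia.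
rewrite mulrC -ler_pdivrMr //; apply: le_trans le_n _.
by rewrite ler_nat; lia.
Qed.

(** The order of the choices matters: [t] from [c], the Fejer order [B], a window [m] long against
    [B], the tolerance [h], and then so many steps [Q] that the radius hardly changes along a
    window. As [q] divides [L], the q-th roots of unity act by rotations of the angles. *)
Lemma toeplitz_uniform_gap (C : numClosedFieldType) (Y : Type) (I : finType)
    (M : Y -> C -> I -> I -> C) (k c g : C) (q : nat) :
  archimedean_field C -> (0 < q)%N -> 0 <= k -> 0 < c -> 0 < g ->
  (forall y x i j, `|M y x i j| <= k) ->
  (forall e, 0 < e -> exists2 d, 0 < d & forall y x x' i j,
      `|x - x'| <= d -> `|M y x i j - M y x' i j| <= e) ->
  (forall y x x' i j, 1 <= `|x| -> 1 <= `|x'| -> M y x i j = M y x' i j) ->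
  (forall y x v, c * nrm2 v <= nrm2 (app (M y x) v)) ->
  exists L m Q w, [/\ L.-primitive_root w, (0 < m <= L)%N, (0 < Q)%N, (q %| L)%N &
    (forall y u, c / 16%:R * nrm2 u <= nrm2 (app (@toep C L m Q w I (M y)) u)) /\
    (forall y b t i j, (2 * m * #|I|)%:R *
       `|M y (pt m Q w b.+1 t) i j - M y (pt m Q w b t) i j| <= g)].
Proof.
move=> archi q0 k0 c0 g0 H1 H2 H3 H4.
(* 48 = 2 * 2 * 12: the smallness required of [t] by [toep_gap], after [t ^+ 2] is replaced by
   [t]. *)
pose n2 := 48%:R * #|I|%:R ^+ 2 : C.
have n20 : 0 <= n2 by rewrite mulr_ge0 ?exprn_ge0.
pose t := c / (n2 + c + 1).
have den : 0 < n2 + c + 1 by rewrite ltr_wpDr // ltr_wpDl.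
have t0 : 0 < t by rewrite divr_gt0.
have t1 : t <= 1 by rewrite ler_pdivrMr // mul1r -addrA [c + 1]addrC addrA lerDr addr_ge0.
have tc : n2 * t <= c.
  rewrite /t mulrCA ler_piMr ?(ltW c0) // ler_pdivrMr // mul1r -addrA lerDl.
  by rewrite addr_ge0 ?(ltW c0).
have th0 : 0 < t / 2 by rewrite divr_gt0.
have [d d0 Hd] := H2 _ th0.
(* Points closer than [d] are treated by continuity; for the others the trivial bound [2 * k] is at
   most [k2] times the squared distance. *)
pose k2 := 2 * k / d ^+ 2.
have k20 : 0 <= k2 by rewrite mulr_ge0 ?invr_ge0 ?exprn_ge0 ?mulr_ge0 ?(ltW d0).
have [B B0 HB] := archi_div archi (mulr_ge0 k20 (ler0n C 4)) th0.
have p1 : 0 <= B%:R ^+ 2 * ((4 * B)%:R * k ^+ 2) by rewrite !mulr_ge0 ?exprn_ge0.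
have [m m0 Hm] := archi_div archi p1 th0.
pose h := t / (2 * B%:R).
have BR0 : 0 < B%:R :> C by rewrite ltr0n.
have h0 : 0 < h by apply: divr_gt0 => //; apply: mulr_gt0; rewrite ?ltr0n.
have [d1 d10 Hd1] := H2 _ h0.
pose g1 := g / (2 * m * #|I|).+1%:R.
have g10 : 0 < g1 by rewrite divr_gt0 ?ltr0n.
have [d2 d20 Hd2] := H2 _ g10.
have [Q1 Q10 HQ1] := archi_div archi (ler0n C (m + B)) d10.
have [Q2 Q20 HQ2] := archi_div archi (ler0n C 1) d20.
pose Q := (Q1 + Q2)%N; pose L := (q * (m + 2 * B))%N.
have Q0 : (0 < Q)%N by rewrite addn_gt0 Q10.
have [|w Lw] := @prim_root_exists C L; first by rewrite /L muln_gt0 q0 addn_gt0 m0.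
have LB : (m + 2 * B <= L)%N by rewrite /L leq_pmull.
have mL : (0 < m <= L)%N by rewrite m0 (leq_trans _ LB) ?leq_addr.
exists L, m, Q, w; split=> //; first by rewrite /L dvdn_mulr.
split=> [y u|y b s i j].
  apply: (@toep_gap C L m Q B w Lw m0 Q0 B0 LB I (M y) k h (t / 2) k2 c t) => //; try exact: ltW.
  - move=> x x' i j _ _.
    have xr : `|x - x'| \is Num.real by exact: normr_real.
    have [le|lt] := real_leP xr (gtr0_real d0).
      by rewrite (le_trans (Hd _ _ _ _ _ le)) // lerDl mulr_ge0 ?exprn_ge0.
    rewrite (le_trans (ler_normB _ _)) // (le_trans (lerD (H1 _ _ _ _) (H1 _ _ _ _))) //.
    rewrite -[leLHS]add0r lerD ?(ltW th0) // -mulr2n -mulr_natl /k2 mulrAC.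
    rewrite ler_pdivlMr ?exprn_gt0 // ler_wpM2l ?mulr_ge0 //.
    by rewrite ler_pXn2r ?nnegrE ?(ltW d0) // ltW.
  - by move=> x x' i j le; apply: Hd1; rewrite (le_trans le) // HQ1 // /Q leq_addr.
  - move=> e1 ?; exact: H3.
  - rewrite -[leRHS](_ : t / 2 + t / 2 = t); last by field.
    by rewrite lerD2l mulrA HB.
  - rewrite -[leRHS](_ : t / 2 + t / 2 = t); last by field.
    rewrite mulrDr lerD // ?[B%:R ^+ 2 * (_ / _)]mulrA ?Hm //.
    rewrite -exprMn; have -> : B%:R * h = t / 2 by rewrite /h; field; rewrite gt_eqF.
    by rewrite expr2 ler_piMl ?(ltW th0) // ler_pdivrMr // mul1r (le_trans t1) // ler1n.
  - rewrite ler_pdivlMr ?ltr0n //; apply: le_trans tc; rewrite /n2.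
    apply: (@le_trans _ _ (2 * #|I|%:R ^+ 2 * (t + t) * 12%:R)).
      rewrite ler_pM2r ?ltr0n // ler_wpM2l ?mulr_ge0 ?exprn_ge0 // lerD2r.
      by rewrite expr2 ler_piMl // ltW.
    by rewrite le_eqVlt; apply/orP; left; apply/eqP; ring.
have le1 : `|M y (pt m Q w b.+1 s) i j - M y (pt m Q w b s) i j| <= g1.
  apply: Hd2; rewrite /pt -mulrBl normrM (norm_w Lw) mulr1.
  apply: le_trans (HQ2 Q _); last by rewrite /Q leq_addl.
  by apply: rho_slow; clear -b; lia.
apply: le_trans (ler_wpM2l (ler0n _ _) le1) _.
rewrite /g1 mulrCA ler_piMr ?(ltW g0) // ler_pdivrMr ?ltr0n // mul1r ler_nat.
exact: leqnSn.
Qed.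

(** * Ends, rotations and translations of the quantized form *)

Section ToeplitzStructure.
Variables (C : numClosedFieldType) (L m Q : nat) (w : C).
Hypotheses (Lw : L.-primitive_root w) (m_gt0 : (0 < m)%N) (Q_gt0 : (0 < Q)%N).
Hypothesis mL : (m <= L)%N.
Local Notation T := (m + Q)%N.
Local Notation NB := (m + Q + m).+1.
Variable I : finType.
Local Notation X := (I * 'I_T)%type.
Local Notation pt := (pt m Q w).
Local Notation toep := (@toep C L m Q w I).
Local Notation win := (win m).
Implicit Types (M : C -> I -> I -> C) (x y : X).

Lemma mL_neq0 : (m * L)%:R != 0 :> C.
Proof. by rewrite pnatr_eq0 muln_eq0 !gtn_eqF // (prim_order_gt0 Lw). Qed.

Lemma eq_toep M M' x y :
  (forall b t, win x.2 b -> win y.2 b -> M (pt b t) x.1 y.1 = M' (pt b t) x.1 y.1) ->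
  toep M x y = toep M' x y.
Proof.
move=> E; congr (_ * _); apply: eq_bigr => b _; apply: eq_bigr => t _.
case: (boolP (win x.2 b)) => wx /=; last by rewrite !mul0r.
by case: (boolP (win y.2 b)) => wy /=; rewrite ?mul0r // E.
Qed.

Lemma toep_const (A : I -> I -> C) x y :
  toep (fun=> A) x y = A x.1 y.1 * (x.2 == y.2)%:R.
Proof.
apply: (mulfI mL_neq0); rewrite /toep mulrA mulfV ?mL_neq0 // mul1r.
transitivity (\sum_(b < NB) (win x.2 b && win y.2 b)%:R * (A x.1 y.1 *
    (if x.2 == y.2 %[mod L] then L%:R else 0))).
  apply: eq_bigr => b _; rewrite -(sum_characters Lw) !mulr_sumr.
  by apply: eq_bigr => t _.
case: (eqVneq x.2 y.2) => [->|ne]; last first.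
  rewrite !mulr0 big1 // => b _; case: (boolP (_ && _)) => [/andP[wx wy]|]; last by rewrite mul0r.
  case: eqP => [/(win_mod Lw m_gt0 Q_gt0 mL wx wy)/val_inj E|_]; last by rewrite !mulr0.
  by rewrite E eqxx in ne.
rewrite eqxx -mulr_suml mulr1; under eq_bigr do rewrite andbb.
by rewrite (card_win Lw m_gt0 Q_gt0) natrM; ring.
Qed.

Lemma toep_bound M x y (e : C) : 0 <= e ->
  (forall b t, win x.2 b -> win y.2 b -> `|M (pt b t) x.1 y.1| <= e) ->
  `|toep M x y| <= e * [exists b : 'I_NB, win x.2 b && win y.2 b]%:R.
Proof.
move=> e0 He; rewrite /toep normrM ger0_norm ?invr_ge0 ?ler0n //.
case: existsP => [_|ne]; last first.
  rewrite big1 ?normr0 ?mulr0 // => b _; rewrite big1 // => t _.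
  case: (boolP (_ && _)) => wb; last by rewrite mul0r.
  by case: ne; exists b.
rewrite mulr1 ler_pdivrMl ?lt_neqAle ?ler0n 1?eq_sym ?mL_neq0 //.
apply: le_trans (ler_norm_sum _ _ _) _.
apply: (@le_trans _ _ (\sum_(b < NB) (win x.2 b)%:R * (L%:R * e))).
  apply: ler_sum => b _; apply: le_trans (ler_norm_sum _ _ _) _.
  have -> : (win x.2 b)%:R * (L%:R * e) = \sum_(t < L) (win x.2 b)%:R * e.
    by rewrite sumr_const card_ord -mulr_natl; ring.
  apply: ler_sum => t _; rewrite !normrM norm_conjC !(norm_w Lw) !mulr1 normr_nat.
  case: (boolP (win x.2 b)) => wx /=; last by rewrite !mul0r.
  case: (boolP (win y.2 b)) => wy /=; last by rewrite mul0r mul1r.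
  by rewrite !mul1r He.
by rewrite -mulr_suml (card_win Lw m_gt0 Q_gt0) natrM mulrA.
Qed.

Lemma toepB M M' x y : toep M x y - toep M' x y = toep (fun z i j => M z i j - M' z i j) x y.
Proof.
rewrite /toep -mulrBr -sumrB; congr (_ * _); apply: eq_bigr => b _.
by rewrite -sumrB; apply: eq_bigr => t _; rewrite -mulrBr mulrBl.
Qed.

(** Every window that contains position 0 has radius 0, so such an entry sees a constant symbol. *)
Lemma toep_bottom M x y : x.2 = 0 :> nat \/ y.2 = 0 :> nat ->
  toep M x y = M 0 x.1 y.1 * (x.2 == y.2)%:R.
Proof.
move=> xy; rewrite -(toep_const (M 0)); apply: eq_toep => b t wx wy.
have le : (b <= m)%N.
  by case: xy => E; move: wx wy; rewrite /win E; clear; lia.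
rewrite /pt /rho (eqP (_ : b - m == 0)%N) ?subn_eq0 //.
by rewrite min0n mul0r mul0r.
Qed.

Lemma toep_top M (A : I -> I -> C) x y : (forall z i j, 1 <= `|z| -> M z i j = A i j) ->
  x.2.+1 = T \/ y.2.+1 = T -> toep M x y = A x.1 y.1 * (x.2 == y.2)%:R.
Proof.
move=> MA xy; rewrite -(toep_const A); apply: eq_toep => b t wx wy.
have le : (T <= b)%N.
  by case: xy => E; move: wx wy E; rewrite /win; clear; lia.
rewrite MA // (norm_pt _ _ Lw) /rho (minn_idPr _) ?divff ?pnatr_eq0 ?gtn_eqF //.
by clear -le; lia.
Qed.

Lemma sum_rotate (t0 : nat) (G : C -> C) :
  \sum_(t < L) G (w ^+ t) = \sum_(t < L) G (w ^+ t * w ^+ t0).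
Proof.
pose f (t : 'I_L) := Ordinal (ltn_pmod (t + t0) (prim_order_gt0 Lw)).
rewrite (reindex_inj (h := f)) => [|t t' /(congr1 val) /= /eqP].
  by apply: eq_bigr => t _; rewrite /= (prim_expr_mod Lw) exprD.
by rewrite eqn_modDr !modn_small ?ltn_ord // => /eqP/val_inj.
Qed.

(** A rotation of the angles reindexes the sum over [t], and the Fourier factors then add the
    position to the weight. *)
Lemma toep_equivariant M M' (v : I -> nat) (z : C) x y : z ^+ L = 1 ->
  (forall t i j, z ^+ v j * M (z * t) i j = z ^+ v i * M' t i j) ->
  z ^+ (v y.1 + y.2) * toep M x y = z ^+ (v x.1 + x.2) * toep M' x y.
Proof.
move=> zL ME; have [t0 Ez] := prim_rootP Lw zL.
have zz n : z ^+ n * (z ^+ n)^* = 1 by rewrite Ez -exprM (wconjK Lw).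
rewrite /toep mulrCA [RHS]mulrCA; congr (_ * _).
rewrite !mulr_sumr; apply: eq_bigr => b _.
pose G (M0 : C -> I -> I -> C) (s : C) :=
  (win x.2 b && win y.2 b)%:R * (M0 (rho C m Q b * s) x.1 y.1 * (s ^+ x.2 * (s ^+ y.2)^*)).
have EG M0 : \sum_(t < L) (win x.2 b && win y.2 b)%:R *
   (M0 (pt b t) x.1 y.1 * (w ^+ (x.2 * t) * (w ^+ (y.2 * t))^*)) = \sum_(t < L) G M0 (w ^+ t).
  by apply: eq_bigr => t _; rewrite /G -!exprM ![(t * _)%N]mulnC.
rewrite !EG (sum_rotate t0) !mulr_sumr; apply: eq_bigr => t _; rewrite /G -Ez.
have -> : rho C m Q b * (w ^+ t * z) = z * (rho C m Q b * w ^+ t) by ring.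
rewrite !exprD !exprMn rmorphM /=.
have := ME (rho C m Q b * w ^+ t) x.1 y.1; have := zz y.2.
set A := M _ _ _; set A' := M' _ _ _ => z1 E.
transitivity ((win x.2 b && win y.2 b)%:R * (z ^+ y.2 * (z ^+ y.2)^*) *
   (z ^+ v y.1 * A) * z ^+ x.2 * ((w ^+ t) ^+ x.2 * ((w ^+ t) ^+ y.2)^*)); first by ring.
by rewrite z1 E; ring.
Qed.

(** The Fourier factors depend only on the difference of the positions, so moving both positions by
    one step amounts to moving the window by one step; the first window and the last contain no
    position, so nothing is lost at the ends. *)
Lemma toep_translate M (e : C) (i j : I) (a a' a1 a1' : 'I_T) : 0 <= e ->
    a1 = a.+1 :> nat -> a1' = a'.+1 :> nat ->
    (forall b t, `|M (pt b.+1 t) i j - M (pt b t) i j| <= e) ->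
  `|toep M (i, a1) (j, a1') - toep M (i, a) (j, a')|
     <= e * ((a < a' + m) && (a' < a + m))%N%:R.
Proof.
move=> e0 Ea Ea' He.
pose M' (b t : nat) := M (pt b.+1 t) i j - M (pt b t) i j.
have E : toep M (i, a1) (j, a1') - toep M (i, a) (j, a') =
   (m * L)%:R^-1 * \sum_(b < NB) \sum_(t < L) (win a b && win a' b)%:R *
       (M' b t * (w ^+ (a * t) * (w ^+ (a' * t))^*)).
  rewrite /toep -mulrBr; congr (_ * _) => /=.
  pose F1 b := \sum_(t < L) (win a1 b && win a1' b)%:R *
     (M (pt b t) i j * (w ^+ (a1 * t) * (w ^+ (a1' * t))^*)).
  pose F2 b := \sum_(t < L) (win a b && win a' b)%:R *
     (M (pt b t) i j * (w ^+ (a * t) * (w ^+ (a' * t))^*)).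
  pose F3 b := \sum_(t < L) (win a b && win a' b)%:R *
     (M' b t * (w ^+ (a * t) * (w ^+ (a' * t))^*)).
  have out : win a (T + m) = false.
    by rewrite /win; have := ltn_ord a; clear; lia.
  rewrite -/(\sum_(b < NB) F1 b) -/(\sum_(b < NB) F2 b) -/(\sum_(b < NB) F3 b).
  rewrite big_ord_recl {1}/F1 big1 ?add0r; last by move=> t _; rewrite {1}/win ltn0 mul0r.
  rewrite !big_ord_recr /= [F2 (T + m)%N]big1 ?addr0; last by move=> t _; rewrite out mul0r.
  rewrite [F3 (T + m)%N]big1 ?addr0; last by move=> t _; rewrite out mul0r.
  rewrite -sumrB; apply: eq_bigr => b _; rewrite -sumrB; apply: eq_bigr => t _.
  have -> : win a1 (bump 0 b) = win a b by rewrite /win Ea /bump leq0n; clear; lia.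
  have -> : win a1' (bump 0 b) = win a' b by rewrite /win Ea' /bump leq0n; clear; lia.
  rewrite -mulrBr Ea Ea' /M' /bump leq0n add1n; congr (_ * _).
  rewrite mulrBl; congr (_ * _ - _).
  rewrite !mulSn !exprD rmorphM /= -[RHS]mul1r -(wconjK Lw t); ring.
rewrite E normrM ger0_norm ?invr_ge0 ?ler0n // ler_pdivrMl ?lt_neqAle ?ler0n 1?eq_sym ?mL_neq0 //.
apply: le_trans (ler_norm_sum _ _ _) _.
apply: (@le_trans _ _ (\sum_(b < NB) (win a b)%:R * (L%:R * (e * ((a < a' + m) && (a' < a + m))%N%:R)))).
  apply: ler_sum => b _; apply: le_trans (ler_norm_sum _ _ _) _.
  set d := _ * _%:R; have -> : (win a b)%:R * (L%:R * d) = \sum_(t < L) (win a b)%:R * d.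
    by rewrite sumr_const card_ord -mulr_natl; ring.
  apply: ler_sum => t _; rewrite !normrM norm_conjC !(norm_w Lw) !mulr1 normr_nat.
  have d0 : 0 <= d by rewrite mulr_ge0.
  case: (boolP (win a b)) => wx /=; last by rewrite !mul0r.
  case: (boolP (win a' b)) => wy /=; last by rewrite mul0r mul1r.
  have band : (a < a' + m)%N && (a' < a + m)%N by move: wx wy; rewrite /win; clear; lia.
  by rewrite /d band mulr1 !mul1r; exact: He.
by rewrite -mulr_suml (card_win Lw m_gt0 Q_gt0) natrM mulrA.
Qed.

End ToeplitzStructure.

(** * Bott periodicity *)

Section SignatureTransport.
Variable C : numClosedFieldType.

Lemma posdim_reindex (X Y : finType) (P : pred X) (Q : pred Y) (A : X -> X -> C)
    (B : Y -> Y -> C) (h : Y -> X) (g : X -> Y) (e : C) k :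
  (forall y, Q y -> P (h y) /\ g (h y) = y) ->
  (forall x, P x -> Q (g x) /\ h (g x) = x) ->
  (forall y y', Q y -> Q y' -> B y y' = A (h y) (h y')) ->
  posdim P A e k -> posdim Q B e k.
Proof.
move=> Qh Pg BA [Z [ZP Zpos]].
exists (fun a y => if Q y then Z a (h y) else 0); split=> [a y /negPf -> //|c c0].
set u := lincomb c _; pose v := lincomb c Z.
have uE y : u y = if Q y then v (h y) else 0.
  by rewrite /u /v /lincomb; case: ifP => Qy //; rewrite big1 // => a _; rewrite mulr0.
have v0 x : ~~ P x -> v x = 0.
  by move=> Px; rewrite /v /lincomb big1 // => a _; rewrite ZP ?mulr0.
have sumE (F : X -> C) : (forall x, ~~ P x -> F x = 0) ->
    \sum_x F x = \sum_(y | Q y) F (h y).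
  move=> F0; rewrite (bigID P) /= [X in _ + X]big1 ?addr0; last by move=> x /F0.
  rewrite (reindex_onto h g) /=; last by move=> x /Pg [].
  apply: eq_bigl => y; apply/andP/idP => [[Ph /eqP Eg]|Qy].
    by have [] := Pg _ Ph; rewrite Eg.
  by have [-> ->] := Qh _ Qy.
have appE y : Q y -> app B u y = app A v (h y).
  move=> Qy; rewrite /app [RHS]sumE => [|x /v0 ->]; last by rewrite mulr0.
  rewrite (bigID Q) /= [X in _ + X]big1 ?addr0; last first.
    by move=> y' /negPf Qy'; rewrite uE Qy' mulr0.
  by apply: eq_bigr => y' Qy'; rewrite uE Qy' BA.
have -> : nrm2 u = nrm2 v.
  rewrite /nrm2 [RHS]sumE => [|x /v0 ->]; last by rewrite normr0 expr0n.
  rewrite (bigID Q) /= [X in _ + X]big1 ?addr0; last first.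
    by move=> y' /negPf Qy'; rewrite uE Qy' normr0 expr0n.
  by apply: eq_bigr => y' Qy'; rewrite uE Qy'.
have -> : qform B u = qform A v; last exact: Zpos.
rewrite /qform [RHS]sumE => [|x /v0 ->]; last by rewrite rmorph0 mul0r.
rewrite (bigID Q) /= [X in _ + X]big1 ?addr0; last first.
  by move=> y' /negPf Qy'; rewrite uE Qy' rmorph0 mul0r.
by apply: eq_bigr => y' Qy'; rewrite uE Qy' appE.
Qed.

Lemma card_reindex (X Y : finType) (P : pred X) (Q : pred Y) (h : Y -> X) (g : X -> Y) :
  (forall y, Q y -> P (h y) /\ g (h y) = y) ->
  (forall x, P x -> Q (g x) /\ h (g x) = x) -> #|P| = #|Q|.
Proof.
move=> Qh Pg; apply/eqP; rewrite eqn_leq; apply/andP; split.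
  rewrite -(card_in_imset (f := g) (D := P)); last first.
    by move=> x x' /Pg[_ E] /Pg[_ E'] Eg; rewrite -E Eg E'.
  by apply/subset_leq_card/fintype.subsetP => y /imsetP[x /Pg[Qg _] ->].
rewrite -(card_in_imset (f := h) (D := Q)); last first.
  by move=> x x' /Qh[_ E] /Qh[_ E'] Eg; rewrite -E Eg E'.
by apply/subset_leq_card/fintype.subsetP => y /imsetP[x /Qh[Qg _] ->].
Qed.

Lemma signature_reindex (X Y : finType) (P : pred X) (Q : pred Y) (A : X -> X -> C)
    (B : Y -> Y -> C) (h : Y -> X) (g : X -> Y) k :
  (forall y, Q y -> P (h y) /\ g (h y) = y) ->
  (forall x, P x -> Q (g x) /\ h (g x) = x) ->
  (forall y y', Q y -> Q y' -> B y y' = A (h y) (h y')) ->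
  signature P A k -> signature Q B k.
Proof.
move=> Qh Pg BA [l [E p n]]; exists l; split.
- by rewrite E; exact: card_reindex Qh Pg.
- exact: (posdim_reindex Qh Pg BA p).
by apply: (posdim_reindex Qh Pg _ n) => y y' Qy Qy'; rewrite /negA BA.
Qed.

(* Schur's test for a hermitian perturbation. *)
Lemma qform_perturb_le (X : finType) (P : pred X) (A B : X -> X -> C) (R : rel X) (e : C) D u :
  0 <= e -> symmetric R -> (forall x, #|[pred y | R x y]| <= D)%N ->
  (forall x y, P x -> P y -> `|A x y - B x y| <= e * (R x y)%:R) ->
  (forall x, ~~ P x -> u x = 0) ->
  `|qform A u - qform B u| <= D%:R * e * nrm2 u.
Proof.
move=> e0 Rs RD AB u0.
have RD' x : \sum_y (R x y)%:R <= D%:R :> C.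
  rewrite -natr_sum ler_nat; apply: leq_trans (RD x).
  by rewrite -sum1_card [leqRHS]big_mkcond.
have H (x y : C) : `|x| * `|y| <= 2^-1 * `|x| ^+ 2 + 2^-1 * `|y| ^+ 2.
  have := Young_le x y (_ : 0 < 2^-1); rewrite invr_gt0 ltr0n => /(_ isT).
  by congr (_ <= _ + _ * _); field.
have -> : qform A u - qform B u = \sum_x \sum_y (u x)^* * (A x y - B x y) * u y.
  rewrite /qform -sumrB; apply: eq_bigr => x _; rewrite /app -mulrBr -sumrB mulr_sumr.
  by apply: eq_bigr => y _; ring.
pose f x y : C := (R x y)%:R * (2^-1 * `|u x| ^+ 2).
have half : \sum_x \sum_y f x y <= 2^-1 * (D%:R * nrm2 u).
  rewrite /nrm2 !mulr_sumr; apply: ler_sum => x _; rewrite -mulr_suml mulrCA.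
  by rewrite ler_wpM2l ?invr_ge0 ?ler0n // ler_wpM2r ?exprn_ge0.
apply: (@le_trans _ _ (e * (\sum_x \sum_y f x y + \sum_x \sum_y f y x))).
  rewrite -big_split mulr_sumr; apply: le_trans (ler_norm_sum _ _ _) _.
  apply: ler_sum => x _; rewrite -big_split mulr_sumr.
  apply: le_trans (ler_norm_sum _ _ _) _; apply: ler_sum => y _ /=.
  have -> : e * (f x y + f y x) = (e * (R x y)%:R) * (2^-1 * `|u x| ^+ 2 + 2^-1 * `|u y| ^+ 2).
    by rewrite /f [R y x]Rs; ring.
  rewrite !normrM norm_conjC.
  case: (boolP (P x)) => [Px|/u0 ->]; last first.
    by rewrite normr0 !mul0r !mulr_ge0 // addr_ge0 ?mulr_ge0 ?invr_ge0 ?ler0n ?exprn_ge0.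
  case: (boolP (P y)) => [Py|/u0 ->]; last first.
    by rewrite normr0 !mulr0 !mulr_ge0 // addr_ge0 ?mulr_ge0 ?invr_ge0 ?ler0n ?exprn_ge0.
  rewrite [_ * `|A x y - _|]mulrC -[leLHS]mulrA.
  apply: ler_pM; [exact: normr_ge0 | by rewrite mulr_ge0 | exact: AB | exact: H].
rewrite [X in _ * (_ + X)]exchange_big /=.
apply: le_trans (ler_wpM2l e0 (lerD half half)) _.
by rewrite le_eqVlt; apply/orP; left; apply/eqP; field.
Qed.

Lemma qform_restrict_sum (X : finType) (P : pred X) (A : X -> X -> C) u :
  (forall x y, ~~ P x -> P y -> A x y = 0) -> (forall x, ~~ P x -> u x = 0) ->
  \sum_(x | P x) `|app A u x| ^+ 2 = nrm2 (app A u).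
Proof.
move=> A0 u0; rewrite /nrm2 [RHS](bigID P) /= [X in _ = _ + X]big1 ?addr0 // => x Px.
rewrite /app big1 ?normr0 ?expr0n // => y _.
by case: (boolP (P y)) => [Py|/u0 ->]; [rewrite A0 ?mul0r|rewrite mulr0].
Qed.

End SignatureTransport.

Section BottPeriodicity.
Variables (C : numClosedFieldType) (q : nat).
Hypotheses (archi : archimedean_field C) (q_gt1 : (1 < q)%N).

(** Multiplication by 1 - t in the group ring of Z/q, an element being given by its coefficients. *)
Definition cdiff (f : 'Z_q -> int) : 'Z_q -> int := fun j => f j - f (j - 1).

(* A family of nondegenerate hermitian forms on the graded space with weights [v],
   equivariant under the q-th roots of unity and constant outside the unit polydisc. *)
Record admissible n (I : finType) (v : I -> nat) (M : 'rV[C]_n -> I -> I -> C)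
    (Mi : I -> I -> C) (k c : C) : Prop := Admissible {
  adm_pos : 0 <= k /\ 0 < c;
  adm_herm : forall x, hermf (M x);
  adm_equiv : forall z (x : 'rV[C]_n) i j, z ^+ q = 1 -> z ^+ v j * M (z *: x) i j = z ^+ v i * M x i j;
  adm_bound : forall x i j, `|M x i j| <= k;
  adm_ucont : forall e, 0 < e -> exists2 d, 0 < d & forall x y : 'rV[C]_n,
     (forall l, `|x 0 l - y 0 l| <= d) -> forall i j, `|M x i j - M y i j| <= e;
  adm_gap : forall x u, c * nrm2 u <= nrm2 (app (M x) u);
  adm_const : forall (x : 'rV[C]_n) i j, (exists l, 1 <= `|x 0 l|) -> M x i j = Mi i j }.

Definition weight (I : finType) (v : I -> nat) (j : 'Z_q) : pred I := fun i => (v i)%:R == j.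

(** The new coordinate has index 0; it is the variable that gets quantized. *)
Definition rcons_coord n (t : C) (y : 'rV[C]_n) : 'rV[C]_n.+1 := row_mx (t%:M : 'rV_1) y.

Lemma rcons_coord0 n t (y : 'rV[C]_n) : rcons_coord t y 0 0 = t.
Proof.
rewrite /rcons_coord; have -> : 0 = lshift n 0 :> 'I_(1 + n) by exact: val_inj.
by rewrite (row_mxEl (t%:M : 'rV_1)) mxE mulr1n.
Qed.

Lemma rcons_coordS n t (y : 'rV[C]_n) l : rcons_coord t y 0 (lift ord0 l) = y 0 l.
Proof.
have -> : lift ord0 l = rshift 1 l by exact: val_inj.
by rewrite /rcons_coord (row_mxEr (t%:M : 'rV_1)).
Qed.

Lemma rcons_coordZ n z t (y : 'rV[C]_n) : z *: rcons_coord t y = rcons_coord (z * t) (z *: y).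
Proof.
apply/rowP => l; rewrite mxE; case: (unliftP ord0 l) => [l' ->|->].
  by rewrite !rcons_coordS mxE.
by rewrite !rcons_coord0.
Qed.

(** Every condition but the lower bound, which is supplied, passes through the averages that define
    [toep]; the position joins the weight. *)
Lemma quantize_admissible n (I : finType) (v : I -> nat) (M : 'rV[C]_n.+1 -> I -> I -> C)
    (Mi : I -> I -> C) (k c : C) L m Q w :
  L.-primitive_root w -> (0 < m <= L)%N -> (0 < Q)%N -> (q %| L)%N ->
  (forall y u, c / 16%:R * nrm2 u
     <= nrm2 (app (@toep C L m Q w I (fun t => M (rcons_coord t y))) u)) ->
  admissible v M Mi k c ->
  admissible (fun x : I * 'I_(m + Q) => v x.1 + x.2)%N
    (fun y => @toep C L m Q w I (fun t => M (rcons_coord t y)))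
    (@toep C L m Q w I (fun=> Mi)) k (c / 16%:R).
Proof.
move=> Lw /andP[m0 mL] Q0 qL gap [[k0 c0] hM eM bM uM gM cM].
have tb (M' : C -> I -> I -> C) x x' e : 0 <= e -> (forall t i j, `|M' t i j| <= e) ->
    `|@toep C L m Q w I M' x x'| <= e.
  move=> e0 He; have := toep_bound Lw m0 Q0 e0 (fun b t _ _ => He (pt m Q w b t) x.1 x'.1).
  by move/le_trans; apply; rewrite ler_piMr // lern1 leq_b1.
split.
- by rewrite divr_gt0.
- by move=> y; apply: toep_herm => t; exact: hM.
- move=> z y x x' zq; apply: (toep_equivariant Lw) => [|t i j].
    by case/dvdnP: qL => r ->; rewrite mulnC exprM zq expr1n.
  by rewrite -rcons_coordZ eM.
- by move=> y x x'; apply: tb.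
- move=> e e0; have [d d0 Hd] := uM e e0; exists d => // x y xy i j.
  rewrite toepB; apply: tb => [|t i' j']; first exact: ltW.
  apply: Hd => l; case: (unliftP ord0 l) => [l' ->|->].
    by rewrite !rcons_coordS.
  by rewrite !rcons_coord0 subrr normr0 ltW.
- exact: gap.
move=> y x x' [l yl]; apply: eq_toep => b t _ _; apply: cM.
by exists (lift ord0 l); rewrite rcons_coordS.
Qed.

End BottPeriodicity.

Lemma signature_empty (C : numClosedFieldType) (X : finType) (P : pred X) (A : X -> X -> C) :
  (forall x, ~~ P x) -> signature P A 0.
Proof.
move=> P0; have pd B : posdim P B 0 0.
  by exists (fun _ _ => 0); split=> // c [[]].
by exists 0%N; split=> //; rewrite eq_card0 // => x; apply/negbTE/P0.
Qed.

(** * One variable quantized: a signature computed in two ways *)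

Section Quantization.
Variables (C : numClosedFieldType) (q : nat).
Hypotheses (archi : archimedean_field C) (q_gt1 : (1 < q)%N).
Variables (n : nat) (I : finType) (v : I -> nat) (M : 'rV[C]_n.+1 -> I -> I -> C)
  (Mi : I -> I -> C) (k c e : C) (L m Q : nat) (w : C).
Hypotheses (Lw : L.-primitive_root w) (m_gt0 : (0 < m)%N) (mL : (m <= L)%N)
  (Q_gt0 : (0 < Q)%N) (qL : (q %| L)%N).
Local Notation T := (m + Q)%N.
Local Notation X := (I * 'I_T)%type.
Let M0 (t : C) := M (rcons_coord t 0).
Let A0 : X -> X -> C := @toep C L m Q w I M0.
Hypothesis adm : admissible q v M Mi k c.
Hypotheses (e_gt0 : 0 < e) (e_small : e ^+ 2 < c / 16%:R).
Hypothesis gap : forall u, c / 16%:R * nrm2 u <= nrm2 (app A0 u).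
Hypothesis slow : forall b t i j, (2 * m * #|I|)%:R *
       `|M0 (pt m Q w b.+1 t) i j - M0 (pt m Q w b t) i j| <= e.
Variables s s' : 'Z_q -> nat.
Hypothesis sP : forall j, signature (weight v j) (M 0) (s j).
Hypothesis s'P : forall j, signature (weight v j) Mi (s' j).

Let v' (x : X) : nat := (v x.1 + x.2)%N.
Let W (j : 'Z_q) : pred X := weight v' j.
Let T_gt0 : (0 < T)%N. Proof. by rewrite addn_gt0 m_gt0. Qed.

Lemma quantized_herm : hermf A0.
Proof. by apply: toep_herm => t; exact: (adm_herm adm). Qed.

(** A primitive q-th root of unity separates the weights modulo [q], so an equivariant entry between
    different weights is 0. *)
Lemma quantized_graded j (x y : X) : W j x -> ~~ W j y -> A0 x y = 0 /\ A0 y x = 0.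
Proof.
move=> Wx Wy; suff E : A0 x y = 0 by rewrite (quantized_herm y x) E rmorph0.
have [z zq] := @prim_root_exists C q (ltnW q_gt1).
have H := @toep_equivariant C L m Q w Lw I M0 M0 v z x y.
have {}H : z ^+ (v y.1 + y.2) * A0 x y = z ^+ (v x.1 + x.2) * A0 x y.
  apply: H => [|t i i'].
    by case/dvdnP: qL => r ->; rewrite mulnC exprM (prim_expr_order zq) expr1n.
  rewrite /M0; have := adm_equiv adm (rcons_coord t 0) i i' (prim_expr_order zq).
  by rewrite rcons_coordZ scaler0.
apply: contraNeq Wy => nz; rewrite /W /weight -(eqP Wx) /v'.
move/(mulIf nz)/eqP: H; rewrite (eq_prim_root_expr zq) => /eqP E.
apply/eqP/val_inj; rewrite /= !val_Zp_nat //.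
Qed.

(** The lattice is cut in two ways, [bot] with [up] and [low] with [top]; moving [low (j - 1)] by
    one step gives [up j]. *)
Let bot j : pred X := fun x => W j x && (x.2 == 0 :> nat).
Let up j : pred X := fun x => W j x && (x.2 != 0 :> nat).
Let top j : pred X := fun x => W j x && (x.2.+1 == T).
Let low j : pred X := fun x => W j x && (x.2.+1 != T).

Lemma bottom_split (x y : X) : (x.2 == 0 :> nat) != (y.2 == 0 :> nat) -> A0 x y = 0.
Proof.
move=> ne; rewrite /A0 (toep_bottom Lw m_gt0 Q_gt0 mL).
  case: eqP => [E|]; last by rewrite mulr0.
  by rewrite E eqxx in ne.
have [x0|x0] := eqVneq (x.2 : nat) 0%N; first by left.
by right; apply/eqP; move: ne; rewrite (negPf x0); case: (y.2 == 0%N :> nat).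
Qed.

Lemma top_split (x y : X) : (x.2.+1 == T) != (y.2.+1 == T) -> A0 x y = 0.
Proof.
move=> ne; rewrite /A0 (toep_top Lw m_gt0 Q_gt0 mL (A := Mi)).
- case: eqP => [E|]; last by rewrite mulr0.
  by rewrite E eqxx in ne.
- move=> t i j t1; apply: (adm_const adm); exists 0; by rewrite rcons_coord0.
have [xT|xT] := eqVneq x.2.+1 T; first by left.
by right; apply/eqP; move: ne; rewrite (negPf xT); case: (y.2.+1 == T).
Qed.

(** Both the other weights and the top slice split off, so the lower bound for the whole form
    restricts to [low j]. *)
Lemma low_gap j u : (forall x, ~~ low j x -> u x = 0) ->
  c / 16%:R * nrm2 u <= \sum_(x | low j x) `|app A0 u x| ^+ 2.
Proof.
move=> u0; rewrite qform_restrict_sum // => x y; rewrite /low negb_and negbK => /orP[Wx|Tx] /andP[Wy Ty].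
  by have [] := quantized_graded Wy Wx.
by apply: top_split; rewrite Tx (negPf Ty).
Qed.

Lemma signature_slice (A : I -> I -> C) (B : X -> X -> C) (a0 : 'I_T) j r :
  (forall i i', B (i, a0) (i', a0) = A i i') ->
  signature (weight v (j - a0%:R)) A r -> signature (fun x => W j x && (x.2 == a0)) B r.
Proof.
move=> BA; apply: (@signature_reindex _ _ _ _ _ _ _ fst (fun i => (i, a0))).
- move=> [i a] /andP[/eqP Wx /= /eqP Ea]; rewrite Ea in Wx *; split=> //; move: Wx.
  by rewrite /v' /= natrD => <-; rewrite /weight addrK.
- by move=> i /eqP Wi; rewrite /= eqxx andbT /W /weight /v' /= natrD Wi subrK.
by move=> [i a] [i' a'] /andP[_ /= /eqP ->] /andP[_ /= /eqP ->].
Qed.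

Let a_first : 'I_T := Ordinal T_gt0.
Let lt_last : (T.-1 < T)%N. Proof. by rewrite prednK. Qed.
Let a_last : 'I_T := Ordinal lt_last.

Lemma signature_bot j : signature (bot j) A0 (s j).
Proof.
have := @signature_slice (M 0) A0 a_first j (s j); rewrite subr0.
move=> H; apply: eq_signature (H _ (sP j)) => // i i'.
rewrite /A0 (toep_bottom Lw m_gt0 Q_gt0 mL) /=; last by left.
rewrite ?eqxx mulr1 /M0; congr (M _ _ _); apply/rowP => l; rewrite [RHS]mxE.
by case: (unliftP ord0 l) => [l' ->|->]; rewrite ?rcons_coordS ?rcons_coord0 ?mxE.
Qed.

Lemma signature_top j : signature (top j) A0 (s' (j - (T.-1)%:R)%R).
Proof.
have H := @signature_slice Mi A0 a_last j (s' (j - (T.-1)%:R)%R).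
apply: eq_signature (H _ (s'P _)) => [x|i i'].
  by rewrite /top; congr (_ && _); rewrite -val_eqE /= -eqSS prednK.
rewrite /A0 (toep_top Lw m_gt0 Q_gt0 mL (A := Mi)) /=.
- by rewrite ?eqxx mulr1.
- by move=> t i1 i2 t1; apply: (adm_const adm); exists 0; rewrite rcons_coord0.
by left; rewrite prednK.
Qed.

Lemma signature_constant j :
  signature (W j) (@toep C L m Q w I (fun=> Mi)) (\sum_(a < T) s' (j - a%:R)%R).
Proof.
set B := toep _ _ _.
suff H t : (t <= T)%N -> signature (fun x => W j x && (x.2 < t)%N) B (\sum_(a < t) s' (j - a%:R)%R).
  by apply: eq_signature (H T (leqnn T)) => x; rewrite ltn_ord andbT.
elim: t => [|t IHt] tT.
  by rewrite big_ord0; apply: signature_empty => x; rewrite ltn0 andbF.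
rewrite big_ord_recr /=.
apply: (signature_add (P1 := fun x => W j x && (x.2 < t)%N)
  (P2 := fun x : X => W j x && (x.2 == Ordinal tT)) _ _ _ (IHt (ltnW tT))).
- by move=> x; rewrite ltnS leq_eqVlt -andb_orr orbC.
- move=> x y /andP[_ xt] /andP[_ /eqP yt]; rewrite /B !(toep_const Lw m_gt0 Q_gt0 mL).
  have ne : (x.2 == y.2) = false by rewrite yt -val_eqE /= ltn_eqF.
  by rewrite [y.2 == _]eq_sym ne !mulr0.
- move=> x; apply/negP => /andP[/andP[_ xt] /andP[_ /eqP xE]].
  by move: xt; rewrite xE ltnn.
apply: signature_slice (s'P _) => i i'.
by rewrite /B (toep_const Lw m_gt0 Q_gt0 mL) /= ?eqxx mulr1.
Qed.

Lemma low_signature j : exists r, exists l,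
  [/\ (r + l = #|low j|)%N, posdim (low j) A0 e r & posdim (low j) (negA A0) e l].
Proof.
exact: (signature_exists quantized_herm (ltW e_gt0) e_small (@low_gap j)).
Qed.

(** Cyclic, in order to be total; from [low] to [up] there is no wrapping around. *)
Let succ (x : X) : X := (x.1, ordS x.2).
Let prev (x : X) : X := (x.1, ord_pred x.2).

Lemma succ_low j x : low (j - 1) x -> up j (succ x) /\ prev (succ x) = x.
Proof.
case: x => i a /andP[/eqP Wx /= Tx]; split; last by rewrite /prev /succ /= ordSK.
have lt : (a.+1 < T)%N by rewrite ltn_neqAle Tx /=.
rewrite /up /succ /= modn_small // andbT /W /weight /v' /= modn_small //.
by rewrite addnS -natr1 [_%:R]Wx subrK.
Qed.

Lemma prev_up j x : up j x -> low (j - 1) (prev x) /\ succ (prev x) = x.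
Proof.
case: x => i a /andP[/eqP Wx /= Tx]; split; last by rewrite /prev /succ /= ord_predK.
have Ea : ((a + T).-1 %% T = a.-1)%N.
  have -> : ((a + T).-1 = a.-1 + T)%N by move: Tx; clear; lia.
  by rewrite modnDr modn_small // (leq_ltn_trans (leq_pred _)).
rewrite /low /prev /= Ea; apply/andP; split.
  rewrite /W /weight /v' /= Ea -Wx /v' /= -{2}(prednK (n := a)) ?lt0n //.
  by rewrite addnS -natr1 addrK.
by rewrite prednK ?lt0n // ltn_eqF.
Qed.

Lemma prev_val j x : up j x -> x.2 = (prev x).2.+1 :> nat.
Proof.
move=> ux; have [lowx Ex] := prev_up ux; rewrite -{1}Ex /succ.
case/andP: lowx => _ ne.
rewrite -[LHS]/((prev x).2.+1 %% T)%N modn_small // ltn_neqAle ne.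
exact: ltn_ord.
Qed.

Let near : rel X := fun x y => (x.2 < y.2 + m)%N && (y.2 < x.2 + m)%N.

Lemma card_near x : (#|[pred y | near x y]| <= 2 * m * #|I|)%N.
Proof.
case: x => i a.
have -> : #|[pred y | near (i, a) y]| = (#|I| * #|[pred b : 'I_T | (a < b + m) && (b < a + m)]|)%N.
  by rewrite -cardX; apply: eq_card => [[i' b]].
rewrite mulnC leq_mul2r; apply/orP; right.
apply: leq_trans (_ : \sum_(b < T) (a < b + m <= a + 2 * m : nat) <= _)%N.
  rewrite -sum1_card big_mkcond /=; apply: leq_sum => b _; rewrite inE.
  by case: ifP => // /andP[lt1 lt2]; rewrite lt1 /= (_ : (b + m <= _)%N) //; move: lt2; clear; lia.
by apply: leq_trans (count_shift_interval _ _ _ _) _; clear; lia.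
Qed.

Lemma translate_perturb j u : (forall x, ~~ up j x -> u x = 0) ->
  `|qform (fun x y => A0 (prev x) (prev y)) u - qform A0 u| <= e * nrm2 u.
Proof.
move=> u0; pose d : nat := (2 * m * #|I|)%N; pose e' := e / d%:R.
have e'0 : 0 <= e' by rewrite divr_ge0 ?ler0n // ltW.
have H : `|qform (fun x y => A0 (prev x) (prev y)) u - qform A0 u| <= d%:R * e' * nrm2 u.
  apply: (qform_perturb_le (P := up j) (R := near)) => //.
  - by move=> x y; rewrite /near andbC.
  - exact: card_near.
  move=> x y ux uy; have [_ Ex] := prev_up ux; have [_ Ey] := prev_up uy.
  have d0 : (0 < d)%N.
    by rewrite !muln_gt0 m_gt0 /=; apply/card_gt0P; exists x.1.
  have := @toep_translate C L m Q w Lw m_gt0 Q_gt0 I M0 e' x.1 y.1 (prev x).2 (prev y).2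
     x.2 y.2 e'0 (prev_val ux) (prev_val uy).
  rewrite distrC -!surjective_pairing => H; apply: le_trans (H _) _ => [b t|].
    by rewrite ler_pdivlMr ?ltr0n // mulrC; exact: slow.
  rewrite /near (prev_val ux) (prev_val uy).
  by rewrite !addSn !ltnS.
apply: le_trans H _; rewrite ler_wpM2r ?nrm2_ge0 // /e' mulrCA ler_piMr ?(ltW e_gt0) //.
by have [->|d0] := posnP d; rewrite ?mul0r // divff // pnatr_eq0 gtn_eqF.
Qed.

(** The translation by one step changes the form by no more than the margin [e], so the numbers of
    positive and negative signs persist. *)
Lemma shifted_signature (j : 'Z_q) r l : (r + l = #|low (j - 1)%R|)%N ->
  posdim (low (j - 1)) A0 e r -> posdim (low (j - 1)) (negA A0) e l ->
  signature (up j) A0 r.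
Proof.
move=> rl pr pl; pose B x y := A0 (prev x) (prev y).
have hB : hermf B by move=> x y; exact: quantized_herm.
have hN A : hermf A -> hermf (negA A) by move=> hA x y; rewrite /negA rmorphN /= -hA.
have up_low : (forall x, up j x -> low (j - 1) (prev x) /\ succ (prev x) = x) by exact: prev_up.
exists l; split.
- by rewrite rl; apply: (card_reindex up_low); exact: succ_low.
- have pB : posdim (up j) B e r by apply: (posdim_reindex up_low (@succ_low j) _ pr).
  by apply: posdim_perturb pB => //; [exact: quantized_herm | exact: translate_perturb].
have pB : posdim (up j) (negA B) e l by apply: (posdim_reindex up_low (@succ_low j) _ pl).
apply: posdim_perturb pB; [exact: hN | exact/hN/quantized_herm|] => u u0.
rewrite !qform_negA -opprD normrN; exact: (translate_perturb u0).
Qed.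

(** With [r j] positive signs on [low j], the first cut gives [s j + r (j - 1)] and the second
    [r j + s' (j - (T - 1))]. Using the second at [j - 1] eliminates [r], and the two sums of [s']
    differ only in one term at each end. *)
Lemma quantized_signature : exists R : 'Z_q -> nat,
  (forall j, signature (W j) A0 (R j)) /\
  forall j, (R j)%:Z - (\sum_(a < T) s' (j - a%:R)%R)%:Z
     - ((R (j - 1))%:Z - (\sum_(a < T) s' (j - 1 - a%:R)%R)%:Z) = (s j)%:Z - (s' j)%:Z.
Proof.
have [r Hr] := fin_all_exists low_signature.
have split_bot j : signature (W j) A0 (s j + r (j - 1)).
  apply: (signature_add (P1 := bot j) (P2 := up j) _ _ _ (signature_bot j)).
  - move=> x; rewrite /bot /up -andb_orr orbN andbT //.
  - move=> x y /andP[_ x0] /andP[_ y0].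
    by split; apply: bottom_split; rewrite x0 (negPf y0).
  - by move=> x; rewrite /bot /up; case: (x.2 == 0%N :> nat); rewrite ?andbF.
  by have [l [rl p1 p2]] := Hr (j - 1); exact: shifted_signature p1 p2.
have split_top j : signature (W j) A0 (r j + s' (j - (T.-1)%:R)%R).
  apply: (signature_add (P1 := low j) (P2 := top j) _ _ _ _ (signature_top j)).
  - by move=> x; rewrite /low /top -andb_orr orNb andbT.
  - move=> x y /andP[_ x0] /andP[_ y0].
    by split; apply: top_split; rewrite y0 (negPf x0).
  - by move=> x; rewrite /low /top; case: (x.2.+1 == T); rewrite ?andbF.
  have [l [rl p1 p2]] := Hr j; exists l; split=> //; exact: posdim_weaken (ltW e_gt0) _.
exists (fun j => s j + r (j - 1)%R)%N; split=> [//|j].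
have E := signature_uniq (split_bot (j - 1)) (split_top (j - 1)).
have rot N : (0 < N)%N ->
    (\sum_(a < N) s' (j - a%:R)%R = s' j + \sum_(a < N.-1) s' (j - 1 - a%:R)%R)%N.
  case: N => // N _; rewrite big_ord_recl subr0; congr (_ + _)%N; apply: eq_bigr => a _.
  by rewrite lift0 -nat1r opprD addrA.
have last N : (0 < N)%N -> (\sum_(a < N) s' (j - 1 - a%:R)%R =
    \sum_(a < N.-1) s' (j - 1 - a%:R)%R + s' (j - 1 - (N.-1)%:R)%R)%N.
  by case: N => // N _; rewrite big_ord_recr.
rewrite (rot T) // (last T) //.
by rewrite E !PoszD /=; ring.
Qed.

End Quantization.

Section BottTheorem.
Variables (C : numClosedFieldType) (q : nat).
Hypotheses (archi : archimedean_field C) (q_gt1 : (1 < q)%N).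

(* Bott periodicity: quantizing one of the n variables by Toeplitz matrices replaces the
   difference class by a class divided by (1 - t), t acting on the weights by translation. *)
Theorem Bott_division n (I : finType) (v : I -> nat) (M : 'rV[C]_n -> I -> I -> C)
    (Mi : I -> I -> C) (k c : C) (s s' : 'Z_q -> nat) :
  admissible q v M Mi k c ->
  (forall j, signature (weight v j) (M 0) (s j)) ->
  (forall j, signature (weight v j) Mi (s' j)) ->
  exists f : 'Z_q -> int, forall j, (s j)%:Z - (s' j)%:Z = iter n (@cdiff q) f j.
Proof.
elim: n I v M Mi k c s s' => [|n IHn] I v M Mi k c s s' adm sP s'P.
  by exists (fun j => (s j)%:Z - (s' j)%:Z).
(* The quotient g / (g + 1) is below both 1 and [g], so its square is below [g]. *)
have [k0 c0] := adm_pos adm; pose g := c / 16%:R; pose e := g / (g + 1).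
have g0 : 0 < g by rewrite divr_gt0.
have e0 : 0 < e by rewrite divr_gt0 // addr_gt0.
have e1 : e < 1 by rewrite ltr_pdivrMr ?addr_gt0 // mul1r ltrDl.
have eg : e ^+ 2 < g.
  rewrite expr2; apply: (@lt_trans _ _ e); first by rewrite gtr_pMl.
  by rewrite ltr_pdivrMr ?addr_gt0 // ltr_pMr // ltrDr.
have [] := @toeplitz_uniform_gap C 'rV[C]_n I (fun y t => M (rcons_coord t y)) k c e q
   archi (ltnW q_gt1) k0 c0 e0.
- by move=> y x i j; exact: (adm_bound adm).
- move=> d d0; have [d' d'0 Hd'] := adm_ucont adm d0; exists d' => // y x x' i j xx'.
  apply: Hd' => l; case: (unliftP ord0 l) => [l' ->|->].
    by rewrite !rcons_coordS subrr normr0 ltW.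
  by rewrite !rcons_coord0.
- move=> y x x' i j x1 x1'; rewrite !(adm_const adm) //.
    by exists 0; rewrite rcons_coord0.
  by exists 0; rewrite rcons_coord0.
- by move=> y x u; exact: (adm_gap adm).
move=> L [m [Q [w [Lw /andP[m0 mL] Q0 qL [gap slow]]]]].
have [R [RP RE]] := quantized_signature q_gt1 Lw m0 mL Q0 qL adm e0 eg (gap 0) (slow 0) sP s'P.
have adm' := quantize_admissible Lw (introT andP (conj m0 mL)) Q0 qL gap adm.
have [f Hf] := IHn _ _ _ _ _ _ _ _ adm' RP (signature_constant Lw m0 mL Q0 s'P).
by exists f => j; rewrite -RE !Hf.
Qed.

End BottTheorem.

(** * The Koszul matrix and the Borsuk-Ulam bound *)

Section Koszul.
Variable C : numClosedFieldType.

(** Subsets of an m-element set: the basis of the exterior algebra. *)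
Fixpoint kidx (m : nat) : finType :=
  match m with 0 => unit | m'.+1 => (bool * kidx m')%type end.

(* The hermitian matrix [a * eps + g /\ + (g /\)^*] on the exterior algebra of C^m,
   eps being the parity; its square is the scalar [a^2 + |g|^2]. *)
Fixpoint kmat (a : C) (g : nat -> C) (m : nat) : kidx m -> kidx m -> C :=
  match m return kidx m -> kidx m -> C with
  | 0 => fun _ _ => a
  | m'.+1 => fun i j =>
      if i.1 then (if j.1 then - kmat a g i.2 j.2 else g m' * (i.2 == j.2)%:R)
      else (if j.1 then (g m')^* * (i.2 == j.2)%:R else kmat a g i.2 j.2)
  end.

Fixpoint kwt (W : nat -> nat) (m : nat) : kidx m -> nat :=
  match m return kidx m -> nat with
  | 0 => fun _ => 0%N
  | m'.+1 => fun i => ((if i.1 then W m' else 0) + kwt W i.2)%N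
  end.

Fixpoint kpar (m : nat) : kidx m -> bool :=
  match m return kidx m -> bool with
  | 0 => fun _ => false
  | m'.+1 => fun i => i.1 (+) kpar i.2
  end.

Lemma kmat_herm a g m : a \is Num.real -> hermf (kmat a g (m := m)).
Proof.
move=> ar; elim: m => [|m IHm] /=; first by move=> i j; rewrite conj_Creal.
move=> [[] i] [[] j] /=; rewrite ?rmorphN /= -?IHm //.
  by rewrite rmorphM /= conjCK rmorph_nat eq_sym.
by rewrite rmorphM /= rmorph_nat eq_sym.
Qed.

Lemma kmat_equiv (z a : C) (g g' : nat -> C) (W : nat -> nat) m (i j : kidx m) :
  z * z^* = 1 -> (forall l, (l < m)%N -> g' l = z ^+ W l * g l) ->
  z ^+ kwt W j * kmat a g' i j = z ^+ kwt W i * kmat a g i j.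
Proof.
move=> zz; elim: m i j => [|m IHm] //= [bi i] [bj j] gg /=.
have zzn n : z ^+ n * (z ^+ n)^* = 1 by rewrite rmorphXn -exprMn zz expr1n.
have {}IHm := IHm i j (fun l lt => gg l (ltnW lt)).
case: bi; case: bj => //=; rewrite ?add0n ?exprD.
- by rewrite !mulrN -!mulrA IHm.
- by rewrite gg // ; case: (eqVneq i j) => [->|_]; rewrite ?mulr0 ?mulr1 //; ring.
rewrite gg // rmorphM /=; case: (eqVneq i j) => [->|_]; rewrite ?mulr0 ?mulr1 //.
by rewrite mulrAC mulrA zzn mul1r mulrC.
Qed.

Lemma kmat_bound (a k : C) g m (i j : kidx m) : 0 <= k -> `|a| <= k ->
  (forall l, (l < m)%N -> `|g l| <= k) -> `|kmat a g i j| <= k.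
Proof.
move=> k0 ak; elim: m i j => [|m IHm] //= [bi i] [bj j] gk /=.
have {}IHm := IHm i j (fun l lt => gk l (ltnW lt)).
have H (x : C) (b : bool) : `|x| <= k -> `|x * b%:R| <= k.
  by case: b; rewrite ?mulr1 // mulr0 normr0.
case: bi; case: bj => //=; rewrite ?normrN //; apply: H; rewrite ?norm_conjC; exact: gk.
Qed.

Lemma kmat_dist (a a' k : C) g g' m (i j : kidx m) : 0 <= k -> `|a - a'| <= k ->
  (forall l, (l < m)%N -> `|g l - g' l| <= k) -> `|kmat a g i j - kmat a' g' i j| <= k.
Proof.
move=> k0 ak; elim: m i j => [|m IHm] //= [bi i] [bj j] gk /=.
have {}IHm := IHm i j (fun l lt => gk l (ltnW lt)).
have H (x y : C) (b : bool) : `|x - y| <= k -> `|x * b%:R - y * b%:R| <= k.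
  by case: b; rewrite ?mulr1 // !mulr0 subrr normr0.
case: bi; case: bj => //=.
- by rewrite -opprD normrN.
- exact/H/gk.
by apply: H; rewrite -rmorphB norm_conjC gk.
Qed.

Lemma hermf_dot (I : finType) (A : I -> I -> C) (u v : I -> C) : hermf A ->
  \sum_i (app A u i)^* * v i = \sum_i (u i)^* * app A v i.
Proof.
move=> hA; under eq_bigr do rewrite rmorph_sum mulr_suml.
rewrite exchange_big; apply: eq_bigr => j _ /=; rewrite mulr_sumr.
by apply: eq_bigr => i _; rewrite rmorphM /= -hA; ring.
Qed.

(** The Clifford relation: the cross terms between the blocks cancel because the smaller matrix is
    hermitian. *)
Lemma kmat_norm (a : C) g m (u : kidx m -> C) : a \is Num.real ->
  nrm2 (app (kmat a g (m := m)) u) = (`|a| ^+ 2 + \sum_(l < m) `|g l| ^+ 2) * nrm2 u.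
Proof.
move=> ar; elim: m u => [|m IHm] u.
  rewrite /nrm2 big_ord0 addr0 mulr_sumr; apply: eq_bigr => [[]] _.
  by rewrite /app (bigD1 tt) //= big1 ?addr0 => [|[]] //; rewrite -exprMn -normrM.
pose u0 i := u (false, i); pose u1 i := u (true, i).
pose A := kmat a g (m := m).
have nE (v : kidx m.+1 -> C) : nrm2 v = nrm2 (fun i => v (false, i)) + nrm2 (fun i => v (true, i)).
  by rewrite /nrm2 big_pair big_bool /= addrC.
have aE (B : kidx m.+1 -> kidx m.+1 -> C) i : app B u i =
    \sum_j B i (false, j) * u0 j + \sum_j B i (true, j) * u1 j.
  by rewrite /app big_pair big_bool /= addrC.
have dE (x : C) (w : kidx m -> C) i : \sum_j x * (i == j)%:R * w j = x * w i.
  rewrite (bigD1 i) //= eqxx mulr1 big1 ?addr0 // => j /negPf ji.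
  by rewrite eq_sym ji mulr0 mul0r.
rewrite nE [in RHS]nE big_ord_recr /=.
set S := \sum_(l < m) _; rewrite -/S in IHm.
have -> : nrm2 (fun i => app (kmat a g (m := m.+1)) u (false, i)) =
          nrm2 (fun i => app A u0 i + (g m)^* * u1 i).
  by apply: eq_nrm2 => i; rewrite aE /= dE.
have -> : nrm2 (fun i => app (kmat a g (m := m.+1)) u (true, i)) =
          nrm2 (fun i => g m * u0 i - app A u1 i).
  apply: eq_nrm2 => i; rewrite aE /= dE; congr (_ + _); rewrite /app -sumrN.
  by apply: eq_bigr => j _; rewrite mulNr.
have ex (x y : kidx m -> C) : nrm2 (fun i => x i + y i) =
    nrm2 x + nrm2 y + (\sum_i (x i)^* * y i + \sum_i (y i)^* * x i).
  rewrite /nrm2 -!big_split; apply: eq_bigr => i _ /=.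
  by rewrite !normCK rmorphD /=; ring.
have nZ (x : C) (y : kidx m -> C) : nrm2 (fun i => x * y i) = `|x| ^+ 2 * nrm2 y.
  by rewrite /nrm2 mulr_sumr; apply: eq_bigr => i _; rewrite normrM exprMn.
have nN (y : kidx m -> C) : nrm2 (fun i => - y i) = nrm2 y.
  by apply: eq_bigr => i _; rewrite normrN.
rewrite !ex nN !nZ !IHm norm_conjC.
have hA : hermf A by exact: kmat_herm.
have e1 : \sum_i (app A u0 i)^* * ((g m)^* * u1 i) = (g m)^* * \sum_i (u0 i)^* * app A u1 i.
  by rewrite -(hermf_dot _ _ hA) mulr_sumr; apply: eq_bigr => i _; ring.
have e2 : \sum_i ((g m)^* * u1 i)^* * app A u0 i = g m * \sum_i (app A u1 i)^* * u0 i.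
  rewrite (hermf_dot _ _ hA) mulr_sumr; apply: eq_bigr => i _.
  by rewrite rmorphM /= conjCK; ring.
have e3 : \sum_i (g m * u0 i)^* * - app A u1 i = - ((g m)^* * \sum_i (u0 i)^* * app A u1 i).
  by rewrite mulr_sumr -sumrN; apply: eq_bigr => i _; rewrite rmorphM /=; ring.
have e4 : \sum_i (- app A u1 i)^* * (g m * u0 i) = - (g m * \sum_i (app A u1 i)^* * u0 i).
  by rewrite mulr_sumr -sumrN; apply: eq_bigr => i _; rewrite rmorphN; ring.
by rewrite e1 e2 e3 e4 -/u0 -/u1; ring.
Qed.

Lemma kmat_diag (a : C) g m (i j : kidx m) : (forall l, (l < m)%N -> g l = 0) ->
  kmat a g i j = a * (-1) ^+ kpar i * (i == j)%:R.
Proof.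
elim: m i j => [|m IHm] /=; first by move=> [] []; rewrite ?eqxx !mulr1.
move=> [bi i] [bj j] g0 /=; rewrite xpair_eqE (g0 m) // rmorph0 !mul0r.
rewrite IHm; last by move=> l lt; apply: g0; exact: ltnW.
by case: bi; case: bj; rewrite //= ?mulr0 //; case: (kpar i); rewrite ?expr0 ?expr1; ring.
Qed.

Lemma signature_id (I : finType) (P : pred I) (A : I -> I -> C) :
  (forall i j, P i -> P j -> A i j = (i == j)%:R) -> signature P A #|P|.
Proof.
move=> AE; exists 0%N; split; first exact: addn0.
  exists (fun a i => (enum_val a == i)%:R); split=> [a i Pi|c [a ca]].
    case: eqP => // E; case/negP: Pi; rewrite -E; exact: (enum_valP a).
  set u := lincomb _ _; rewrite mul0r.
  have uE b : u (enum_val b) = c b.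
    rewrite /u /lincomb (bigD1 b) //= eqxx mulr1 big1 ?addr0 // => b' nb.
    by rewrite (inj_eq enum_val_inj) (negPf nb) mulr0.
  have u0 i : ~~ P i -> u i = 0.
    move=> Pi; rewrite /u /lincomb big1 // => b _.
    case: eqP => [E|]; last by rewrite mulr0.
    by case/negP: Pi; rewrite -E; exact: (enum_valP b).
  have -> : qform A u = nrm2 u.
    apply: eq_bigr => i _; case: (boolP (P i)) => [Pi|/u0 ->]; last first.
      by rewrite rmorph0 mul0r normr0 expr0n.
    rewrite normCK mulrC; congr (_ * _); rewrite /app (bigD1 i) //= AE // eqxx mul1r.
    rewrite big1 ?addr0 // => j ji; case: (boolP (P j)) => [Pj|/u0 ->]; last by rewrite mulr0.
    by rewrite AE // eq_sym (negPf ji) mul0r.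
  rewrite /nrm2 (bigD1 (enum_val a)) //= ltr_pwDl ?exprn_gt0 ?normr_gt0 ?uE //.
  by apply: sumr_ge0 => i _; rewrite exprn_ge0.
by exists (fun _ _ => 0); split=> // c [[]].
Qed.

Lemma signature_neg (I : finType) (P : pred I) (A : I -> I -> C) k :
  signature P A k -> signature P (negA A) (#|P| - k).
Proof.
move=> [l [E p n]]; exists k; split; first by rewrite -E addKn addnC.
  by rewrite -E addKn.
have [X [XP Xpos]] := p; exists X; split=> // c /Xpos.
by rewrite !qform_negA opprK.
Qed.

Lemma signature_sign (I : finType) (P : pred I) (b : I -> bool) (A : I -> I -> C) :
  (forall i j, A i j = (-1) ^+ b i * (i == j)%:R) ->
  signature P A #|[pred i | P i && ~~ b i]|.
Proof.
move=> AE; rewrite -[X in signature _ _ X]addn0.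
apply: (signature_add (P1 := fun i => P i && ~~ b i) (P2 := fun i => P i && b i)).
- by move=> i; rewrite -andb_orr orNb andbT.
- move=> i j /andP[_ bi] /andP[_ bj]; rewrite !AE.
  have -> : (i == j) = false by apply: contraNF bi => /eqP ->.
  by rewrite eq_sym (_ : (i == j) = false) ?mulr0 //; apply: contraNF bi => /eqP ->.
- by move=> i; case: (b i); rewrite ?andbF.
- apply: signature_id => i j /andP[_ /negPf bi] _.
  by rewrite AE bi expr0 mul1r.
have H : signature (fun i => P i && b i) (negA A) #|[pred i | P i && b i]|.
  by apply: signature_id => i j /andP[_ bi] _; rewrite /negA AE bi expr1 mulN1r opprK.
have := signature_neg H; rewrite subnn => -[l [E p n]]; exists l; split=> //.
  by have [X [XP Xpos]] := p; exists X; split=> // c /Xpos; rewrite !qform_negA opprK.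
by have [X [XP Xpos]] := n; exists X; split=> // c /Xpos; rewrite !qform_negA opprK.
Qed.

End Koszul.

(** * Weights as exponents modulo t^q - 1 *)

Section GeneratingPolynomial.
Variable q : nat.
Hypothesis q_gt1 : (1 < q)%N.
Implicit Types (f : 'Z_q -> int) (x y z : {poly int}).

Definition modXq x y := exists b, x = y + ('X^q - 1) * b.

Lemma modXq_refl x : modXq x x.
Proof. by exists 0; rewrite mulr0 addr0. Qed.

Lemma modXq_trans y x z : modXq x y -> modXq y z -> modXq x z.
Proof. by move=> [b ->] [b' ->]; exists (b + b'); ring. Qed.

Lemma modXq_sym x y : modXq x y -> modXq y x.
Proof. by move=> [b ->]; exists (- b); ring. Qed.

Lemma modXqM x y z : modXq x y -> modXq (z * x) (z * y).
Proof. by move=> [b ->]; exists (z * b); ring. Qed.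

Lemma modXq_sum (I : finType) (F G : I -> {poly int}) :
  (forall i, modXq (F i) (G i)) -> modXq (\sum_i F i) (\sum_i G i).
Proof.
move=> H; have [b Hb] := fin_all_exists H; exists (\sum_i b i).
by rewrite mulr_sumr -big_split; apply: eq_bigr => i _; rewrite Hb.
Qed.

Lemma modXq_exp a : modXq 'X^a 'X^(a %% q).
Proof.
exists ('X^(a %% q) * \sum_(i < a %/ q) ('X^q) ^+ i).
by rewrite mulrCA -subrX1 -exprM {1}(divn_eq a q) exprD [(q * _)%N]mulnC; ring.
Qed.

Definition gen f : {poly int} := \sum_j (f j)%:P * 'X^j.

Lemma gen_cdiff f : modXq (gen (cdiff f)) ((1 - 'X) * gen f).
Proof.
have -> : gen (cdiff f) = gen f - \sum_(j : 'Z_q) (f j)%:P * 'X^((j + 1)%R : 'Z_q).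
  rewrite /gen [X in _ = _ - X](reindex_inj (subIr 1)) -sumrB.
  by apply: eq_bigr => j _; rewrite subrK /cdiff polyCB mulrBl.
have [|b Eb] := @modXq_sum 'Z_q (fun j => (f j)%:P * 'X^((j + 1)%R : 'Z_q))
    (fun j => (f j)%:P * 'X^(j.+1)).
  move=> j; apply: modXqM; apply: modXq_sym; have := modXq_exp j.+1.
  have -> : (j + 1)%R = (j.+1)%:R :> 'Z_q by rewrite -natr1 natr_Zp.
  by rewrite val_Zp_nat.
exists (- b); rewrite Eb.
have -> : \sum_(j : 'Z_q) (f j)%:P * 'X^(j.+1) = 'X * gen f.
  by rewrite /gen mulr_sumr; apply: eq_bigr => j _; rewrite exprS; ring.
by ring.
Qed.

Lemma gen_iter_cdiff n f : modXq (gen (iter n (@cdiff q) f)) ((1 - 'X) ^+ n * gen f).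
Proof.
elim: n => [|n IHn]; first by rewrite expr0 mul1r; exact: modXq_refl.
by rewrite iterS exprS -mulrA; apply: modXq_trans (gen_cdiff _) _; exact: modXqM.
Qed.

(** Expanding the product over subsets gives the Euler characteristic of the exterior algebra weight
    by weight. *)
Lemma gen_koszul (W : nat -> nat) m :
  modXq (gen (fun j => #|[pred i : kidx m | weight (kwt W (m := m)) j i && ~~ kpar i]|%:Z
              - #|[pred i : kidx m | weight (kwt W (m := m)) j i && kpar i]|%:Z))
    (\prod_(l < m) (1 - 'X^(W l))).
Proof.
have -> : \prod_(l < m) (1 - 'X^(W l)) = \sum_(i : kidx m) (-1) ^+ kpar i * 'X^(kwt W i) :> {poly int}.
  elim: m => [|m IHm]; first by rewrite big_ord0 (bigD1 tt) //= big1 ?addr0 ?mul1r // => [[]].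
  rewrite big_ord_recr /= IHm big_pair big_bool /= -big_split mulr_suml; apply: eq_bigr => i _ /=.
  by rewrite add0n exprD; case: (kpar i); rewrite /= ?expr0 ?expr1; ring.
apply: modXq_sym; apply: modXq_trans.
  apply: (modXq_sum (G := fun i : kidx m => (-1) ^+ kpar i * 'X^(kwt W i %% q))) => i.
  exact/modXqM/modXq_exp.
rewrite (partition_big (fun i : kidx m => (kwt W i)%:R : 'Z_q) xpredT) //= /gen.
rewrite (eq_bigr (fun j : 'Z_q => (#|[pred i : kidx m | weight (kwt W (m := m)) j i && ~~ kpar i]|%:Z
   - #|[pred i : kidx m | weight (kwt W (m := m)) j i && kpar i]|%:Z)%:P * 'X^j)).
  exact: modXq_refl.
move=> j _; rewrite (bigID (@kpar m)) /= addrC.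
rewrite (eq_bigr (fun=> 'X^j)); last first.
  by move=> i /andP[/eqP <- /negPf ->]; rewrite val_Zp_nat // mul1r.
rewrite [X in _ + X](eq_bigr (fun=> - 'X^j)); last first.
  by move=> i /andP[/eqP <- ->]; rewrite val_Zp_nat // mulN1r.
rewrite !sumr_const polyCB mulrBl mulNrn; congr (_ - _).
  by rewrite -mulr_natl -polyC_natr natz.
by rewrite -mulr_natl -polyC_natr natz.
Qed.

End GeneratingPolynomial.

(** At the centre the Koszul matrix is the parity, positive on even degrees; outside it is the
    opposite, positive on odd degrees. The difference of the two signatures is therefore the Euler
    class, to which [Bott_division] and [Euler_class_valuation] apply. *)
Theorem Borsuk_Ulam_bound (C : numClosedFieldType) (p k n m : nat) (W : nat -> nat)
    (a : 'rV[C]_n -> C) (g : nat -> 'rV[C]_n -> C) (K c : C) (l0 : 'I_m) :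
  archimedean_field C -> prime p -> 0 <= K -> 0 < c ->
  (forall l, (l < m)%N -> (0 < W l)%N /\ (logn p (W l) <= k)%N) -> logn p (W l0) = k ->
  (forall x, a x \is Num.real) -> a 0 = 1 ->
  (forall x : 'rV[C]_n, (exists i, 1 <= `|x 0 i|) -> a x = -1 /\ forall l, (l < m)%N -> g l x = 0) ->
  (forall l, (l < m)%N -> g l 0 = 0) ->
  (forall z x, z ^+ (p ^ k.+1) = 1 ->
     a (z *: x) = a x /\ forall l, (l < m)%N -> g l (z *: x) = z ^+ W l * g l x) ->
  (forall x, `|a x| <= K /\ forall l, (l < m)%N -> `|g l x| <= K) ->
  (forall e, 0 < e -> exists2 d, 0 < d & forall x y : 'rV[C]_n,
     (forall i, `|x 0 i - y 0 i| <= d) ->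
     `|a x - a y| <= e /\ forall l, (l < m)%N -> `|g l x - g l y| <= e) ->
  (forall x, c <= `|a x| ^+ 2 + \sum_(l < m) `|g l x| ^+ 2) ->
  (n <= (\sum_(l < m | l != l0) p ^ logn p (W l)).+1)%N.
Proof.
move=> archi pr_p K0 c0 HW Wl0 ar a0 outer g0 eqv bnd uc gap.
set q := (p ^ k.+1)%N.
have q1 : (1 < q)%N by rewrite /q -(exp1n k.+1) ltn_exp2r // prime_gt1.
pose M (x : 'rV[C]_n) := kmat (a x) (fun l => g l x) (m := m).
pose Mi : kidx m -> kidx m -> C := kmat (-1) (fun=> 0) (m := m).
have adm : admissible q (kwt W (m := m)) M Mi K c.
  split=> //.
  - by move=> x; exact: kmat_herm.
  - move=> z x i j zq; rewrite /M; have [-> gz] := eqv z x zq; apply: kmat_equiv => //.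
    have z1 : `|z| = 1.
      have := congr1 (fun x : C => `|x|) zq; rewrite normrX normr1 => /eqP.
      by rewrite pexpr_eq1 ?expn_gt0 ?prime_gt0 // => /eqP.
    by rewrite -normCK z1 expr1n.
  - by move=> x i j; have [] := bnd x; exact: kmat_bound.
  - move=> e e0; have [d d0 Hd] := uc e e0; exists d => // x y xy i j.
    by have [H1 H2] := Hd x y xy; apply: kmat_dist => //; exact: ltW.
  - by move=> x u; rewrite kmat_norm // ler_wpM2r ?nrm2_ge0.
  move=> x i j /outer [ax gx]; by rewrite /M /Mi !kmat_diag // ax.
have sP j : signature (weight (kwt W (m := m)) j) (M 0)
    #|[pred i : kidx m | weight (q := q) (kwt W (m := m)) j i && ~~ kpar i]|.
  apply: signature_sign => i i'; rewrite /M kmat_diag ?a0 ?mul1r // => l; exact: g0.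
have s'P j : signature (weight (kwt W (m := m)) j) Mi
    #|[pred i : kidx m | weight (q := q) (kwt W (m := m)) j i && kpar i]|.
  have -> : #|[pred i : kidx m | weight (q := q) (kwt W (m := m)) j i && kpar i]| =
    #|[pred i : kidx m | weight (q := q) (kwt W (m := m)) j i && ~~ ~~ kpar i]|.
    by apply: eq_card => i; rewrite !inE negbK.
  apply: (@signature_sign _ _ _ (fun i => ~~ kpar i)) => i i'; rewrite /Mi kmat_diag //.
  by case: (kpar i); rewrite /= ?expr0 ?expr1; ring.
have [f Hf] := Bott_division archi q1 adm sP s'P.
have [b Eb] := gen_iter_cdiff q1 n f.
have [b' Eb'] := modXq_sym (gen_koszul q1 W m).
have Egen : gen (fun j => #|[pred i : kidx m | weight (q := q) (kwt W (m := m)) j i && ~~ kpar i]|%:Z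
              - #|[pred i : kidx m | weight (q := q) (kwt W (m := m)) j i && kpar i]|%:Z)
   = gen (iter n (@cdiff q) f).
  by apply: eq_bigr => j _; rewrite Hf.
rewrite Egen Eb in Eb'.
pose s := [seq W l | l : 'I_m <- enum 'I_m & l != l0].
have [W0 _] := HW l0 (ltn_ord l0).
have Hs x : x \in s -> (0 < x)%N /\ (logn p x <= k)%N.
  by case/mapP => l _ ->; exact: HW.
have := @Euler_class_valuation p k n (W l0) s (b + b') (gen f) pr_p W0 Wl0 Hs.
have -> : (\sum_(x <- s) p ^ logn p x = \sum_(l < m | l != l0) p ^ logn p (W l))%N.
  by rewrite /s big_map big_filter big_enum_cond; apply: eq_bigl.
have -> : \prod_(x <- s) (1 - 'X^x) = \prod_(l < m | l != l0) (1 - 'X^(W l)) :> {poly int}.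
  by rewrite /s big_map big_filter big_enum_cond; apply: eq_bigl.
have -> : (1 - 'X^(W l0)) * \prod_(l < m | l != l0) (1 - 'X^(W l))
    = \prod_(l < m) (1 - 'X^(W l)) :> {poly int} by rewrite [RHS](bigD1 l0).
by apply; rewrite Eb' /q; ring.
Qed.

(** * Representations of cyclic p-groups *)

Section CyclicRepresentations.
Variables (C : numClosedFieldType) (p k : nat) (z : C).
Hypothesis p_pr : prime p.
Local Notation q := (p ^ k.+1)%N.
Hypothesis zq : q.-primitive_root z.

Lemma q_gt1 : (1 < q)%N.
Proof. by rewrite -(exp1n k.+1) ltn_exp2r // prime_gt1. Qed.

Lemma Zp_expgE r (x : 'Z_r) n : (x ^+ n)%g = x *+ n.
Proof. by elim: n => // n IHn; rewrite expgS mulrS IHn. Qed.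

Lemma Zpk_exp (g : 'Z_q) : g = ((1%R : 'Z_q) ^+ g)%g.
Proof. by rewrite Zp_expgE; apply/esym; apply: natr_Zp. Qed.

Lemma Zpk_expq : ((1%R : 'Z_q) ^+ q)%g = 1%g.
Proof. by rewrite Zp_expgE; exact: pchar_Zp q_gt1. Qed.

(** The generator is annihilated by X^q - 1, which has simple roots, all powers of [z]. *)
Lemma cyclic_diagonalize n (rG : mx_representation C (Zpk p k) n) :
  exists (S : 'M[C]_n) (b : 'I_n -> nat), [/\ S \in unitmx, forall i, (b i < q)%N &
    forall g : 'Z_q, S *m rG g = diag_mx (\row_i z ^+ (b i * g)) *m S].
Proof.
case: n rG => [|n] rG.
  exists 1%:M, (fun=> 0%N); split=> [|[]|g]; first exact: unitmx1.
    by move=> m; case.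
  by apply/matrixP => -[].
have [|S Su] := (diagonalizableP (rG 1)).2.
  exists [seq z ^+ i | i <- index_iota 0 q].
    rewrite map_inj_in_uniq ?iota_uniq // => i j; rewrite !mem_index_iota /= => iq jq.
    by move/eqP; rewrite (eq_prim_root_expr zq) !modn_small // => /eqP.
  rewrite big_map (factor_Xn_sub_1 zq); apply/mxminpoly_minP.
  rewrite rmorphB rmorph1 /= rmorphXn /= horner_mx_X -repr_mxX ?inE //.
  by rewrite Zpk_expq repr_mx1 subrr.
move=> /similar_diagPex[D /(similarP Su) ED].
have EX m : S *m rG (1 : 'Z_q) ^+ m = diag_mx D ^+ m *m S.
  elim: m => [|m IHm]; first by rewrite !expr0 mulmx1 mul1mx.
  by rewrite exprSr -mulmxE mulmxA IHm -mulmxA ED mulmxA exprSr -mulmxE.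
have DX m : diag_mx D ^+ m = diag_mx (\row_i D 0 i ^+ m).
  elim: m => [|m IHm].
    rewrite expr0; apply/matrixP => i j; rewrite !mxE expr0 //.
  rewrite exprSr IHm -mulmxE mulmx_diag; congr diag_mx; apply/rowP => i.
  by rewrite !mxE exprSr.
have Dq i : D 0 i ^+ q = 1.
  have := EX q; rewrite -repr_mxX ?inE //.
  rewrite Zpk_expq repr_mx1 mulmx1 => /(congr1 (mulmx^~ (invmx S))).
  rewrite mulmxV // -mulmxA mulmxV // mulmx1 DX => /matrixP/(_ i i).
  by rewrite !mxE eqxx mulr1n.
have Hb' i : exists m, (m < q)%N /\ D 0 i = z ^+ m.
  by have [j Ej] := prim_rootP zq (Dq i); exists j.
have [b Hb] := fin_all_exists Hb'; exists S, b; split=> // [i|g].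
  by have [] := Hb i.
rewrite {1}[g]Zpk_exp repr_mxX ?inE // EX DX; congr (diag_mx _ *m S).
by apply/rowP => i; rewrite !mxE; have [_ ->] := Hb i; rewrite exprM.
Qed.

Variables (d : nat) (rV : mx_representation C (Zpk p k) d).
Variables (S : 'M[C]_d) (a : 'I_d -> nat).
Hypotheses (S_unit : S \in unitmx) (a_lt : forall i, (a i < q)%N).
Hypothesis S_diag : forall g : 'Z_q, S *m rV g = diag_mx (\row_i z ^+ (a i * g)) *m S.

(** The rows of [S] are weight vectors: those in [P] are fixed, and a fixed vector has no component
    along the others. *)
Lemma rank_rfix (H : {set 'Z_q}) (h : nat) : H = <[(h%:R : 'Z_q)]>%g ->
  \rank (rfix_mx rV H) = #|[pred i | (q %| a i * h)%N]|.
Proof.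
move=> HE; set P := [pred i | _].
pose E : 'M[C]_(#|P|, d) := rowsub enum_val S.
have rowEE (r : 'I_#|P|) : row r E = row (enum_val r) S by apply/rowP => j; rewrite !mxE.
have zP (i : 'I_d) : (z ^+ (a i * h) == 1) = P i.
  by rewrite -(prim_order_dvd zq).
have EF : (E :=: rfix_mx rV H)%MS.
  apply/eqmxP/andP; split.
    apply/rfix_mxP => x; rewrite HE => /cycleP[n ->].
    apply/row_matrixP => r; rewrite row_mul rowEE -row_mul S_diag row_mul row_diag_mx.
    rewrite -scalemxAl -rowE mxE.
    have -> : z ^+ (a (enum_val r) * ((h%:R : 'Z_q) ^+ n)%g) = 1.
      rewrite Zp_expgE -mulrnA val_Zp_nat ?q_gt1 //.
      have /eqP E1 : z ^+ (a (enum_val r) * h) == 1 by rewrite zP; exact: (enum_valP r).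
      rewrite -[RHS](expr1n _ n) -E1 -exprM -mulnA.
      by apply/eqP; rewrite (eq_prim_root_expr zq) modnMmr.
    by rewrite scale1r.
  pose F := rfix_mx rV H; pose Y := F *m invmx S.
  have hH : (h%:R : 'Z_q) \in H by rewrite HE cycle_id.
  have YS : F = Y *m S by rewrite mulmxKV.
  have YD : Y *m diag_mx (\row_i z ^+ (a i * (h%:R : 'Z_q))) = Y.
    have /rfix_mxP/(_ _ hH) : (F <= rfix_mx rV H)%MS by [].
    rewrite {1}YS -mulmxA S_diag mulmxA => /(congr1 (mulmx^~ (invmx S))).
    by rewrite mulmxK.
  have Y0 r i : ~~ P i -> Y r i = 0.
    move=> Pi; move/matrixP/(_ r i): YD; rewrite mul_mx_diag !mxE => /eqP.
    rewrite -subr_eq0 -[X in _ - X]mulr1 -mulrBr mulf_eq0 => /orP[/eqP->//|].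
    rewrite subr_eq0 val_Zp_nat ?q_gt1 // => /eqP E1.
    case/negP: Pi; rewrite -zP -E1; apply/eqP/eqP.
    by rewrite (eq_prim_root_expr zq) modnMmr.
  apply/row_subP => r; rewrite -/F YS row_mul mulmx_sum_row; apply: summx_sub => i _.
  case: (boolP (P i)) => [Pi|/Y0 Yi]; last by rewrite mxE Yi scale0r sub0mx.
  apply: scalemx_sub; rewrite -(enum_rankK_in Pi Pi) -rowEE; exact: row_sub.
rewrite -EF; apply/eqP; rewrite -/(row_free E); apply/row_freeP.
exists (invmx S *m (rowsub enum_val 1%:M)^T).
rewrite /E -[S in rowsub _ S]mul1mx -mul_rowsub_mx mulmxA -[_ *m S *m _]mulmxA mulmxV // mulmx1.
apply/matrixP => r r'; rewrite !mxE (bigD1 (enum_val r)) //= big1 ?addr0 => [|i ne].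
  by rewrite !mxE eqxx mul1r eq_sym (inj_eq enum_val_inj).
by rewrite !mxE eq_sym (negPf ne) mul0r.
Qed.

(** The subgroup generated by [p ^ j] fixes exactly the weights of valuation at least [k.+1 - j], so
    consecutive fixed spaces differ by one valuation. *)
Lemma rep_mult_card l : (l <= k)%N -> (forall i, 0 < a i)%N ->
  rep_mult rV l = #|[pred i | logn p (a i) == l]|.
Proof.
move=> lk a0; have p0 := prime_gt0 p_pr.
have card_fix j : (j <= k.+1)%N -> \rank (rfix_mx rV (pow_subgroup p k j)) =
    #|[pred i | (k.+1 - j <= logn p (a i))%N]|.
  move=> jk; rewrite (@rank_rfix _ (p ^ j)%N) //; apply: eq_card => i; rewrite !inE.
  rewrite -{1}(subnK jk) expnD dvdn_pmul2r ?expn_gt0 ?p0 //.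
  by rewrite pfactor_dvdn.
have sub : (rfix_mx rV (pow_subgroup p k (k - l)) <= rfix_mx rV (pow_subgroup p k (k - l + 1)))%MS.
  apply/rfix_mxP => x xH; have /rfix_mxP := submx_refl (rfix_mx rV (pow_subgroup p k (k - l))).
  apply; move: xH; rewrite /pow_subgroup => /cycleP[n ->].
  by rewrite expnD expn1 Zp_expgE mulrnA -(mulrnA _ p n) -Zp_expgE mem_cycle.
have := mxrank_in_factmod (rfix_mx rV (pow_subgroup p k (k - l)))
          (rfix_mx rV (pow_subgroup p k (k - l + 1))).
rewrite -/(rep_mult rV l) (addsmx_idPr sub) !card_fix; try lia.
rewrite (_ : k.+1 - (k - l) = l.+1)%N; last by lia.
rewrite (_ : k.+1 - (k - l + 1) = l)%N; last by lia.
rewrite -(cardID [pred i | logn p (a i) == l] [pred i | (l <= logn p (a i))%N]).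
rewrite [X in _ = (X + _)%N](_ : _ = #|[pred i | logn p (a i) == l]|); last first.
  by apply: eq_card => i; rewrite !inE; case: eqP => [->|]; rewrite ?leqnn ?andbF.
rewrite [X in _ = (_ + X)%N](_ : _ = #|[pred i | (l < logn p (a i))%N]|); last first.
  by apply: eq_card => i; rewrite !inE ltn_neqAle eq_sym.
by move/eqP; rewrite eqn_add2r => /eqP.
Qed.

Lemma logn_le i : (0 < a i)%N -> (logn p (a i) <= k)%N.
Proof.
move=> ai; rewrite -ltnS -(@ltn_exp2l p) ?prime_gt1 //.
by apply: leq_ltn_trans (a_lt i); rewrite dvdn_leq // pfactor_dvdnn.
Qed.

(** The term of [l0] is [p ^ k], which leaves 1 after the subtraction of [p ^ k - 1]. *)
Lemma rep_delta_sum (l0 : 'I_d) : (forall i, 0 < a i)%N -> logn p (a l0) = k ->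
  rep_delta rV = (\sum_(i < d | i != l0) p ^ logn p (a i)).+1%:Z.
Proof.
move=> a0 l0k; rewrite /rep_delta.
have -> : \sum_(l < k.+1) (p ^ l * rep_mult rV l)%:Z = (\sum_(i < d) p ^ logn p (a i))%N%:Z.
  rewrite -(big_morph Posz PoszD (erefl _)); congr Posz.
  rewrite (partition_big (fun i => inord (logn p (a i)) : 'I_k.+1) xpredT) //=.
  apply: eq_bigr => l _; rewrite rep_mult_card //; last by rewrite -ltnS.
  have inE' i : (inord (logn p (a i)) == l :> 'I_k.+1) = (logn p (a i) == l).
    by rewrite -val_eqE /= inordK // ltnS logn_le.
  rewrite mulnC -sum_nat_const; apply: eq_big => [i|i]; first by rewrite inE' inE.
  by rewrite inE => /eqP ->.
by rewrite (bigD1 l0) //= l0k PoszD -addn1 PoszD; ring.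
Qed.

End CyclicRepresentations.

(** * Continuity and compactness in C^n *)

Section RowVectorTopology.
Variable C : numClosedFieldType.
Hypothesis archi : archimedean_field C.
Hypothesis compact_disc : forall r : C, compact [set z : C | `|z| <= r].

Lemma small_inv (e : C) : 0 < e -> exists N : nat, N.+1%:R^-1 < e.
Proof.
move=> e0; have [N N0 HN] := archi_div archi ler01 (divr_gt0 e0 (ltr0Sn C 1)).
exists N; apply: le_lt_trans (_ : e / 2 < e); last first.
  by rewrite ltr_pdivrMr ?ltr0n // ltr_pMr // ltr1n.
by rewrite -[X in X <= _]mul1r HN.
Qed.

Definition vnear n (d : C) (x y : 'rV[C]_n) := forall i, `|x 0 i - y 0 i| < d.

Lemma nbhs_vnear n (x : 'rV[C]_n) (P : set 'rV[C]_n) :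
  nbhs x P <-> exists2 d : C, 0 < d & forall y, vnear d x y -> P y.
Proof.
split.
  move=> /nbhs_ballP [e /= e0 H]; exists e => // y Hy; apply: H.
  by split=> // i j; rewrite ord1; exact: Hy.
move=> [e e0 H]; apply/nbhs_ballP; exists e => //= y [_ Hy]; apply: H => i; exact: Hy.
Qed.

Definition econt n (F : 'rV[C]_n -> C) := forall x (e : C), 0 < e ->
  exists2 d : C, 0 < d & forall y, vnear d x y -> `|F x - F y| < e.

Lemma econtP n (F : 'rV[C]_n -> C) : econt F <-> continuous F.
Proof.
split=> H x.
  move=> P /nbhs_ballP[e /= e0 He]; have [d d0 Hd] := H x e e0.
  by apply/nbhs_vnear; exists d => // y /Hd Hy; apply: He.
move=> e e0; have nb : nbhs (F x) (ball (F x) e) by apply/nbhs_ballP; exists e.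
have : nbhs x (F @^-1` (ball (F x) e)) by exact: (H x _ nb).
by move=> /nbhs_vnear[d d0 Hd]; exists d => // y; exact: Hd.
Qed.

Definition cbox n (r : C) : set 'rV[C]_n := [set x | forall i, `|x 0 i| <= r].

Lemma compact_cbox n r : compact (@cbox n r).
Proof. exact: (@rV_compact C n (fun=> [set z : C | `|z| <= r]) (fun=> @compact_disc r)). Qed.

(** The source of the uniform constants on compact sets: an index that is good near each point
    becomes, by monotonicity and compactness, one index for all of [K]. *)
Lemma compact_uniform n (K : set 'rV[C]_n) (P : nat -> 'rV[C]_n -> Prop) :
  compact K -> (forall N N' x, (N <= N')%N -> P N x -> P N' x) ->
  (forall x, K x -> exists N (d : C), 0 < d /\ forall y, vnear d x y -> P N y) ->
  exists N, forall x, K x -> P N x.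
Proof.
move=> /compact_near_coveringP cK mono loc.
have [|N _ HN] := cK nat \oo P _; last by exists N => x Kx; apply: (HN N) => /=.
move=> x Kx; have [N [d [d0 Hd]]] := loc x Kx.
exists ([set y | vnear d x y], [set N' | (N <= N')%N]) => /=.
  by split; [apply/nbhs_vnear; exists d | exists N].
by move=> [y N'] /= [xy NN']; apply: mono NN' _; exact: Hd.
Qed.

Lemma vnear_sym n d (x y : 'rV[C]_n) : vnear d x y -> vnear d y x.
Proof. by move=> H i; rewrite distrC. Qed.

Lemma vnear_trans n d d' (x y z : 'rV[C]_n) :
  vnear d x y -> vnear d' y z -> vnear (d + d') x z.
Proof.
move=> H H' i; rewrite -(subrKA (y 0 i)); apply: le_lt_trans (ler_normD _ _) _.
by rewrite ltrD.
Qed.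

Lemma vnear_le n d d' (x y : 'rV[C]_n) : d <= d' -> vnear d x y -> vnear d' x y.
Proof. by move=> dd H i; exact: lt_le_trans (H i) dd. Qed.

Lemma inv_mono (N N' : nat) : (N <= N')%N -> N'.+1%:R^-1 <= N.+1%:R^-1 :> C.
Proof. by move=> le; rewrite lef_pV2 ?posrE ?ltr0n // ler_nat. Qed.

Lemma econt_uniform n (K : set 'rV[C]_n) (F : 'rV[C]_n -> C) (e : C) :
  compact K -> econt F -> 0 < e ->
  exists2 d : C, 0 < d & forall x y, K x -> vnear d x y -> `|F x - F y| < e.
Proof.
move=> cK cF e0.
have [||N HN] := @compact_uniform n K (fun N x => forall y, vnear N.+1%:R^-1 x y -> `|F x - F y| < e) cK.
- by move=> N N' x NN' H y xy; apply: H; exact: (vnear_le (inv_mono NN') xy).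
- move=> x Kx; have e2 : 0 < e / 2 by rewrite divr_gt0.
  have [d d0 Hd] := cF x _ e2; have d2 : 0 < d / 2 by rewrite divr_gt0.
  have [N HN] := small_inv d2; exists N, (d / 2); split=> // y xy z yz.
  have xz : vnear d x z.
    by rewrite (splitr d); apply: vnear_trans xy (vnear_le (ltW HN) yz).
  have xy' : vnear d x y by apply: vnear_le xy; rewrite ler_pdivrMr // ler_peMr ?ler1n // ltW.
  rewrite -(subrKA (F x)); apply: le_lt_trans (ler_normD _ _) _.
  by rewrite [ltRHS]splitr ltrD ?Hd // distrC Hd.
by exists N.+1%:R^-1 => [|x y Kx xy]; [rewrite invr_gt0 | exact: HN].
Qed.

Lemma econt_bounded n (K : set 'rV[C]_n) (F : 'rV[C]_n -> C) :
  compact K -> econt F -> exists2 k : C, 0 <= k & forall x, K x -> `|F x| <= k.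
Proof.
move=> cK cF; have [|x Kx|N HN] := @compact_uniform n K (fun N x => `|F x| <= N%:R) cK.
- by move=> N N' x NN' /le_trans; apply; rewrite ler_nat.
- have [d d0 Hd] := cF x 1 ltr01.
  have [N HN] := archi (addr_ge0 ler01 (normr_ge0 (F x))).
  exists N, d; split=> // y /Hd xy; apply: le_trans HN.
  rewrite -[F y](subrK (F x)); apply: le_trans (ler_normD _ _) _.
  by rewrite lerD2r distrC ltW.
by exists N%:R.
Qed.

Lemma econt_pos n (K : set 'rV[C]_n) (F : 'rV[C]_n -> C) :
  compact K -> econt F -> (forall x, 0 <= F x) -> (forall x, K x -> 0 < F x) ->
  exists2 c : C, 0 < c & forall x, K x -> c <= F x.
Proof.
move=> cK cF F0 F1; have [|x Kx|N HN] := @compact_uniform n K (fun N x => N.+1%:R^-1 <= F x) cK.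
- by move=> N N' x NN'; exact/le_trans/inv_mono.
- have e2 : 0 < F x / 2 by rewrite divr_gt0 ?F1.
  have [d d0 Hd] := cF x _ e2; have [N HN] := small_inv e2.
  exists N, d; split=> // y /Hd xy; apply: le_trans (ltW HN) _.
  have : F x - F y < F x / 2.
    apply: le_lt_trans xy; apply: real_ler_norm.
    by apply: rpredB; apply: ger0_real.
  by rewrite ltrBlDr -ltrBlDl {1}[F x]splitr addrK; exact: ltW.
by exists N.+1%:R^-1 => //; rewrite invr_gt0.
Qed.

Lemma econt_cst n (c : C) : econt (fun _ : 'rV[C]_n => c).
Proof. by move=> x e e0; exists 1 => // y _; rewrite subrr normr0. Qed.

Lemma econt_coord n i : econt (fun x : 'rV[C]_n => x 0 i).
Proof. by apply/econtP; exact: coord_continuous. Qed.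

Lemma econtD n (F G : 'rV[C]_n -> C) : econt F -> econt G -> econt (fun x => F x + G x).
Proof. by move=> /econtP cF /econtP cG; apply/econtP => x; exact: (cvgD (cF x) (cG x)). Qed.

Lemma econtN n (F : 'rV[C]_n -> C) : econt F -> econt (fun x => - F x).
Proof. by move=> /econtP cF; apply/econtP => x; exact: (cvgN (cF x)). Qed.

Lemma econtM n (F G : 'rV[C]_n -> C) : econt F -> econt G -> econt (fun x => F x * G x).
Proof. by move=> /econtP cF /econtP cG; apply/econtP => x; exact: (cvgM (cF x) (cG x)). Qed.

Lemma econt_norm n (F : 'rV[C]_n -> C) : econt F -> econt (fun x => `|F x|).
Proof.
move=> cF x e e0; have [d d0 Hd] := cF x e e0; exists d => // y /Hd.
exact/le_lt_trans/ler_dist_dist.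
Qed.

Lemma econt_conj n (F : 'rV[C]_n -> C) : econt F -> econt (fun x => (F x)^*).
Proof.
move=> cF x e e0; have [d d0 Hd] := cF x e e0; exists d => // y /Hd.
by rewrite -rmorphB norm_conjC.
Qed.

Lemma econtX n (F : 'rV[C]_n -> C) m : econt F -> econt (fun x => F x ^+ m).
Proof.
move=> cF; elim: m => [|m IHm]; first exact: econt_cst.
by under eq_fun do rewrite exprS; exact: econtM.
Qed.

Lemma econt_sum n (I : finType) (F : I -> 'rV[C]_n -> C) :
  (forall i, econt (F i)) -> econt (fun x => \sum_i F i x).
Proof.
move=> cF; elim: (index_enum I) => [|i s IHs].
  by under eq_fun do rewrite big_nil; exact: econt_cst.
by under eq_fun do rewrite big_cons; exact: econtD.
Qed.

Lemma econt_prod n (I : finType) (F : I -> 'rV[C]_n -> C) :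
  (forall i, econt (F i)) -> econt (fun x => \prod_i F i x).
Proof.
move=> cF; elim: (index_enum I) => [|i s IHs].
  by under eq_fun do rewrite big_nil; exact: econt_cst.
by under eq_fun do rewrite big_cons; exact: econtM.
Qed.

Lemma econt_vnear n m (u : 'rV[C]_n -> 'rV[C]_m) x d :
  (forall i, econt (fun x => u x 0 i)) -> 0 < d ->
  exists2 d' : C, 0 < d' & forall y, vnear d' x y -> vnear d (u x) (u y).
Proof.
move=> cu d0; suff /nbhs_vnear : nbhs x [set y | vnear d (u x) (u y)] by [].
have H i : nbhs x [set y | `|u x 0 i - u y 0 i| < d].
  by apply/nbhs_vnear; have [d' d'0 Hd'] := cu i x d d0; exists d'.
have FF : Filter (nbhs x) by exact: nbhs_filter.
by have := @filter_forall _ _ (fun i => [set y | `|u x 0 i - u y 0 i| < d]) _ FF H; apply: filterS.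
Qed.

Lemma econt_comp n m (F : 'rV[C]_m -> C) (u : 'rV[C]_n -> 'rV[C]_m) :
  econt F -> (forall i, econt (fun x => u x 0 i)) -> econt (fun x => F (u x)).
Proof.
move=> cF cu x e e0; have [d d0 Hd] := cF (u x) e e0.
by have [d' d'0 Hd'] := econt_vnear x cu d0; exists d' => // y /Hd'/Hd.
Qed.

Lemma econt_inv n (F : 'rV[C]_n -> C) (c : C) : 0 < c -> (forall x, c <= `|F x|) ->
  econt F -> econt (fun x => (F x)^-1).
Proof.
move=> c0 Fc cF x e e0; have [d d0 Hd] := cF x (e * c ^+ 2) (mulr_gt0 e0 (exprn_gt0 2 c0)).
exists d => // y /Hd xy.
have F0 z : F z != 0 by rewrite -normr_gt0 (lt_le_trans c0).
have -> : (F x)^-1 - (F y)^-1 = (F y - F x) / (F x * F y).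
  by field; rewrite !F0.
rewrite normrM normfV ltr_pdivrMr ?normr_gt0 ?mulf_neq0 // distrC (lt_le_trans xy) //.
by rewrite ler_pM2l // normrM expr2 ler_pM // ltW.
Qed.

(** The positive part of a real number; it serves to build minima and maxima, [C] being only
    partially ordered. *)
Definition posp (x : C) : C := (x + `|x|) / 2.

Lemma econt_posp n (F : 'rV[C]_n -> C) : econt F -> econt (fun x => posp (F x)).
Proof. by move=> cF; exact: (econtM (econtD cF (econt_norm cF)) (@econt_cst n 2^-1)). Qed.

Lemma pospE x : 0 <= x -> posp x = x.
Proof. by move=> x0; rewrite /posp ger0_norm // mulrDl -splitr. Qed.

Lemma posp0 x : x <= 0 -> posp x = 0.
Proof. by move=> x0; rewrite /posp ler0_norm // subrr mul0r. Qed.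

Lemma posp_ge0 x : x \is Num.real -> 0 <= posp x.
Proof. by move=> xr; case/orP: xr => [x0|x0]; rewrite ?(pospE x0) ?(posp0 x0). Qed.

Lemma posp_real x : x \is Num.real -> posp x \is Num.real.
Proof. by move=> xr; rewrite ger0_real // posp_ge0. Qed.

End RowVectorTopology.

(** * General position *)

Section GeneralPosition.
Variable C : numClosedFieldType.

Lemma nonroot_small (P : {poly C}) (t0 : C) : P != 0 -> 0 < t0 ->
  exists t, [/\ 0 < t, t <= t0 & ~~ root P (- t)].
Proof.
move=> P0 t00; pose f (j : nat) := - (t0 / j.+1%:R).
pose s := [seq f j | j <- iota 0 (size P)].
have us : uniq s.
  rewrite map_inj_uniq ?iota_uniq // => i j /oppr_inj/(mulfI (lt0r_neq0 t00))/invr_inj/eqP.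
  by rewrite eqr_nat => /eqP[].
have : ~~ all (root P) s.
  apply/negP => rs; have := max_poly_roots P0 rs us.
  by rewrite size_map size_iota ltnn.
case/allPn => _ /mapP[j _ ->] nr; exists (t0 / j.+1%:R); split=> //.
  by rewrite divr_gt0 ?ltr0n.
by rewrite ler_pdivrMr ?ltr0n // ler_peMr ?ler1n // ltW.
Qed.

Lemma det_addZ_neq0 n (A B : 'M[C]_n) (t : C) : B \in unitmx ->
  ~~ root (char_poly (A *m invmx B)) (- t) -> \det (A + t *: B) != 0.
Proof.
move=> Bu; rewrite -eigenvalue_root_char /eigenvalue /eigenspace negbK kermx_eq0.
rewrite row_free_unit unitmxE unitfE => D.
have -> : A + t *: B = (A *m invmx B - (- t)%:M) *m B.
  by rewrite mulmxBl mulmxKV // mul_scalar_mx scaleNr opprK.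
by rewrite det_mulmx mulf_neq0 // -unitfE -unitmxE.
Qed.

Definition realc (y : nat -> C) (j : nat) : C := if odd j then 'Im (y j./2) else 'Re (y j./2).

(* A point of the moment curve: its real coordinates are the powers of [k], so the
   Vandermonde determinant makes any [2r] of these points independent over the reals. *)
Definition moment (k l : nat) : C := k%:R ^+ l.*2 + 'i * k%:R ^+ l.*2.+1.

Lemma realc_perturb (v : nat -> C) (t : C) k j : t \is Num.real ->
  realc (fun l => v l + t * moment k l) j = realc v j + t * k%:R ^+ j.
Proof.
move=> tr; rewrite /realc /moment.
have re n : (k%:R ^+ n : C) \is Num.real by rewrite rpredX ?realn.
case: ifP => oj; rewrite raddfD /=.
  rewrite ImMl // Im_rect ?re //; congr (_ + _ * _ ^+ _).
  by rewrite -[RHS]odd_double_half oj.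
rewrite ReMl // Re_rect ?re //; congr (_ + _ * _ ^+ _).
by rewrite -[RHS]odd_double_half oj.
Qed.

(** For each selection of at most [r.*2] points a minor of the perturbed real coordinates is, by
    Vandermonde, a nonzero polynomial in [t]; a small [t] avoids the roots of all these minors, and
    then every such selection is independent over the reals. *)
Lemma general_position (r s : nat) (v : 'I_s -> nat -> C) (t0 : C) : 0 < t0 ->
  exists t, [/\ 0 < t, t <= t0 & forall lam : 'I_s -> C,
    (forall k, lam k \is Num.real) -> (#|[pred k | lam k != 0%R]| <= r.*2)%N ->
    (exists k, lam k != 0) ->
    exists2 l, (l < r)%N & \sum_k lam k * (v k l + t * moment k l) != 0].
Proof.
move=> t00.
pose A n (f : {ffun 'I_n -> 'I_s}) : 'M[C]_n := \matrix_(a, j) realc (v (f a)) j.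
pose B n (f : {ffun 'I_n -> 'I_s}) : 'M[C]_n := \matrix_(a, j) (f a)%:R ^+ j.
(* Selections with repetitions make [B] singular, but characteristic polynomials are monic in any
   case, so the product is nonzero. *)
pose P : {poly C} := \prod_(n < r.*2.+1) \prod_(f : {ffun 'I_n -> 'I_s})
  char_poly (A n f *m invmx (B n f)).
have P0 : P != 0.
  apply/prodf_neq0 => n _; apply/prodf_neq0 => f _.
  exact/monic_neq0/char_poly_monic.
have [t [t_gt0 tle nr]] := nonroot_small P0 t00.
exists t; split=> // lam lamr card [k0 k0nz].
set S := [pred k | lam k != 0] in card *.
pose f : {ffun 'I_#|S| -> 'I_s} := [ffun a => enum_val a].
have Bu : B _ f \in unitmx.
  have -> : B _ f = (Vandermonde #|S| (\row_a ((f a : nat)%:R : C)))^T.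
    by apply/matrixP => a j; rewrite !mxE.
  rewrite unitmx_tr unitmxE unitfE det_Vandermonde; apply/prodf_neq0 => i _.
  apply/prodf_neq0 => j ij; rewrite !mxE subr_eq0 eqr_nat /f !ffunE.
  by apply: contraTneq ij => /val_inj/enum_val_inj ->; rewrite ltnn.
have D : \det (A _ f + t *: B _ f) != 0.
  apply: det_addZ_neq0 => //; apply: contraNN nr => rt.
  rewrite /P rootE horner_prod (bigD1 (Ordinal (card : (#|S| < r.*2.+1)%N))) //=.
  by rewrite horner_prod (bigD1 f) //= (eqP rt) !mul0r.
case: (boolP [exists l : 'I_r, \sum_k lam k * (v k l + t * moment k l) != 0]).
  by case/existsP => l Hl; exists l.
rewrite negb_exists => /forallP H0; case/negP: (k0nz).
have Hl l : (l < r)%N -> \sum_k lam k * (v k l + t * moment k l) = 0.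
  by move=> lt; apply/eqP; have := H0 (Ordinal lt); rewrite negbK.
have tr : t \is Num.real by exact: gtr0_real.
have Hj j : (j < r.*2)%N -> \sum_k lam k * (realc (v k) j + t * k%:R ^+ j) = 0.
  move=> lt; have lt2 : (j./2 < r)%N by rewrite ltn_half_double.
  transitivity (realc (fun l => \sum_k lam k * (v k l + t * moment k l)) j); last first.
    by rewrite /realc (Hl _ lt2) !raddf0 if_same.
  rewrite (eq_bigr (fun k => lam k * realc (fun l => v k l + t * moment k l) j)); last first.
    by move=> k _; rewrite realc_perturb.
  rewrite /realc; case: ifP => _; rewrite raddf_sum; apply: eq_bigr => k _ /=.
    by rewrite ImMl.
  by rewrite ReMl.
pose u : 'rV[C]_#|S| := \row_a lam (f a).
have : u *m (A _ f + t *: B _ f) = 0.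
  apply/rowP => j; rewrite !mxE -[RHS](Hj j (leq_trans (ltn_ord j) card)).
  rewrite [RHS](bigID S) /= [X in _ = _ + X]big1 ?addr0; last first.
    by move=> k; rewrite /S /= negbK => /eqP ->; rewrite mul0r.
  have sumS F : \sum_(i | S i) F i = \sum_(a < #|S|) F (enum_val a) :> C.
    by rewrite -(big_enum_val F); apply: eq_bigl => i; rewrite unfold_in.
  by rewrite sumS; apply: eq_bigr => a _; rewrite !mxE /f !ffunE.
have AB : A _ f + t *: B _ f \in unitmx by rewrite unitmxE unitfE.
move=> /(congr1 (mulmx^~ (invmx (A _ f + t *: B _ f)))); rewrite mulmxK // mul0mx => u0.
have k0S : k0 \in S by [].
have /rowP/(_ (enum_rank_in k0S k0)) := u0.
by rewrite !mxE /f !ffunE enum_rankK_in // => ->.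
Qed.

End GeneralPosition.

(** * Fine covers and nonvanishing maps *)

Section SmallCovers.
Variable C : numClosedFieldType.
Hypothesis archi : archimedean_field C.
Hypothesis compact_disc : forall r : C, compact [set z : C | `|z| <= r].

Lemma open_vnear n (d : C) (x : 'rV[C]_n) : 0 < d -> open [set y | vnear d x y].
Proof.
move=> d0; suff -> : [set y | vnear d x y] = ball x d by exact: ball_open.
apply/seteqP; split=> y /=; first by move=> H; split=> // i j; rewrite ord1; exact: H.
by move=> [_ H] i; exact: H.
Qed.

Lemma vnear_refl n (d : C) (x : 'rV[C]_n) : 0 < d -> vnear d x x.
Proof. by move=> d0 i; rewrite subrr normr0. Qed.

Lemma rV_neqP n (x y : 'rV[C]_n) : x != y -> exists i, x 0 i != y 0 i.
Proof. by rewrite -subr_eq0 => /rV0Pn[j]; rewrite !mxE subr_eq0; exists j. Qed.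

Lemma finite_net n (K : set 'rV[C]_n) (U : 'rV[C]_n -> set 'rV[C]_n) : compact K ->
  (forall x, K x -> open (U x) /\ U x x) ->
  exists s : seq 'rV[C]_n, (forall x, x \in s -> K x) /\
    forall x, K x -> exists2 y, y \in s & U y x.
Proof.
move=> cK HU; move: (cK); rewrite compact_cover => /(_ _ K U)[].
- by move=> x /HU[].
- by move=> x Kx; exists x => //; case: (HU x Kx).
move=> D DK KD; exists (finmap.enum_fset D); split.
  by move=> x xD; have := DK x xD; rewrite inE.
by move=> x /KD[y yD Uyx]; exists y.
Qed.

Lemma eventually_all (T : eqType) (s : seq T) (P : nat -> T -> Prop) :
  (forall N N' x, (N <= N')%N -> P N x -> P N' x) ->
  (forall x, x \in s -> exists N, P N x) -> exists N, forall x, x \in s -> P N x.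
Proof.
move=> mono; elim: s => [|x s IHs] H; first by exists 0%N.
have [N HN] := H x (mem_head _ _).
have [|N' HN'] := IHs; first by move=> y ys; apply: H; rewrite in_cons ys orbT.
exists (maxn N N') => y; rewrite in_cons => /orP[/eqP ->|ys].
  by apply: mono HN; rewrite leq_maxl.
by apply: mono (HN' y ys); rewrite leq_maxr.
Qed.

Lemma card_le_I_inj (T : Type) (A : set T) N : (A #<= `I_N)%card ->
  exists F : T -> nat, (forall x, A x -> (F x < N)%N) /\
    (forall x y, A x -> A y -> F x = F y -> x = y).
Proof.
move=> /pcard_leP/unsquash f; exists f; split=> [x Ax|x y Ax Ay].
  exact: (@funS _ _ _ _ f x Ax).
by apply: (@inj _ _ _ f); rewrite inE.
Qed.

Lemma open_preimage n m (phi : 'rV[C]_n -> 'rV[C]_m) (T : set 'rV[C]_m) :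
  (forall i, econt (fun x => phi x 0 i)) -> open T -> open (phi @^-1` T).
Proof.
move=> cphi oT; rewrite openE => x Tx; apply/nbhs_vnear.
have /nbhs_vnear[d d0 Hd] : nbhs (phi x) T by move: oT; rewrite openE; exact.
by have [d' d'0 Hd'] := econt_vnear x cphi d0; exists d' => // y /Hd'/Hd.
Qed.

(** The form in which dimension is used: finitely many open sets of the ambient space, with
    multiplicity counted on [K] only, on which the first [r] functions oscillate by less than
    [e]. *)
Definition fine_covers n r N (K : set 'rV[C]_n) :=
  forall (G : nat -> 'rV[C]_n -> C) (e : C), (forall l, econt (G l)) -> 0 < e ->
  exists s (D : 'I_s -> set 'rV[C]_n),
    [/\ forall i, open (D i), forall x, K x -> exists i, D i x,
        forall x, K x -> (#|[pred i | `[< D i x >]]| <= N)%N &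
        forall i x y l, (l < r)%N -> D i x -> D i y -> `|G l x - G l y| < e].

Lemma fine_fibre n (s : seq 'rV[C]_n) r (G : nat -> 'rV[C]_n -> C) (e : C) :
  (forall l, econt (G l)) -> 0 < e ->
  exists2 d : C, 0 < d & forall a b, a \in s -> b \in s ->
    (forall x y l, (l < r)%N -> vnear d a x -> vnear d a y -> `|G l x - G l y| < e) /\
    (forall x, vnear d a x -> vnear d b x -> a = b).
Proof.
move=> cG e0.
pose P N (ab : 'rV[C]_n * 'rV[C]_n) :=
  (forall x y l, l \in iota 0 r -> vnear N.+1%:R^-1 ab.1 x -> vnear N.+1%:R^-1 ab.1 y ->
     `|G l x - G l y| < e) /\
    (forall x, vnear N.+1%:R^-1 ab.1 x -> vnear N.+1%:R^-1 ab.2 x -> ab.1 = ab.2).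
have [||N HN] := @eventually_all _ [seq (a, b) | a <- s, b <- s] P.
- move=> N N' [a b] /(@inv_mono C) NN' [H1 H2].
  split=> /= [x y l lr|x] /(vnear_le NN') h1 /(vnear_le NN') h2.
    exact: H1.
  exact: H2 h1 h2.
- move=> [a b] _.
  have [N1 HN1] : exists N, forall l, l \in iota 0 r -> forall x y,
     vnear N.+1%:R^-1 a x -> vnear N.+1%:R^-1 a y -> `|G l x - G l y| < e.
    apply: (@eventually_all _ _ (fun N l => forall x y,
     vnear N.+1%:R^-1 a x -> vnear N.+1%:R^-1 a y -> `|G l x - G l y| < e)).
      by move=> N N' l /(@inv_mono C) NN' H x y /(vnear_le NN') h1 /(vnear_le NN'); exact: H.
    move=> l _; have e2 : 0 < e / 2 by rewrite divr_gt0.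
    have [d d0 Hd] := cG l a _ e2; have [N HN] := small_inv archi d0; exists N => x y.
    move=> /(vnear_le (ltW HN))/Hd h1 /(vnear_le (ltW HN))/Hd h2.
    rewrite -(subrKA (G l a)); apply: le_lt_trans (ler_normD _ _) _.
    by rewrite [ltRHS]splitr ltrD // distrC.
  have [N2 HN2] : exists N : nat, forall x, vnear N.+1%:R^-1 a x -> vnear N.+1%:R^-1 b x -> a = b.
    have [->|ab] := eqVneq a b; first by exists 0%N.
    have [i abi] := rV_neqP ab.
    have d0 : 0 < `|a 0 i - b 0 i| / 2 by rewrite divr_gt0 // normr_gt0 subr_eq0.
    have [N HN] := small_inv archi d0.
    exists N => x /(vnear_le (ltW HN))/(_ i) h1 /(vnear_le (ltW HN))/(_ i) h2.
    have : `|a 0 i - b 0 i| < `|a 0 i - b 0 i|.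
      rewrite -{1}(subrKA (x 0 i)); apply: le_lt_trans (ler_normD _ _) _.
      by rewrite [ltRHS]splitr ltrD // distrC.
    by rewrite ltxx.
  exists (maxn N1 N2); split=> /= [x y l lr|x].
    move=> /(vnear_le (inv_mono C (leq_maxl _ _))) h1 /(vnear_le (inv_mono C (leq_maxl _ _))); exact: HN1.
  move=> /(vnear_le (inv_mono C (leq_maxr _ _))) h1 /(vnear_le (inv_mono C (leq_maxr _ _))); exact: HN2 h1.
exists N.+1%:R^-1; first by rewrite invr_gt0.
move=> a b sa sb; have [|H1 H2] := HN (a, b); first exact: allpairs_f.
by split=> // x y l lr; apply: H1; rewrite mem_iota.
Qed.

(** Near a point of [K] outside the fibre, [phi] keeps a distance from [u]; compactness makes this
    distance uniform. *)
Lemma tube n m (K : set 'rV[C]_n) (phi : 'rV[C]_n -> 'rV[C]_m) (u : 'rV[C]_m)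
    (s : seq 'rV[C]_n) (d : C) : compact K -> (forall i, econt (fun x => phi x 0 i)) -> 0 < d ->
  (forall x, K x -> phi x = u -> x \in s) ->
  exists2 e : C, 0 < e & forall x, K x -> vnear e u (phi x) -> exists2 a, a \in s & vnear d a x.
Proof.
move=> cK cphi d0 Hs.
pose P N x := vnear N.+1%:R^-1 u (phi x) -> exists2 a, a \in s & vnear d a x.
have [||N HN] := @compact_uniform C n K P cK.
- by move=> N N' x /(@inv_mono C) NN' H /(vnear_le NN').
- move=> x Kx; have [xs|xs] := boolP (x \in s).
    by exists 0%N, d; split=> // y xy _; exists x.
  have [i ui] : exists i, phi x 0 i != u 0 i.
    by apply: rV_neqP; apply: contraNneq xs => /Hs; exact.
  have d1 : 0 < `|phi x 0 i - u 0 i| / 2 by rewrite divr_gt0 // normr_gt0 subr_eq0.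
  have [d' d'0 Hd'] := cphi i x _ d1; have [N HN] := small_inv archi d1.
  exists N, d'; split=> // y /Hd' h1 /(vnear_le (ltW HN))/(_ i) h2.
  have : `|phi x 0 i - u 0 i| < `|phi x 0 i - u 0 i|.
    rewrite -{1}(subrKA (phi y 0 i)); apply: le_lt_trans (ler_normD _ _) _.
    by rewrite [ltRHS]splitr ltrD // distrC.
  by rewrite ltxx.
by exists N.+1%:R^-1 => [|x Kx]; [rewrite invr_gt0 | exact: HN].
Qed.

(* The preimage of a small open set splits into disjoint neighbourhoods of the points of a
   finite fibre; cutting it into these pieces does not increase the multiplicity. *)
Lemma fine_covers_pullback n m r N (Z : set 'rV[C]_m) (K : set 'rV[C]_n)
    (phi : 'rV[C]_n -> 'rV[C]_m) :
  covering_dim_lt (subset_space Z) N -> compact Z -> compact K ->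
  (forall i, econt (fun x => phi x 0 i)) ->
  (forall u, Z u -> exists s : seq 'rV[C]_n, forall x, phi x = u -> x \in s) ->
  (forall x, K x -> Z (phi x)) -> fine_covers r N K.
Proof.
move=> dimZ cZ cK cphi fibre KZ G e cG e0.
(* [w u] consists of the fibre over [u], a radius of the pieces around its points, and a radius of a
   ball around [u] whose preimage in [K] is covered by the pieces. *)
pose Q u (w : seq 'rV[C]_n * C * C) := Z u -> [/\ 0 < w.1.2, 0 < w.2,
     forall a b, a \in w.1.1 -> b \in w.1.1 ->
    (forall x y l, (l < r)%N -> vnear w.1.2 a x -> vnear w.1.2 a y -> `|G l x - G l y| < e) /\
    (forall x, vnear w.1.2 a x -> vnear w.1.2 b x -> a = b) &
    forall x, K x -> vnear w.2 u (phi x) -> exists2 a, a \in w.1.1 & vnear w.1.2 a x].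
have /choice[w Hw] u : exists w, Q u w.
  have [Zu|nZu] := pselect (Z u); last by exists ([::], 1, 1).
  have [s Hs] := fibre u Zu; have [d d0 Hd] := fine_fibre s r cG e0.
  have [e' e'0 He'] := @tube _ _ K phi u s d cK cphi d0 (fun x _ => Hs x).
  by exists (s, d, e').
have [|L [LZ LW]] := @finite_net _ Z (fun u => [set v | vnear (w u).2 u v]) cZ.
  move=> u Zu; have [_ w0 _ _] := Hw u Zu; split; [exact: open_vnear | exact: vnear_refl].
pose cov u : set (subset_space Z) := [set v | vnear (w u).2 u (\val v)].
have Lcov : open_cover [set cov u | u in [set` L]].
  split.
    move=> _ [u uL <-]; exists [set v | vnear (w u).2 u v] => //.
    by apply: open_vnear; have [] := Hw u (LZ u uL).
  apply/seteqP; split=> // v _; have [u uL uv] := LW _ (set_valP v).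
  by exists (cov u) => //; exists u.
have [|BB [finB [oB cB] refB mulB]] := dimZ _ _ Lcov.
  exact/finite_image/finite_seq.
have /choice[T HT] V : exists T, BB V -> open T /\ \val @^-1` T = V.
  have [BV|nBV] := pselect (BB V); last by exists setT.
  by have [T oT TV] := oB V BV; exists T.
have /choice[c Hc] V : exists u, BB V -> u \in L /\ V `<=` cov u.
  have [BV|nBV] := pselect (BB V); last by exists 0.
  by have [_ [u uL <-] VU] := refB V BV; exists u.
have [bs Ebs] := (finite_seqP BB).1 finB.
have Bbs V : V \in bs -> BB V by rewrite Ebs.
pose L' := undup [seq (V, a) | V <- bs, a <- (w (c V)).1.1].
have L'P Va : Va \in L' -> BB Va.1 /\ Va.2 \in (w (c Va.1)).1.1.
  by rewrite mem_undup => /allpairsPdep[V [a [Vb aw ->]]]; split; first exact: Bbs.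
have W0 V : BB V -> Z (c V) by move=> /Hc[/LZ].
pose D i := let Va := tnth (in_tuple L') i in
  [set x | T Va.1 (phi x) /\ vnear (w (c Va.1)).1.2 Va.2 x].
exists (size L'), D; split.
- move=> i; have [BV aw] := L'P _ (mem_tnth i (in_tuple L')).
  rewrite /D; case: (tnth _ _) BV aw => V a /= BV aw.
  apply: openI; first by apply: open_preimage => //; have [] := HT V BV.
  by apply: open_vnear; have [] := Hw _ (W0 V BV).
- move=> x Kx; pose v : subset_space Z := exist _ (phi x) (mem_set (KZ x Kx)).
  have [V BV Vv] : (\bigcup_(U in BB) U) v by rewrite cB.
  have [oT TV] := HT V BV; have [uL Vu] := Hc V BV.
  have [_ _ _ /(_ x Kx (Vu v Vv))[a aw ax]] := Hw _ (LZ _ uL).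
  have VaL : (V, a) \in L'.
    by rewrite mem_undup; apply/allpairsPdep; exists V, a; split=> //; move: BV; rewrite Ebs.
  have lt : (index (V, a) L' < size L')%N by rewrite index_mem.
  exists (Ordinal lt); rewrite /D (tnth_nth (V, a)) /= nth_index //=; split=> //.
  by move: Vv; rewrite -{1}TV.
- move=> x Kx; pose v : subset_space Z := exist _ (phi x) (mem_set (KZ x Kx)).
  have [F [FN Finj]] := card_le_I_inj (mulB v).
  have Dv i : D i x -> [/\ BB (tnth (in_tuple L') i).1, (tnth (in_tuple L') i).1 v,
     (tnth (in_tuple L') i).2 \in (w (c (tnth (in_tuple L') i).1)).1.1 &
     vnear (w (c (tnth (in_tuple L') i).1)).1.2 (tnth (in_tuple L') i).2 x].
    have [BV aw] := L'P _ (mem_tnth i (in_tuple L')).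
    by rewrite /D => -[TV ax]; split=> //; have [_ <-] := HT _ BV.
  (* For a given [V] the pieces are disjoint, so an index whose set contains [x] is determined by
     [V]. *)
  pose S := [pred i | `[< D i x >]]; pose FF i := F (tnth (in_tuple L') i).1.
  rewrite cardE -(size_map FF) -[N in (_ <= N)%N](size_iota 0); apply: uniq_leq_size.
    rewrite map_inj_in_uniq ?enum_uniq // => i j; rewrite !mem_enum => Hi Hj.
    have Di : D i x := asboolW Hi; have Dj : D j x := asboolW Hj.
    have [BV Vv aw ax] := Dv i Di; have [BV' Vv' aw' ax'] := Dv j Dj; move=> /Finj E.
    have {}E : (tnth (in_tuple L') i).1 = (tnth (in_tuple L') j).1 by apply: E.
    apply/(tuple_uniqP (in_tuple L') (undup_uniq _)); move: E aw ax aw' ax' BV.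
    case: (tnth _ i) => V a; case: (tnth _ j) => V' a' /= <- aw ax aw' ax' BV; congr (_, _).
    by have [_ _ /(_ a a' aw aw')[_ H] _] := Hw _ (W0 V BV); apply: H ax ax'.
  move=> y /mapP[j]; rewrite mem_enum => Hi ->; have Dj : D j x := asboolW Hi.
  by have [BV Vv _ _] := Dv j Dj; rewrite mem_iota FN.
- move=> i x y l lr; have [BV aw] := L'P _ (mem_tnth i (in_tuple L')).
  have [_ _ /(_ _ _ aw aw)[H _] _] := Hw _ (W0 _ BV).
  by move=> Dx Dy; apply: H lr Dx.2 Dy.2.
Qed.
End SmallCovers.

(** * Equivariant maps without zeros *)

Section Nonvanishing.
Variable C : numClosedFieldType.
Hypothesis archi : archimedean_field C.
Hypothesis compact_disc : forall r : C, compact [set z : C | `|z| <= r].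

Definition bump n (d : C) (c x : 'rV[C]_n) : C := \prod_i posp (d - `|c 0 i - x 0 i|).

Lemma bump_ge0 n (d : C) (c x : 'rV[C]_n) : d \is Num.real -> 0 <= bump d c x.
Proof. by move=> dr; apply: prodr_ge0 => i _; apply: posp_ge0; rewrite rpredB ?normr_real. Qed.

Lemma bump_gt0 n (d : C) (c x : 'rV[C]_n) : vnear d c x -> 0 < bump d c x.
Proof. by move=> H; apply: prodr_gt0 => i _; rewrite pospE ?subr_gt0 // subr_ge0 ltW. Qed.

Lemma bump_near n (d : C) (c x : 'rV[C]_n) : d \is Num.real -> bump d c x != 0 -> vnear d c x.
Proof.
move=> dr /prodf_neq0 H i; have := H i isT; apply: contraR => nl.
rewrite posp0 ?eqxx // subr_le0; move: nl; rewrite -real_leNgt ?normr_real //.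
Qed.

Lemma econt_bump n (d : C) (c : 'rV[C]_n) : econt (bump d c).
Proof.
apply: econt_prod => i; apply: econt_posp; apply: econtD; first exact: econt_cst.
apply: econtN; apply: econt_norm; apply: econtD; first exact: econt_cst.
by apply: econtN; exact: econt_coord.
Qed.

Lemma subordinate_functions n (K : set 'rV[C]_n) s (D : 'I_s -> set 'rV[C]_n) :
  compact K -> (forall i, open (D i)) -> (forall x, K x -> exists i, D i x) ->
  exists lam : 'I_s -> 'rV[C]_n -> C,
    [/\ forall i, econt (lam i), forall i x, 0 <= lam i x,
        forall i x, lam i x != 0 -> D i x & forall x, K x -> 0 < \sum_i lam i x].
Proof.
move=> cK oD cov.
have /choice[w Hw] x : exists w : option ('I_s) * C, K x -> exists i, [/\ w.1 = Some i, 0 < w.2 &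
    forall y, vnear w.2 x y -> D i y].
  have [Kx|nKx] := pselect (K x); last by exists (None, 0).
  have [i Dix] := cov x Kx.
  have /nbhs_vnear[d d0 Hd] : nbhs x (D i) by move: (oD i); rewrite openE; exact.
  by exists (Some i, d) => _; exists i.
have [|L [LK LP]] := @finite_net _ _ K (fun x => [set y | vnear (w x).2 x y]) cK.
  by move=> x /Hw[i [_ w0 _]]; split; [exact: open_vnear | exact: vnear_refl].
pose lam i x := \sum_(c <- L | (w c).1 == Some i) bump (w c).2 c x.
have r0 c : c \in L -> (w c).2 \is Num.real by move=> /LK/Hw[i [_ /gtr0_real]].
have l0 i x : 0 <= lam i x.
  by rewrite /lam big_seq_cond; apply: sumr_ge0 => c /andP[cL _]; exact/bump_ge0/r0.
exists lam; split=> //.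
- move=> i; rewrite /lam; elim: (L) => [|c L' IH].
    by under eq_fun do rewrite big_nil; exact: econt_cst.
  case E: ((w c).1 == Some i).
    under eq_fun do rewrite big_cons E; apply: econtD IH; exact: econt_bump.
  by under eq_fun do rewrite big_cons E.
- move=> i x nz.
  have [c cL /andP[/eqP wc bn]] : exists2 c, c \in L & ((w c).1 == Some i) && (bump (w c).2 c x != 0).
    apply/hasP; apply: contraNT nz => /hasPn H; rewrite /lam big_seq_cond big1 // => c /andP[cL wc].
    by have := H c cL; rewrite wc /= negbK => /eqP.
  have [j [wj _ Hj]] := Hw c (LK c cL).
  by move: wj; rewrite wc => -[->]; apply: Hj; apply: bump_near bn; exact: r0.
- move=> x Kx; have [c cL cx] := LP x Kx; have [i [wi _ _]] := Hw c (LK c cL).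
  rewrite (bigD1 i) //= ltr_pwDl //; last by apply: sumr_ge0.
  rewrite /lam (big_rem c) //= wi eqxx ltr_pwDl ?bump_gt0 // big_seq_cond.
  by apply: sumr_ge0 => c' /andP[/mem_rem c'L _]; exact/bump_ge0/r0.
Qed.

(** A map through the nerve of the cover: its value is an average of sample values in general
    position. At most [r.*2] weights are nonzero at a point of [K], so this real combination cannot
    vanish. *)
Lemma perturb_nonvanishing n r (K : set 'rV[C]_n) (G : nat -> 'rV[C]_n -> C) (e : C) :
  fine_covers r r.*2 K -> compact K -> (forall l, econt (G l)) -> 0 < e ->
  exists k : nat -> 'rV[C]_n -> C, [/\ forall l, econt (k l),
    forall l x, (l < r)%N -> K x -> `|k l x - G l x| < e &
    forall x, K x -> exists2 l, (l < r)%N & k l x != 0].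
Proof.
move=> fc cK cG e0; have e2 : 0 < e / 2 by rewrite divr_gt0.
have [s [D [oD cov mult osc]]] := fc G (e / 2) cG e2.
have [lam [clam lam0 lamD lamK]] := subordinate_functions cK oD cov.
have /choice[z Hz] i : exists z, forall y, D i y -> D i z.
  have [[y Dy]|nD] := pselect (exists y, D i y); first by exists y.
  by exists 0 => y Dy; case: nD; exists y.
pose M : C := 1 + \sum_(i < s) \sum_(l < r) `|moment C i l|.
have M0 : 0 < M.
  by rewrite ltr_pwDl // sumr_ge0 // => i _; rewrite sumr_ge0.
have ML (i : 'I_s) l : (l < r)%N -> `|moment C i l| < M.
  move=> lr; apply: (@le_lt_trans _ _ (\sum_(l < r) `|moment C i l|)).
    by rewrite (bigD1 (Ordinal lr)) //= lerDl sumr_ge0.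
  rewrite /M (bigD1 i) //= addrCA ltrDl ltr_pwDl // sumr_ge0 // => j _.
  by rewrite sumr_ge0.
pose v (i : 'I_s) l := G l (z i).
have [t [t0 tle GP]] := general_position r v (divr_gt0 e2 M0).
have [c c0 Hc] := econt_pos archi cK (econt_sum clam) (fun x => sumr_ge0 _ (fun i _ => lam0 i x)) lamK.
(* On [K] this is the sum of the weights, and everywhere it is at least [c], so the quotient is
   continuous on the whole space. *)
pose T x := c + posp (\sum_i lam i x - c).
have cr : c \is Num.real := gtr0_real c0.
have Sr x : \sum_i lam i x \is Num.real by rewrite ger0_real // sumr_ge0.
have TK x : K x -> T x = \sum_i lam i x.
  by move=> /Hc H; rewrite /T pospE ?subr_ge0 // subrKC.
have Tc x : c <= `|T x|.
  have H : 0 <= posp (\sum_i lam i x - c) by rewrite posp_ge0 // rpredB.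
  by rewrite ger0_norm /T ?lerDl // addr_ge0 // ltW.
pose y i l := v i l + t * moment C i l.
exists (fun l x => (\sum_i lam i x * y i l) * (T x)^-1); split.
- move=> l; apply: econtM.
    by apply: econt_sum => i; apply: econtM => //; exact: econt_cst.
  apply: (econt_inv c0) => //; apply: econtD; first exact: econt_cst.
  by apply: econt_posp; apply: econtD; [exact: econt_sum | exact: econt_cst].
- move=> l x lr Kx; have S0 := lamK x Kx.
  have -> : (\sum_i lam i x * y i l) * (T x)^-1 - G l x =
      (\sum_i lam i x * (y i l - G l x)) / \sum_i lam i x.
    under [in RHS]eq_bigr do rewrite mulrBr; rewrite sumrB -mulr_suml mulrBl TK //.
    by congr (_ - _); rewrite mulrAC divff ?mul1r // gt_eqF.
  rewrite normrM normfV (ger0_norm (ltW S0)) ltr_pdivrMr //.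
  apply: le_lt_trans (ler_norm_sum _ _ _) _.
  apply: (@lt_le_trans _ _ (\sum_i lam i x * e)); last by rewrite -mulr_suml mulrC.
  have H i : `|lam i x * (y i l - G l x)| <= lam i x * e ?= iff (lam i x == 0).
    have [->|nz] := eqVneq (lam i x) 0; first by rewrite !mul0r normr0; exact/leif_refl.
    rewrite normrM ger0_norm //; apply/leifP => /=.
    rewrite ltr_pM2l; last by rewrite lt0r nz lam0.
    rewrite /y addrAC; apply: le_lt_trans (ler_normD _ _) _.
    rewrite [ltRHS]splitr; apply: ltrD.
      by apply: osc (lamD _ _ nz) => //; apply: (Hz i x); exact: lamD nz.
    rewrite normrM (gtr0_norm t0); apply: (@lt_le_trans _ _ (t * M)).
      by rewrite ltr_pM2l // ML.
    by rewrite -ler_pdivlMr.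
  rewrite (lt_leif (leif_sum (fun i (_ : xpredT i) => H i))).
  apply/negP => /forallP A; have := S0; rewrite big1 ?ltxx // => i _; exact/eqP/(implyP (A i)).
- move=> x Kx; have S0 := lamK x Kx.
  have [||| l lr nz] := GP (fun i => lam i x).
  + by move=> i; rewrite ger0_real.
  + apply: leq_trans (mult x Kx); apply: subset_leq_card; apply/fintype.subsetP => i; move=> nz.
    exact: asboolT (lamD i x nz).
  + apply/existsP; apply: contraLR (S0); rewrite negb_exists => /forallP H.
    rewrite big1 ?ltxx // => i _; apply/eqP; have := H i; rewrite negbK //.
  by exists l => //; rewrite mulf_neq0 // invr_eq0 TK // gt_eqF.
Qed.
Lemma nonvanishing_bound n r (K : set 'rV[C]_n) (k : nat -> 'rV[C]_n -> C) :
  compact K -> (forall l, econt (k l)) -> (forall x, K x -> exists2 l, (l < r)%N & k l x != 0) ->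
  exists N : nat, forall x, K x -> exists2 l, (l < r)%N & N.+1%:R^-1 < `|k l x|.
Proof.
move=> cK ck nz.
apply: (@compact_uniform C n K (fun N x => exists2 l, (l < r)%N & N.+1%:R^-1 < `|k l x|) cK).
  by move=> N N' x /(@inv_mono C) NN' [l lr H]; exists l => //; exact: le_lt_trans H.
move=> x Kx; have [l lr kx] := nz x Kx.
have d0 : 0 < `|k l x| / 2 by rewrite divr_gt0 // normr_gt0.
have [d' d'0 Hd'] := ck l x _ d0; have [N HN] := small_inv archi d0.
exists N, d'; split=> // y /Hd' xy; exists l => //; apply: lt_trans HN _.
have : `|k l x| < `|k l x| / 2 + `|k l y|.
  by rewrite -{1}(subrK (k l y) (k l x)); apply: le_lt_trans (ler_normD _ _) _; rewrite ltrD2r.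
by rewrite -ltrBlDl {1}[`|k l x|]splitr addrK.
Qed.

Definition clamp (x : C) : C := posp x - posp (x - 1).

Lemma clamp1 x : 1 <= x -> clamp x = 1.
Proof.
by move=> x1; rewrite /clamp !pospE ?subr_ge0 ?(le_trans ler01) // opprB addrCA subrr addr0.
Qed.

Lemma clamp0 x : x <= 0 -> clamp x = 0.
Proof. by move=> x0; rewrite /clamp !posp0 ?subrr // subr_le0 (le_trans x0). Qed.

Lemma clamp_itv x : x \is Num.real -> 0 <= clamp x <= 1.
Proof.
move=> xr; have [x0|x0] := real_leP xr (real0 C); first by rewrite clamp0 // lexx ler01.
have [x1|x1] := real_leP (real1 C) xr; first by rewrite clamp1 // ler01 lexx.
by rewrite /clamp (pospE (ltW x0)) posp0 ?subr_le0 ?(ltW x1) // subr0 (ltW x0) (ltW x1).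
Qed.

Definition plateau n (d : C) (c x : 'rV[C]_n) : C := \prod_i clamp (2 - `|c 0 i - x 0 i| / d).

Lemma plateau1 n (d : C) (c x : 'rV[C]_n) : 0 < d -> vnear d c x -> plateau d c x = 1.
Proof.
move=> d0 H; apply: big1 => i _; apply: clamp1; rewrite lerBrDl -lerBrDr.
by rewrite [_ - 1](_ : _ = 1) ?ler_pdivrMr ?mul1r ?ltW //; rewrite addrK.
Qed.

Lemma plateau0 n (d : C) (c x : 'rV[C]_n) : 0 < d -> plateau d c x != 0 -> vnear (2 * d) c x.
Proof.
move=> d0 /prodf_neq0 H i; have := H i isT; apply: contraR => nl.
rewrite clamp0 ?eqxx // subr_le0 ler_pdivlMr //.
by move: nl; rewrite -real_leNgt ?normr_real // realM ?realn // gtr0_real.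
Qed.

Lemma plateau_le1 n (d : C) (c x : 'rV[C]_n) : 0 < d -> `|plateau d c x| <= 1.
Proof.
move=> d0; have H i : 0 <= clamp (2 - `|c 0 i - x 0 i| / d) <= 1.
  by apply: clamp_itv; rewrite rpredB ?realn // rpred_div ?normr_real // gtr0_real.
rewrite ger0_norm; first by apply: prodr_ile1 => i _; exact: H.
by apply: prodr_ge0 => i _; case/andP: (H i).
Qed.

Lemma econt_plateau n (d : C) (c : 'rV[C]_n) : econt (plateau d c).
Proof.
have H (e : C) i : econt (fun x : 'rV[C]_n => e - `|c 0 i - x 0 i| / d).
  apply: econtD; first exact: econt_cst.
  apply: econtN; apply: econtM; last exact: econt_cst.
  apply: econt_norm; apply: econtD; first exact: econt_cst.
  by apply: econtN; exact: econt_coord.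
apply: econt_prod => i; apply: econtD; first exact/econt_posp/H.
apply: econtN; apply: econt_posp; apply: econtD; first exact: H.
exact: econt_cst.
Qed.

Lemma econt_scale n (F : 'rV[C]_n -> C) (u : C) : econt F -> econt (fun x => F (u *: x)).
Proof.
move=> cF; apply: (econt_comp cF) => i; under eq_fun do rewrite mxE.
by apply: econtM; [exact: econt_cst | exact: econt_coord].
Qed.

(* [K] is away from 0, so the roots of unity move a small ball off itself: the perturbation
   can be made on one ball at a time and spread along its orbit. *)
Lemma equivariant_nonvanishing n r q (z : C) (K : set 'rV[C]_n) (rho : C) :
  q.-primitive_root z -> fine_covers r r.*2 K -> compact K -> 0 < rho ->
  (forall x, K x -> exists i, rho <= `|x 0 i|) -> (forall x, K x -> K (z *: x)) ->
  exists h : nat -> 'rV[C]_n -> C, [/\ forall l, econt (h l),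
    forall l x, h l (z *: x) = z * h l x & forall x, K x -> exists2 l, (l < r)%N & h l x != 0].
Proof.
move=> zq fc cK rho0 Krho Kz; have q0 : (0 < q)%N := prim_order_gt0 zq.
have z1 : z ^+ q = 1 := prim_expr_order zq.
have zn0 : z != 0 by apply: contra_eq_neq z1 => ->; rewrite expr0n gtn_eqF // eq_sym oner_neq0.
set u := z^-1; have uz : u * z = 1 by rewrite mulVf.
have u1 : u ^+ q = 1 by rewrite exprVn z1 invr1.
have Ku j x : K x -> K (u ^+ j *: x).
  move=> Kx; have -> : u = z ^+ q.-1.
    by apply: (mulfI zn0); rewrite -exprS prednK // z1 mulrC.
  rewrite -exprM; elim: (_ * _)%N => [|m IHm]; first by rewrite scale1r.
  by rewrite exprS -scalerA; exact: Kz.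
have [N HN] : exists N : nat, forall j, j \in iota 1 q.-1 -> N.+1%:R^-1 < `|u ^+ j - 1|.
  apply: (@eventually_all _ _ (fun N j => N.+1%:R^-1 < `|u ^+ j - 1|)).
    by move=> N N' j /(@inv_mono C) NN'; exact: le_lt_trans.
  move=> j; rewrite mem_iota add1n prednK // => /andP[j0 jq].
  apply: (small_inv archi); rewrite normr_gt0 subr_eq0; apply: contraTneq jq => uj.
  rewrite -leqNgt dvdn_leq // (prim_order_dvd zq); apply/eqP.
  by rewrite -[z ^+ j]mulr1 -uj -exprMn mulrC uz expr1n.
set kap : C := N.+1%:R^-1 in HN; have kap0 : 0 < kap by rewrite invr_gt0.
(* Nontrivial powers of [u] move a point of [K] by at least [kap * rho = 4 * eta] in some
   coordinate. A point within [eta] of [c] thus has no other orbit point within [2 * eta] of [c],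
   where the plateau ends. *)
pose eta := kap * rho / 4.
have eta0 : 0 < eta by rewrite divr_gt0 // mulr_gt0.
have [|L [LK LP]] := @finite_net _ _ K (vnear eta) cK.
  by move=> x Kx; split; [exact: open_vnear | exact: vnear_refl].
(* Induction on the balls of the net. A uniform lower bound on the balls already treated is carried
   along, because the next correction may halve it. *)
suff [h [ch hz [M HM]]] : exists h : nat -> 'rV[C]_n -> C, [/\ forall l, econt (h l),
    forall l x, h l (z *: x) = z * h l x & exists M : nat,
    forall x c, K x -> c \in L -> vnear eta c x -> exists2 l, (l < r)%N & M.+1%:R^-1 < `|h l x|].
  exists h; split=> // x Kx; have [c cL cx] := LP x Kx.
  have [l lr Hl] := HM x c Kx cL cx; exists l => //.
  by rewrite -normr_gt0 (lt_trans _ Hl) // invr_gt0.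
elim: (L) => [|c L' [h [ch hz [M HM]]]].
  exists (fun _ _ => 0); split=> [l|l x|]; [exact: econt_cst | by rewrite mulr0 | by exists 0%N].
(* The [q] terms of the correction together may use up half of the lower bound reached so far. *)
pose e : C := (2 * M.+1%:R)^-1 / q%:R.
have e0 : 0 < e by rewrite divr_gt0 ?ltr0n // invr_gt0 mulr_gt0.
have [k [ck kh knz]] := perturb_nonvanishing fc cK ch e0.
have [M' HM'] := nonvanishing_bound cK ck knz.
(* The term [j = 0] replaces [h] by [k] near [c]; the others carry the replacement along the
   orbit. *)
pose F l (j : nat) x := plateau eta c (u ^+ j *: x) * (z ^+ j * (k l (u ^+ j *: x) - h l (u ^+ j *: x))).
exists (fun l x => h l x + \sum_(j < q) F l j x); split.
- move=> l; apply: econtD => //; apply: econt_sum => j; apply: econtM.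
    by apply: econt_scale; exact: econt_plateau.
  apply: econtM; first exact: econt_cst.
  by apply: econtD; [|apply: econtN]; apply: econt_scale.
- move=> l x; rewrite hz mulrDr; congr (_ + _).
  rewrite (reindex (@ordS q)) /=; last by apply: onW_bij; exact: ordS_bij.
  rewrite mulr_sumr; apply: eq_bigr => j _; rewrite /F !expr_mod //.
  have -> : u ^+ j.+1 *: (z *: x) = u ^+ j *: x by rewrite scalerA exprSr -mulrA uz mulr1.
  by rewrite exprS; ring.
exists (maxn M' (2 * M.+1)%N) => x c' Kx; rewrite in_cons => /orP[/eqP ->|c'L] near.
  have [l lr Hl] := HM' x Kx; exists l => //.
  suff -> : h l x + \sum_(j < q) F l j x = k l x.
    by apply: le_lt_trans Hl; rewrite inv_mono // leq_maxl.
  rewrite (bigD1 (Ordinal q0)) //= big1 => [|j j0].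
    by rewrite /F !expr0 !scale1r plateau1 // !mul1r addr0 subrKC.
  rewrite /F; have [->|/(plateau0 eta0) near'] := eqVneq (plateau eta c (u ^+ j *: x)) 0.
    by rewrite mul0r.
  have [i xi] := Krho x Kx.
  have : kap * rho < 3 * eta.
    have lt : `|u ^+ j - 1| * `|x 0 i| < 3 * eta.
      rewrite -normrM mulrBl mul1r -(subrKA (c 0 i)); apply: le_lt_trans (ler_normD _ _) _.
      have -> : 3 * eta = 2 * eta + eta by ring.
      by apply: ltrD; [have := near' i; rewrite mxE distrC | exact: near].
    apply: le_lt_trans lt; apply: ler_pM => //; try exact: ltW.
    apply: ltW; apply: HN; rewrite mem_iota add1n prednK // ltn_ord andbT lt0n.
    by apply: contra j0 => /eqP j00; apply/eqP/val_inj.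
  have -> : kap * rho = 4 * eta by rewrite /eta [RHS]mulrC divfK // pnatr_eq0.
  by rewrite ltr_pM2r // ltr_nat.
have [l lr Hl] := HM x c' Kx c'L near; exists l => //.
have small : `|\sum_(j < q) F l j x| <= (2 * M.+1%:R)^-1.
  apply: le_trans (ler_norm_sum _ _ _) _.
  have -> : (2 * M.+1%:R)^-1 = \sum_(j < q) e :> C.
    by rewrite sumr_const card_ord -[RHS]mulr_natr /e divfK // pnatr_eq0 -lt0n.
  apply: ler_sum => j _; rewrite /F normrM normrM normrX.
  have -> : `|z| = 1.
    by apply/eqP; rewrite -(pexpr_eq1 (_ : (0 < q)%N)) // -normrX z1 normr1.
  rewrite expr1n mul1r -[e]mul1r; apply: ler_pM => //; first exact: plateau_le1.
  by apply: ltW; apply: kh => //; exact: Ku.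
apply: le_lt_trans (inv_mono _ (leq_maxr _ _)) _.
apply: (@lt_le_trans _ _ (2 * M.+1%:R)^-1).
  by rewrite ltf_pV2 ?posrE ?mulr_gt0 ?ltr0n // -natrM ltr_nat.
have : M.+1%:R^-1 <= `|h l x + \sum_(j < q) F l j x| + (2 * M.+1%:R)^-1.
  apply: le_trans (ltW Hl) _; rewrite -{1}(addrK (\sum_(j < q) F l j x) (h l x)).
  by apply: le_trans (ler_normB _ _) _; rewrite lerD2l.
have -> : M.+1%:R^-1 = (2 * M.+1%:R)^-1 + (2 * M.+1%:R)^-1 :> C.
  by rewrite invfM mulrC -splitr.
by rewrite lerD2r.
Qed.
End Nonvanishing.

(** * The zero set *)

Section Gauge.
Variable C : numClosedFieldType.
Hypothesis archi : archimedean_field C.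
Hypothesis compact_disc : forall r : C, compact [set z : C | `|z| <= r].

(** Here [t] plays the part of a radius: the function [a] of the proof is 1 at the centre, vanishes
    exactly where [t] is 1, where the [G l] have no common zero, and is -1 from [t = 2] on. *)
Lemma Borsuk_Ulam_gauge (p k n m : nat) (W : nat -> nat) (l0 : 'I_m)
    (t : 'rV[C]_n -> C) (G : nat -> 'rV[C]_n -> C) (rho : C) :
  prime p -> (forall l, (l < m)%N -> (0 < W l)%N /\ (logn p (W l) <= k)%N) ->
  logn p (W l0) = k -> econt t -> (forall x, t x \is Num.real) -> t 0 = 0 -> 0 < rho ->
  (forall x : 'rV[C]_n, (exists i, rho <= `|x 0 i|) -> 2 <= t x) ->
  (forall l, (l < m)%N -> econt (G l)) ->
  (forall l x, (l < m)%N -> (t x <= 0) || (2 <= t x) -> G l x = 0) ->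
  (forall z x, z ^+ (p ^ k.+1) = 1 ->
     t (z *: x) = t x /\ forall l, (l < m)%N -> G l (z *: x) = z ^+ W l * G l x) ->
  (forall x, t x = 1 -> exists2 l, (l < m)%N & G l x != 0) ->
  (n <= (\sum_(l < m | l != l0) p ^ logn p (W l)).+1)%N.
Proof.
move=> p_pr HW Wl0 ct tr t0 rho0 tbig cG Gz equi nz.
pose a x := -1 + posp (2 - t x).
pose Gc l x := if (l < m)%N then G l x else 0.
have cGc l : econt (Gc l) by rewrite /Gc; case lm: (l < m)%N; [exact: cG | exact: econt_cst].
have ca : econt a.
  apply: econtD; first exact: econt_cst.
  apply: econt_posp; apply: econtD; [exact: econt_cst | exact: econtN].
have ar x : a x \is Num.real.
  apply: realD; first by rewrite realN; exact: real1.
  by apply: posp_real; exact: realB (realn _ 2) (tr x).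
have out (x : 'rV[C]_n) : (exists i, rho <= `|x 0 i|) -> a x = -1 /\ forall l, Gc l x = 0.
  move=> /tbig t2; split=> [|l]; first by rewrite /a posp0 ?addr0 // subr_le0.
  by rewrite /Gc; case: ifP => // lm; rewrite Gz // t2 orbT.
pose E x : C := `|a x| ^+ 2 + \sum_(l < m) `|Gc l x| ^+ 2.
have cE : econt E.
  apply: econtD; first by apply: econtX; exact: econt_norm.
  by apply: econt_sum => l; apply: econtX; exact: econt_norm.
have E0 x : 0 <= E x by rewrite addr_ge0 ?exprn_ge0 // sumr_ge0 // => l _; rewrite exprn_ge0.
have E1 x : 0 < E x.
  have [a0|a0] := eqVneq (a x) 0; last first.
    by rewrite ltr_pwDl ?exprn_gt0 ?normr_gt0 // sumr_ge0 // => l _; rewrite exprn_ge0.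
  have t1 : t x = 1.
    have P1 : posp (2 - t x) = 1 by apply/eqP; rewrite -subr_eq0 addrC; exact/eqP.
    have : 0 <= 2 - t x.
      have [//|lt] := real_leP (real0 C) (rpredB (realn _ 2) (tr x)).
      by move: P1; rewrite posp0 ?ltW // => /eqP; rewrite eq_sym oner_eq0.
    move=> /pospE; rewrite P1 => E2.
    by apply: (addIr (- t x)); rewrite subrr; apply: (addrI 1); rewrite addr0 addrA -E2.
  have [l lm Gl] := nz x t1.
  rewrite /E (bigD1 (Ordinal lm)) //= ltr_wpDl ?exprn_ge0 // ltr_pwDl //.
    by rewrite exprn_gt0 // normr_gt0 /Gc lm.
  by rewrite sumr_ge0 // => i _; rewrite exprn_ge0.
pose Kc := @cbox C n rho.
have cK : compact Kc by exact: compact_cbox.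
have inK (x : 'rV[C]_n) : Kc x \/ exists i, rho <= `|x 0 i|.
  have [/existsP[i Hi]|] := boolP [exists i, rho <= `|x 0 i|]; first by right; exists i.
  rewrite negb_exists => /forallP H; left=> i; have := H i.
  by rewrite -real_ltNge ?normr_real ?gtr0_real // => /ltW.
have [c c0 Hc] := econt_pos archi cK cE E0 (fun x _ => E1 x).
have [K1 K10 HK1] := econt_bounded archi cK ca.
have /choice[KG HKG] l : exists kk : C, 0 <= kk /\ forall x, Kc x -> `|Gc l x| <= kk.
  by have [kk kk0 H] := econt_bounded archi cK (cGc l); exists kk.
pose KK := 1 + K1 + \sum_(l < m) KG l.
have KG0 : 0 <= \sum_(l < m) KG l by apply: sumr_ge0 => l _; case: (HKG l).
pose sc (x : 'rV[C]_n) := rho *: x.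
(* A number below both [c], the bound inside the box, and 1, the bound outside, where [a] is -1. *)
have cc : 0 < (c^-1 + 1)^-1 by rewrite invr_gt0 addr_gt0 // invr_gt0.
have out1 (x : 'rV[C]_n) : (exists i, 1 <= `|x 0 i|) -> exists i, rho <= `|sc x 0 i|.
  move=> [i Hi]; exists i; rewrite mxE normrM (gtr0_norm rho0) -[X in X <= _]mulr1.
  by rewrite ler_pM2l.
apply: (@Borsuk_Ulam_bound C p k n m W (fun x => a (sc x))
  (fun l x => Gc l (sc x)) KK (c^-1 + 1)^-1 l0) => //.
- by rewrite !addr_ge0.
- by rewrite /sc scaler0 /a t0 subr0 pospE // addrC -[2]/(1 + 1) addrK.
- by move=> x /out1/out[-> H]; split=> // l _; exact: H.
- by move=> l lm; rewrite /sc scaler0 /Gc lm Gz // t0 lexx.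
- move=> z x /equi H; have [H1 H2] := H (sc x).
  have scz : sc (z *: x) = z *: sc x by rewrite /sc !scalerA mulrC.
  by rewrite scz /a H1; split=> // l lm; rewrite /Gc lm H2.
- move=> x; have [Kx|/out[-> H]] := inK (sc x).
    split; first by apply: le_trans (HK1 _ Kx) _; rewrite /KK -addrA addrCA lerDl addr_ge0.
    move=> l lm; apply: le_trans (proj2 (HKG l) _ Kx) _.
    rewrite /KK (bigD1 (Ordinal lm)) //= addrCA lerDl !addr_ge0 //.
    by apply: sumr_ge0 => i _; case: (HKG i).
  split=> [|l lm]; last by rewrite H normr0 !addr_ge0.
  by rewrite normrN normr1 /KK -addrA lerDl addr_ge0.
- move=> e e0.
  have uc (F : 'rV[C]_n -> C) : econt F -> (forall x y : 'rV[C]_n, (exists i, rho <= `|x 0 i|) ->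
      (exists i, rho <= `|y 0 i|) -> F x = F y) ->
      exists N : nat, forall x y, vnear N.+1%:R^-1 x y -> `|F x - F y| <= e.
    move=> cF cst; have [d d0 Hd] := econt_uniform archi cK cF e0.
    have [N HN] := small_inv archi d0; exists N => x y /(vnear_le (ltW HN)) xy.
    have [Kx|ox] := inK x; first by apply: ltW; exact: Hd.
    have [Ky|oy] := inK y; first by apply: ltW; rewrite distrC; apply: Hd => //; exact: vnear_sym.
    by rewrite (cst x y) // subrr normr0 ltW.
  have [Na HNa] := uc a ca (fun x y ox oy => etrans (proj1 (out x ox)) (esym (proj1 (out y oy)))).
  have [Ng HNg] : exists N, forall l, l \in iota 0 m ->
      forall x y, vnear N.+1%:R^-1 x y -> `|Gc l x - Gc l y| <= e.
    apply: (@eventually_all _ _ (fun N l =>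
      forall x y, vnear N.+1%:R^-1 x y -> `|Gc l x - Gc l y| <= e)).
      by move=> N N' l /(@inv_mono C) NN' H x y /(vnear_le NN'); exact: H.
    move=> l _; apply: uc => // x y ox oy.
    by rewrite (proj2 (out x ox)) (proj2 (out y oy)).
  pose d : C := (maxn Na Ng).+1%:R^-1 / rho / 2.
  exists d; first by rewrite !divr_gt0.
  move=> x y xy; have near : vnear (maxn Na Ng).+1%:R^-1 (sc x) (sc y).
    move=> i; rewrite !mxE -mulrBr normrM (gtr0_norm rho0) mulrC -ltr_pdivlMr //.
    apply: le_lt_trans (xy i) _.
    by rewrite /d ltr_pdivrMr // ltr_pMr ?ltr1n // divr_gt0.
  split; first by apply: HNa; apply: vnear_le near; rewrite inv_mono // leq_maxl.
  move=> l lm; apply: HNg; first by rewrite mem_iota.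
  by apply: vnear_le near; rewrite inv_mono // leq_maxr.
- move=> x; have -> : `|a (sc x)| ^+ 2 + \sum_(l < m) `|Gc l (sc x)| ^+ 2 = E (sc x) by [].
  have [Kx|/out[ax H]] := inK (sc x).
    apply: le_trans (Hc _ Kx); rewrite -[leRHS]invrK lef_pV2 ?posrE ?addr_gt0 ?invr_gt0 //.
    by rewrite lerDl.
  rewrite /E ax normrN normr1 expr1n big1 => [|l _]; last by rewrite H normr0 expr0n.
  by rewrite addr0 invf_le1 ?addr_gt0 ?invr_gt0 // lerDr invr_ge0 ltW.
Qed.
End Gauge.

(** * The unit sphere and compactness of the zero set *)

Section UnitSphereTopology.
Variable C : numClosedFieldType.
Hypothesis archi : archimedean_field C.
Hypothesis compact_disc : forall r : C, compact [set z : C | `|z| <= r].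

Lemma econt_mulmx n m (Q : 'M[C]_(n, m)) j : econt (fun x : 'rV[C]_n => (x *m Q) 0 j).
Proof.
under eq_fun do rewrite mxE; apply: econt_sum => i.
by apply: econtM; [exact: econt_coord | exact: econt_cst].
Qed.

Lemma econt_dot n (B : {dot 'rV[C]_n for Num.conj}) : econt (fun x => B x x).
Proof.
have H x : B x x = \sum_i \sum_j x 0 i * (x 0 j)^* * B (delta_mx 0 i) (delta_mx 0 j).
  rewrite {1 2}[x]row_sum_delta linear_sumlz; apply: eq_bigr => i _.
  rewrite linear_sumr; apply: eq_bigr => j _.
  by rewrite linearZl linearZr /= mulrA.
under eq_fun => x do rewrite H.
apply: econt_sum => i; apply: econt_sum => j; apply: econtM; last exact: econt_cst.
by apply: econtM; [exact: econt_coord | apply: econt_conj; exact: econt_coord].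
Qed.

Lemma homogeneous_lower n (N : 'rV[C]_n -> C) : econt N ->
  (forall a x, N (a *: x) = `|a| ^+ 2 * N x) -> (forall x, x != 0 -> 0 < N x) ->
  exists2 c : C, 0 < c & forall x : 'rV[C]_n, c * (\sum_i `|x 0 i| ^+ 2) <= N x.
Proof.
move=> cN hN pN; pose s (x : 'rV[C]_n) := \sum_i `|x 0 i| ^+ 2.
have N00 : N 0 = 0 by rewrite -(scale0r (0 : 'rV[C]_n)) hN normr0 expr0n mul0r.
have N0 x : 0 <= N x by have [->|/pN/ltW] := eqVneq x 0; rewrite ?N00.
have s0 x : 0 <= s x by apply: sumr_ge0 => i _; rewrite exprn_ge0.
have sle (x : 'rV[C]_n) i : `|x 0 i| ^+ 2 <= s x.
  by rewrite /s (bigD1 i) //= lerDl sumr_ge0 // => j _; rewrite exprn_ge0.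
have cs : econt s by apply: econt_sum => i; apply: econtX; apply: econt_norm; exact: econt_coord.
have sr x : 1 - s x \is Num.real by apply: realB; [exact: real1 | exact: ger0_real].
(* It agrees with [N] where [s x = 1] and is positive everywhere, 0 included, so a positive lower
   bound on a box suffices. *)
pose F x := N x + posp (1 - s x).
have cF : econt F.
  by apply: econtD => //; apply: econt_posp; apply: econtD; [exact: econt_cst | exact: econtN].
have F0 x : 0 <= F x by rewrite addr_ge0 // posp_ge0.
have F1 x : 0 < F x.
  have [->|x0] := eqVneq x 0; last by rewrite ltr_pwDl ?pN // posp_ge0.
  have -> : F 0 = 1.
    rewrite /F N00 add0r /s big1 => [|i _]; last by rewrite mxE normr0 expr0n.
    by rewrite subr0 pospE.
  exact: ltr01.
have [c c0 Hc] := econt_pos archi (compact_cbox compact_disc (r := 1)) cF F0 (fun x _ => F1 x).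
exists c => // x; rewrite -/(s x).
have [->|sx0] := eqVneq (s x) 0; first by rewrite mulr0.
have sx : 0 < s x by rewrite lt0r sx0 s0.
pose y := (sqrtC (s x))^-1 *: x.
have sq0 : 0 < sqrtC (s x) by rewrite sqrtC_gt0.
have nsq : `|(sqrtC (s x))^-1| ^+ 2 = (s x)^-1.
  by rewrite normfV gtr0_norm // exprVn sqrtCK.
have sy : s y = 1.
  rewrite /s; under eq_bigr do rewrite mxE normrM exprMn nsq.
  by rewrite -mulr_sumr mulVf.
have yb : cbox 1 y.
  by move=> i; have := sle y i; rewrite sy expr_le1.
have := Hc y yb; rewrite /F sy subrr posp0 // addr0 hN nsq mulrC.
by rewrite ler_pdivlMr.
Qed.

Lemma econt_sqrt n (F : 'rV[C]_n -> C) (c : C) : 0 < c -> (forall x, c <= F x) ->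
  econt F -> econt (fun x => sqrtC (F x)).
Proof.
move=> c0 Fc cF x e e0; have sc : 0 < sqrtC c by rewrite sqrtC_gt0.
have [d d0 Hd] := cF x (e * sqrtC c) (mulr_gt0 e0 sc); exists d => // y /Hd xy.
have s0 z : sqrtC c <= sqrtC (F z) by rewrite ler_sqrtC // ?qualifE /= ?(ltW c0) ?(le_trans (ltW c0)).
have sp : 0 < sqrtC (F x) + sqrtC (F y).
  by rewrite addr_gt0 // (lt_le_trans sc).
have E : F x - F y = (sqrtC (F x) - sqrtC (F y)) * (sqrtC (F x) + sqrtC (F y)).
  by rewrite -subr_sqr !sqrtCK.
rewrite -(ltr_pM2r sp); move: xy; rewrite E normrM (gtr0_norm sp) => /lt_le_trans; apply.
by rewrite ler_pM2l // (le_trans (s0 x)) // lerDl (le_trans (ltW sc)).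
Qed.

Lemma compact_bounded_closed n (r : C) (A : set 'rV[C]_n) : A `<=` cbox r -> closed A -> compact A.
Proof. by move=> Ar cA; exact: (subclosed_compact cA (compact_cbox compact_disc (r := r)) Ar). Qed.

Section ZeroSet.
Variables (n d : nat) (B : {dot 'rV[C]_n for Num.conj}) (f : 'rV[C]_n -> 'rV[C]_d).
Hypothesis f_cont : {within unit_sphere B, continuous f}.

Lemma within_vnear u e : unit_sphere B u -> 0 < e ->
  exists2 dl : C, 0 < dl & forall v, unit_sphere B v -> vnear dl u v -> vnear e (f u) (f v).
Proof.
move=> Su e0; have /subspace_continuousP/(_ u Su) := f_cont.
have nb : nbhs (f u) [set w | vnear e (f u) w] by apply/nbhs_vnear; exists e.
move=> /(_ _ nb); rewrite /fmap /= nbhs_simpl /within /= => /nbhs_vnear[dl dl0 H].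
by exists dl => // v Sv uv; apply: H.
Qed.

Definition zeros := [set u | unit_sphere B u /\ f u = 0].

Lemma sphere_bounded : exists r : C, unit_sphere B `<=` cbox r.
Proof.
have [|x x0|c c0 Hc] := @homogeneous_lower n (fun x => B x x) (@econt_dot n B).
- by move=> a x; rewrite linearZl linearZr /= mulrA normCK.
- exact: neq0_dnorm_gt0.
exists (1 + c^-1) => u Su i; have ui : `|u 0 i| ^+ 2 <= c^-1.
  rewrite -[leRHS]mul1r ler_pdivlMr // mulrC; apply: le_trans (_ : B u u <= 1); last by rewrite Su.
  apply: le_trans (Hc u); rewrite ler_pM2l // (bigD1 i) //= lerDl.
  by apply: sumr_ge0 => j _; rewrite exprn_ge0.
have [le1|gt1] := real_leP (normr_real (u 0 i)) (real1 C).
  by apply: le_trans le1 _; rewrite lerDl invr_ge0 ltW.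
apply: le_trans (_ : `|u 0 i| ^+ 2 <= _); first by rewrite ler_eXnr // ltW.
by apply: le_trans ui _; rewrite lerDr.
Qed.

Lemma zeros_closed : closed zeros.
Proof.
rewrite -openC openE => u /= nZ; apply/nbhs_vnear.
have [Su|nSu] := pselect (unit_sphere B u).
  have /rV0Pn[i fi] : f u != 0 by apply: contra_notN nZ => /eqP.
  have e0 : 0 < `|f u 0 i| by rewrite normr_gt0.
  have [dl dl0 H] := within_vnear Su e0; exists dl => // v uv [Sv fv].
  by have := H v Sv uv i; rewrite fv mxE subr0 ltxx.
have e0 : 0 < `|B u u - 1| by rewrite normr_gt0 subr_eq0; apply/eqP.
have [dl dl0 H] := @econt_dot n B u _ e0; exists dl => // v /H uv [Sv _].
by move: uv; rewrite Sv ltxx.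
Qed.

Lemma zeros_compact : compact zeros.
Proof.
have [r Hr] := sphere_bounded.
by apply: (@compact_bounded_closed n r _ _ zeros_closed) => u [/Hr].
Qed.

End ZeroSet.
End UnitSphereTopology.

(** * The power map and the gauge it induces *)

Section PowerMap.
Variable C : numClosedFieldType.
Hypothesis archi : archimedean_field C.
Hypothesis compact_disc : forall r : C, compact [set z : C | `|z| <= r].
Variables (n : nat) (e : 'I_n -> nat) (Q : 'M[C]_n).
Hypotheses (e_gt0 : forall i, (0 < e i)%N) (Q_unit : Q \in unitmx).

(* [e i] represents the i-th weight of U, so [phi] below is equivariant from the free weight-one
   action to U, and its fibres are finite. *)
Definition powmap (x : 'rV[C]_n) : 'rV[C]_n := \row_i x 0 i ^+ e i.
Definition phi (x : 'rV[C]_n) : 'rV[C]_n := powmap x *m Q.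

Lemma econt_phi i : econt (fun x => phi x 0 i).
Proof.
rewrite /phi; apply: (econt_comp (econt_mulmx Q i)) => j.
by under eq_fun do rewrite mxE; apply: econtX; exact: econt_coord.
Qed.

Lemma phi0 : phi 0 = 0.
Proof.
rewrite /phi (_ : powmap 0 = 0) ?mul0mx //; apply/rowP => i.
by rewrite !mxE expr0n gtn_eqF.
Qed.

Lemma phi_fibre u : exists s : seq 'rV[C]_n, forall x, phi x = u -> x \in s.
Proof.
pose w := u *m invmx Q.
have /choice[r Hr] i : exists r : seq C, forall c, c ^+ e i = w 0 i -> c \in r.
  have [r Hr] := closed_field_poly_normal ('X^(e i) - (w 0 i)%:P : {poly C}).
  exists r => c Hc; have : root ('X^(e i) - (w 0 i)%:P) c by rewrite rootE !hornerE Hc subrr.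
  rewrite Hr rootZ ?root_prod_XsubC // lead_coefDl ?lead_coefXn ?oner_eq0 //.
  by rewrite size_polyXn size_polyN ltnS (leq_trans (size_polyC_leq1 _)).
pose M := \max_i size (r i).
exists [seq \row_i nth 0 (r i) (g i) | g : {ffun 'I_n -> 'I_M.+1}] => x Hx.
have xr i : x 0 i \in r i.
  by apply: Hr; rewrite /w -Hx /phi mulmxK // mxE.
have lt i : (index (x 0%R i) (r i) < M.+1)%N.
  by rewrite ltnS (leq_trans (index_size _ _)) // leq_bigmax.
apply/mapP; exists [ffun i => Ordinal (lt i)]; first by rewrite mem_enum.
by apply/rowP => i; rewrite mxE ffunE /= nth_index.
Qed.

Lemma phi_scale (z : C) (A : 'M[C]_n) : Q *m A = diag_mx (\row_i z ^+ e i) *m Q ->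
  forall x, phi (z *: x) = phi x *m A.
Proof.
move=> H x; rewrite /phi -mulmxA H mulmxA; congr (_ *m _).
by apply/rowP => i; rewrite mul_mx_diag !mxE exprMn mulrC.
Qed.

Variable B : {dot 'rV[C]_n for Num.conj}.

(** The invariant form of U pulled back along [phi]; the level 1 is the preimage of the unit
    sphere. *)
Definition gauge (x : 'rV[C]_n) : C := B (phi x) (phi x).

Lemma econt_gauge : econt gauge.
Proof. exact: (econt_comp (@econt_dot C n B) econt_phi). Qed.

Lemma gauge_ge0 x : 0 <= gauge x.
Proof. exact: dnorm_ge0. Qed.

Lemma gauge0 : gauge 0 = 0.
Proof. by rewrite /gauge phi0 linear0r. Qed.

Lemma gauge_big : exists2 rho : C, 0 < rho &
  forall x : 'rV[C]_n, (exists i, rho <= `|x 0 i|) -> 2 <= gauge x.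
Proof.
have [|a w|w w0|c c0 Hc] := @homogeneous_lower C archi compact_disc n (fun w => B (w *m Q) (w *m Q)).
- exact: (econt_comp (@econt_dot C n B) (econt_mulmx Q)).
- by rewrite -scalemxAl linearZl linearZr /= mulrA normCK.
- apply: neq0_dnorm_gt0; apply: contraNneq w0 => wQ.
  by rewrite -(mulmxK Q_unit w) wQ mul0mx.
exists (1 + 2 / c); first by rewrite addr_gt0 // divr_gt0.
move=> x [i Hi]; apply: le_trans (Hc (powmap x)).
have x1 : 1 <= `|x 0 i| by apply: le_trans Hi; rewrite lerDl divr_ge0 // ltW.
apply: (@le_trans _ _ (c * `|x 0 i|)).
  by rewrite mulrC -ler_pdivrMr // (le_trans _ Hi) // lerDr.
rewrite ler_pM2l // (bigD1 i) //= mxE normrX -exprM.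
apply: (@le_trans _ _ (`|x 0 i| ^+ (e i * 2))); last first.
  by rewrite lerDl sumr_ge0 // => j _; rewrite exprn_ge0.
by rewrite ler_eXnr // muln_gt0 e_gt0.
Qed.

End PowerMap.

Section Cutoff.
Variable C : numClosedFieldType.

Lemma pos_below (x y : C) : 0 < x -> 0 < y -> exists d : C, [/\ 0 < d, d <= x & d <= y].
Proof.
move=> x0 y0; have s0 : 0 < x^-1 + y^-1 by rewrite addr_gt0 ?invr_gt0.
exists (x^-1 + y^-1)^-1; split; first by rewrite invr_gt0.
  by rewrite -[leRHS]invrK lef_pV2 ?posrE ?invr_gt0 // lerDl invr_ge0 ltW.
by rewrite -[leRHS]invrK lef_pV2 ?posrE ?invr_gt0 // lerDr invr_ge0 ltW.
Qed.

(** Made for an [F] built from a map that is continuous on the sphere only: wherever its continuity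
    is unknown, [chi] vanishes in a neighbourhood. *)
Lemma econt_cutoff n (chi F : 'rV[C]_n -> C) : econt chi ->
  (forall x, (exists2 d : C, 0 < d & forall y, vnear d x y -> chi y = 0) \/
     (forall e : C, 0 < e -> exists2 d : C, 0 < d & forall y, vnear d x y -> `|F x - F y| < e)) ->
  econt (fun x => chi x * F x).
Proof.
move=> cchi H x e e0; case: (H x) => [[d d0 Hd]|cF].
  exists d => // y xy; rewrite (Hd y xy) (Hd x) ?mul0r ?subrr ?normr0 // => i.
  by rewrite subrr normr0.
have e2 : 0 < e / 2 by rewrite divr_gt0.
have X0 : 0 < `|chi x| + 1 by rewrite ltr_wpDl.
have F0 : 0 < `|F x| + 1 by rewrite ltr_wpDl.
have [d1 d10 H1] := cF _ (divr_gt0 e2 X0).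
have [d2 d20 H2] := cF 1 ltr01.
have [d3 d30 H3] := cchi x _ (divr_gt0 e2 F0).
have [d12 [d120 le1 le2]] := pos_below d10 d20.
have [d [d0 le12 dl3]] := pos_below d120 d30.
have dl1 := le_trans le12 le1; have dl2 := le_trans le12 le2.
exists d => // y xy.
have -> : chi x * F x - chi y * F y = chi x * (F x - F y) + (chi x - chi y) * F y by ring.
apply: le_lt_trans (ler_normD _ _) _; rewrite !normrM [ltRHS]splitr; apply: ler_ltD.
  apply: (@le_trans _ _ ((`|chi x| + 1) * (e / 2 / (`|chi x| + 1)))).
    by apply: ler_pM => //; [rewrite lerDl | apply/ltW/H1; exact: vnear_le xy].
  by rewrite mulrC divfK // gt_eqF.
have Fy : `|F y| <= `|F x| + 1.
  rewrite -[F y](subrK (F x)) addrC; apply: le_trans (ler_normD _ _) _.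
  by rewrite lerD2l distrC; apply/ltW/H2; exact: vnear_le xy.
apply: (@le_lt_trans _ _ (`|chi x - chi y| * (`|F x| + 1))).
  by rewrite ler_wpM2l.
by rewrite -ltr_pdivlMr //; apply: H3; exact: vnear_le xy.
Qed.

Lemma fine_covers_le n r N N' (K : set 'rV[C]_n) : (N <= N')%N ->
  fine_covers r N K -> fine_covers r N' K.
Proof.
move=> NN' fc G e cG e0; have [s [D [oD cov m osc]]] := fc G e cG e0.
by exists s, D; split=> // x Kx; apply: leq_trans (m x Kx) NN'.
Qed.

End Cutoff.

(** * The map to V + C^r and the contradiction *)

Section ZeroSetDimension.
Variable C : numClosedFieldType.
Hypothesis archi : archimedean_field C.
Hypothesis compact_disc : forall r : C, compact [set z : C | `|z| <= r].

Lemma zero_set_dimension (p k : nat) (p_prime : prime p)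
  (d : nat) (rV : mx_representation C (Zpk p k) d)
  (V_nofix : rfix_mx rV (Zpk p k) = 0)
  (n : nat) (rU : mx_representation C (Zpk p k) n)
  (B : {dot 'rV[C]_n for Num.conj}) (B_inv : invariant_form rU B)
  (f : 'rV[C]_n -> 'rV[C]_d)
  (f_cont : {within unit_sphere B, continuous f})
  (f_equiv : forall g u, unit_sphere B u -> f (u *m rU g) = f u *m rV g)
  (mk_neq0 : rep_mult rV k <> 0%N) (r N : nat) :
  n%:Z = rep_delta rV + 1 + r%:Z -> (N <= r.*2)%N ->
  ~ covering_dim_lt (subset_space (zeros B f)) N.
Proof.
move=> n_eq N_le dimZ; pose q := (p ^ k.+1)%N.
have q0 : (0 < q)%N by rewrite expn_gt0 prime_gt0.
have [z zq] := prim_root_exists C q0.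
have [S [a [Su a_lt Sd]]] := cyclic_diagonalize p_prime zq rV.
have [Q [b [Qu b_lt Qd]]] := cyclic_diagonalize p_prime zq rU.
have val1 : ((1%R : 'Z_q) : nat) = 1%N by [].
have Zpk1 : Zpk p k = <[(1%:R : 'Z_q)]>%g :> {set _}.
  apply/setP => g; rewrite !inE; apply/esym/cycleP; exists g.
  by rewrite -[LHS]/g; exact: (Zpk_exp g).
have a_gt0 i : (0 < a i)%N.
  have := rank_rfix p_prime zq Su Sd Zpk1; rewrite V_nofix mxrank0 => /esym/card0_eq/(_ i).
  by rewrite !inE muln1 lt0n; apply: contraFneq => ->; exact: dvdn0.
have [l0 l0k] : exists l0, logn p (a l0) = k.
  move: mk_neq0; rewrite (rep_mult_card p_prime zq Su Sd (leqnn k) a_gt0) => /eqP.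
  by rewrite -lt0n => /card_gt0P[l0]; rewrite inE => /eqP ?; exists l0.
(* The weight 0 is represented by [q], since the exponent 0 would make the power map constant in
   that coordinate. *)
pose e i := if b i == 0%N then q else b i.
have e_gt0 i : (0 < e i)%N by rewrite /e; case: eqP => // /eqP; rewrite -lt0n.
have Qe : Q *m rU 1%R = diag_mx (\row_i z ^+ e i) *m Q.
  rewrite Qd; congr (diag_mx _ *m _); apply/rowP => i; rewrite !mxE val1 muln1 /e.
  by case: eqP => // ->; rewrite expr0 (prim_expr_order zq).
pose ph := @phi C n e Q; pose t := @gauge C n e Q B.
have phz x : ph (z *: x) = ph x *m rU 1%R by exact: phi_scale.
have cph i : econt (fun x => ph x 0 i) by exact: econt_phi.
have tz x : t (z *: x) = t x by rewrite /t /gauge -/(ph _) phz B_inv ?inE.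
have ct : econt t by exact: econt_gauge.
have t0 x : 0 <= t x by exact: gauge_ge0.
have tr x : t x \is Num.real by exact: ger0_real.
have [rho rho0 tbig] := gauge_big archi compact_disc e_gt0 Qu B.
pose Z := zeros B f; have cZ : compact Z by exact: zeros_compact.
pose K := ph @^-1` Z.
have cK : compact K.
  apply: (@compact_bounded_closed C compact_disc n rho).
    move=> x [tx _] i; have [//|lt] := real_leP (normr_real (x 0 i)) (gtr0_real rho0).
    have /tbig : exists i, rho <= `|x 0 i| by exists i; exact: ltW.
    by rewrite -/(t x) [t x]tx lern1.
  rewrite -openC; apply: (@open_preimage C n n ph (~` Z)) => //.
  by rewrite openC; exact: zeros_closed.
have fc : fine_covers r r.*2 K.
  apply: (fine_covers_le N_le).
  have := @fine_covers_pullback C archi n n r N Z K ph dimZ cZ cK cph.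
  by apply=> [u _|x Kx //]; exact: (phi_fibre e_gt0 Qu).
have Kz x : K x -> K (z *: x).
  move=> [Sx fx]; split; first exact: etrans (tz x) Sx.
  by rewrite phz f_equiv // fx mul0mx.
have [rho' rho'0 Krho] : exists2 rho' : C, 0 < rho' & forall x, K x -> exists i, rho' <= `|x 0 i|.
  have [dl dl0 Hd] := ct 0 1 ltr01; exists dl => // x [Sx _].
  apply/existsP; apply: contraT; rewrite negb_exists => /forallP H.
  have : vnear dl 0 x.
    by move=> i; have := H i; rewrite -real_ltNge ?normr_real ?gtr0_real // mxE sub0r normrN.
  by move=> /Hd; rewrite [t 0]gauge0 // sub0r normrN [t x]Sx normr1 ltxx.
have [h [ch hz hnz]] := equivariant_nonvanishing archi zq fc cK rho'0 Krho Kz.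
(* [t] cut off below at 1 / 4, so that the normalization [psi] is continuous even at 0. *)
pose s x := 4^-1 + posp (t x - 4^-1).
have i4 : 0 < 4^-1 :> C by rewrite invr_gt0.
have s4 x : 4^-1 <= s x.
  by rewrite /s lerDl posp_ge0 //; apply: realB => //; exact: gtr0_real.
have sE x : 4^-1 <= t x -> s x = t x by move=> le; rewrite /s pospE ?subr_ge0 // subrKC.
have cs : econt s.
  apply: econtD; first exact: econt_cst.
  by apply: econt_posp; apply: econtD => //; exact: econt_cst.
have sq0 x : 0 < sqrtC (s x) by rewrite sqrtC_gt0 (lt_le_trans i4).
pose psi x := (sqrtC (s x))^-1 *: ph x.
have psiS x : 4^-1 <= t x -> unit_sphere B (psi x).
  move=> le; rewrite /unit_sphere /= linearZl linearZr /= mulrA -normCK normfV gtr0_norm //.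
  by rewrite exprVn sqrtCK -[B _ _]/(t x) sE // mulVf // gt_eqF // (lt_le_trans i4).
have cpsi i : econt (fun x => psi x 0 i).
  under eq_fun do rewrite mxE; apply: econtM => //.
  apply: (@econt_inv C n _ (sqrtC 4^-1)); first by rewrite sqrtC_gt0.
    move=> x; rewrite gtr0_norm // ler_sqrtC // qualifE /= ?(ltW i4) //.
    exact: le_trans (ltW i4) (s4 x).
  exact: econt_sqrt i4 s4 cs.
(* Nonzero only for 1 / 2 < t < 2. Since [psi] is on the sphere as soon as 1 / 4 <= t, it is so on a
   neighbourhood of each point with 1 / 2 <= t. *)
pose chi x := posp (2 - t x) * posp (t x - 2^-1).
have cchi : econt chi.
  apply: econtM; apply: econt_posp; apply: econtD => //; try exact: econt_cst.
  exact: econtN.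
have chi_lo x : t x <= 2^-1 -> chi x = 0.
  by move=> le; rewrite /chi [X in _ * X]posp0 ?mulr0 // subr_le0.
have chi_hi x : 2 <= t x -> chi x = 0.
  by move=> le; rewrite /chi posp0 ?mul0r // subr_le0.
(* First the coordinates of [f (psi x)] in the eigenbasis of V, then those of [h], which have weight
   1. *)
pose F (l : nat) x :=
  if (insub l : option 'I_d) is Some i then (f (psi x) *m invmx S) 0 i else h (l - d)%N x.
pose W (l : nat) := if (insub l : option 'I_d) is Some i then a i else 1%N.
have Wl i : W (lshift r (i : 'I_d)) = a i by rewrite /W /= valK.
have Wr i : W (rshift d (i : 'I_r)) = 1%N.
  by rewrite /W /= insubN // -leqNgt leq_addr.
have h24 : 4^-1 < 2^-1 :> C by rewrite ltf_pV2 ?posrE // ltr_nat.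
have lo x : t x < 2^-1 \/ 2^-1 <= t x.
  by have [] := real_leP (gtr0_real (_ : 0 < 2^-1 :> C)) (tr x); rewrite ?invr_gt0 //; [right | left].
have Fz l x : 2^-1 <= t x -> F l (z *: x) = z ^+ W l * F l x.
  move=> le; rewrite /F /W; case: insubP => [i _ _|_]; last by rewrite hz expr1.
  have -> : psi (z *: x) = psi x *m rU 1%R.
    by rewrite /psi /s tz phz scalemxAl.
  rewrite f_equiv; last by apply: psiS; exact: le_trans (ltW h24) le.
  have Sd1 : rV 1%R *m invmx S = invmx S *m diag_mx (\row_i z ^+ a i).
    apply: (can_inj (mulKmx Su)); rewrite mulmxA Sd mulmxK // mulKVmx //.
    by congr diag_mx; apply/rowP => j; rewrite !mxE val1 muln1.
  by rewrite -mulmxA Sd1 mulmxA mul_mx_diag !mxE mulrC.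
have Gz l x : chi (z *: x) * F l (z *: x) = z ^+ W l * (chi x * F l x).
  have chiz : chi (z *: x) = chi x by rewrite /chi tz.
  rewrite chiz; case: (lo x) => [/ltW/chi_lo ->|/Fz ->]; first by rewrite !mul0r mulr0.
  by rewrite mulrCA.
have cG l : econt (fun x => chi x * F l x).
  apply: econt_cutoff => // x; case: (lo x) => [lt|le].
    left; have gap : 0 < 2^-1 - t x by rewrite subr_gt0.
    have [dl dl0 Hd] := ct x _ gap.
    exists dl => // y /Hd xy; apply: chi_lo.
    have : t y - t x < 2^-1 - t x.
      by rewrite distrC in xy; apply: le_lt_trans xy; apply: real_ler_norm; exact: realB.
    by rewrite ltrD2r => /ltW.
  right=> ep ep0; rewrite /F; case: insubP => [i _ _|_]; last exact: ch.
  have Sx : unit_sphere B (psi x) by apply: psiS; exact: le_trans (ltW h24) le.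
  have [d1 d10 H1] := econt_mulmx (invmx S) i (f (psi x)) ep0.
  have [d2 d20 H2] := within_vnear f_cont Sx d10.
  have [d3 d30 H3] := econt_vnear x cpsi d20.
  have gap : 0 < 2^-1 - 4^-1 :> C by rewrite subr_gt0.
  have [d4 d40 H4] := ct x _ gap.
  have [d5 [d50 d53 d54]] := pos_below d30 d40.
  exists d5 => // y xy; apply: H1; apply: H2; last by apply: H3; exact: vnear_le xy.
  apply: psiS; have : t x - t y < 2^-1 - 4^-1.
    by apply: le_lt_trans (H4 y (vnear_le d54 xy)); apply: real_ler_norm; exact: realB.
  by move=> /ltW /(lerB le); rewrite !subKr.
have bound : (n <= (\sum_(l < d + r | l != lshift r l0) p ^ logn p (W l)).+1)%N.
  apply: (@Borsuk_Ulam_gauge C archi compact_disc p k n (d + r) W (lshift r l0) t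
    (fun l x => chi x * F l x) rho) => //.
  - move=> l _; rewrite /W; case: insubP => [i _ _|_]; last by rewrite logn1.
    by rewrite a_gt0 logn_le.
  - by rewrite Wl.
  - exact: gauge0.
  - move=> l x _ /orP[le|/chi_hi ->]; last by rewrite mul0r.
    by rewrite chi_lo ?mul0r // (le_trans le) // invr_ge0.
  - move=> z' x z'q; have [j ->] := prim_rootP zq z'q.
    elim: (j : nat) => [|jj [IH1 IH2]].
      by rewrite expr0 scale1r; split=> // l _; rewrite expr1n mul1r.
    rewrite exprS -scalerA tz; split=> // l lm.
    by rewrite Gz IH2 // exprMn mulrA.
  - move=> x tx; have le : 2^-1 <= t x by rewrite tx invf_le1 // ler1n.
    have chi0 : chi x != 0.
      have E2 : 1 - 2^-1 = 2^-1 :> C by rewrite [X in X - _](splitr 1) mul1r addrK.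
      have E3 : 2 - 1 = 1 :> C by rewrite -[2]/(1 + 1) addrK.
      by rewrite /chi tx E3 E2 !pospE ?invr_ge0 // mul1r invr_eq0 pnatr_eq0.
    have le4 := le_trans (ltW h24) le; have pE : psi x = ph x.
      by rewrite /psi sE // tx sqrtC1 invr1 scale1r.
    (* If [f] vanishes the point lies in [K], where some coordinate of [h] does not. *)
    have [fx|fx] := eqVneq (f (ph x)) 0.
      have [l lr hl] := hnz x (conj tx fx).
      exists (d + l)%N; first by rewrite ltn_add2l.
      by rewrite mulf_neq0 // /F insubN ?addKn // -leqNgt leq_addr.
    have /rV0Pn[i Hi] : f (psi x) *m invmx S != 0.
      by apply: contraNneq fx => E0; rewrite -pE -(mulmxKV Su (f (psi x))) E0 mul0mx.
    exists i; first by rewrite (leq_trans (ltn_ord i)) // leq_addr.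
    by rewrite mulf_neq0 // /F valK.
(* Each of the [r] coordinates of weight 1 contributes 1, so the bound reads n <= delta(V) + r,
   which is n - 1. *)
move: bound; rewrite big_split_ord /=.
rewrite (eq_bigl (fun i => i != l0)) => [|i]; last by rewrite eq_lshift.
rewrite (eq_bigr (fun i => p ^ logn p (a i))%N) => [|i _]; last by rewrite Wl.
rewrite [X in (_ + X)%N](eq_bigr (fun=> 1%N)) => [|i _]; last by rewrite Wr logn1 expn0.
rewrite [X in (_ + X)%N](eq_bigl xpredT) => [|i]; last by rewrite eq_rlshift.
rewrite sum1_card card_ord => bound.
move: n_eq; rewrite (rep_delta_sum p_prime zq Su a_lt Sd a_gt0 l0k).
move: bound; move: (\sum_(i | i != l0) _)%N => sm; clear.
by rewrite -addn1 -addn1 -!PoszD => le [E]; move: le; rewrite E; lia.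
Qed.
End ZeroSetDimension.

Lemma closed_disc (C : numClosedFieldType) (r : C) : r \is Num.real ->
  closed [set z : C | `|z| <= r].
Proof.
move=> rr; rewrite -openC openE => z /= /negP; rewrite -real_ltNge ?normr_real // => lt.
apply/nbhs_ballP; exists (`|z| - r); first by rewrite /= subr_gt0.
move=> w; rewrite /ball /= => zw; apply/negP; rewrite -real_ltNge ?normr_real //.
move: zw; rewrite ltrBrDr -ltrBrDl => /lt_le_trans; apply.
by rewrite lerBlDl; apply: le_trans (ler_normD _ _); rewrite subrK.
Qed.

Lemma normC_le_parts (R : rcfType) (x y : R) : `|(x +i* y)%C : R[i]| <= (`|x| + `|y|)%:C%C.
Proof.
rewrite normc_def lecR /= -[leRHS]ger0_norm ?addr_ge0 // -[leRHS]sqrtr_sqr.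
rewrite ler_sqrt ?exprn_ge0 ?addr_ge0 // sqrrD !real_normK ?num_real // addrAC.
by rewrite lerDl mulrn_wge0 // mulr_ge0.
Qed.

Lemma normC_ge_parts (R : rcfType) (z : R[i]) :
  `|complex.Re z|%:C%C <= `|z| /\ `|complex.Im z|%:C%C <= `|z|.
Proof.
rewrite normc_def !lecR -!sqrtr_sqr; split; rewrite ler_sqrt ?addr_ge0 ?sqr_ge0 //.
  by rewrite lerDl sqr_ge0.
by rewrite lerDr sqr_ge0.
Qed.

Lemma archimedean_cplx (R : realType) : archimedean_field (cplx R).
Proof.
case=> a b; rewrite /cplx lecE /= => /andP[/eqP b0 a0].
exists (Num.trunc a).+1; rewrite -(rmorph_nat (@real_complex R)) b0 lecR.
exact/ltW/truncnS_gt.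
Qed.

Lemma compact_disc_cplx (R : realType) (r : cplx R) :
  compact [set z : cplx R | `|z| <= r].
Proof.
(* A bound that is not real admits no [z] at all, since it would have to be nonnegative. *)
have [rr|nr] := boolP (r \is Num.real); last first.
  rewrite (_ : [set z | _] = set0); first exact: compact0.
  apply/seteqP; split=> // z /= zr; case/negP: nr.
  by apply: ger0_real; exact: le_trans zr.
pose s : R := complex.Re r.
pose h (xy : R * R) : cplx R := (xy.1 +i* xy.2)%C.
have ch : continuous h.
  move=> [x y] P /nbhs_ballP[e /= e0 He].
  have [e' [e'0 ee']] : exists e' : R, 0 < e' /\ e = (e')%:C%C.
    case: e e0 He => e1 e2; rewrite /cplx ltcE /= => /andP[/eqP -> e10] _.
    by exists e1.
  apply/nbhs_ballP; exists (e' / 2); first by rewrite /= divr_gt0.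
  move=> [x' y'] [/= bx by_]; apply: He; rewrite /ball /= /h /=.
  rewrite (_ : _ - _ = ((x - x') +i* (y - y'))%C) //.
  apply: le_lt_trans (normC_le_parts _ _) _; rewrite ee' ltcR [ltRHS]splitr.
  by apply: ltrD.
have cS : compact (h @` (`[- s, s] `*` `[- s, s])).
  apply: continuous_compact; first exact: continuous_subspaceT.
  by apply: compact_setX; exact: segment_compact.
apply: (subclosed_compact (closed_disc rr) cS) => z /= zr.
have [Hre Him] := normC_ge_parts z.
have rs : r = s%:C%C.
  rewrite /s; move: rr; rewrite realE; case: (r) => a b; rewrite !lecE /=.
  by case/orP => /andP[/eqP E _]; rewrite ?E // -E.
have itv (x : R) : `|x|%:C%C <= `|z| -> x \in `[- s, s].
  by move=> H; have := le_trans H zr; rewrite rs lecR ler_norml in_itv.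
exists (complex.Re z, complex.Im z); last by rewrite /h; case: (z).
by split; apply: itv.
Qed.

Theorem corollary3p9 (R : realType) (p k : nat) (p_prime : prime p)
  (d : nat) (rV : mx_representation (cplx R) (Zpk p k) d)
  (V_nofix : rfix_mx rV (Zpk p k) = 0)
  (n : nat) (rU : mx_representation (cplx R) (Zpk p k) n)
  (B : {dot 'rV[cplx R]_n for Num.conj}) (B_inv : invariant_form rU B)
  (f : 'rV[cplx R]_n -> 'rV[cplx R]_d)
  (f_cont : {within unit_sphere B, continuous f})
  (f_equiv : forall g u, unit_sphere B u -> f (u *m rU g) = f u *m rV g)
  (mk_neq0 : rep_mult rV k <> 0%N)
  (n_gt : rep_delta rV < n%:Z) :
  ((2 * (n%:Z - rep_delta rV - 1))%:~R%:E
     <= covering_dim (subset_space [set u | unit_sphere B u /\ f u = 0%R]) R)%E.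
Proof.
have archi : archimedean_field (cplx R) by exact: archimedean_cplx.
have cd : forall r : cplx R, compact [set z : cplx R | `|z| <= r] by exact: compact_disc_cplx.
(* The infimum is taken over the numbers N - 1, so the claim amounts to 2r < N for every such N. *)
apply/ereal_infP => _ [N dimN <-]; rewrite lee_fin.
have [r Er] : exists r : nat, n%:Z = rep_delta rV + 1 + r%:Z.
  exists (absz (n%:Z - rep_delta rV - 1)%R); rewrite gez0_abs; first by ring.
  by rewrite subr_ge0 lerBrDr addrC lezD1.
have ltN : (r.*2 < N)%N.
  rewrite ltnNge; apply/negP => leN.
  exact: (zero_set_dimension archi cd p_prime V_nofix B_inv f_cont f_equiv mk_neq0 Er leN dimN).
have -> : n%:Z - rep_delta rV - 1 = r%:Z by rewrite Er; ring.
have -> : 2 * r%:Z = r.*2%:Z by rewrite -mul2n PoszM.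
rewrite -[1]/(1%:R) -natrB ?(leq_ltn_trans _ ltN) // ler_nat.
by rewrite leq_subRL ?(leq_ltn_trans _ ltN) // add1n.
Qed.
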